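(* Let $\phi$ be the cusp map. There exist constants $c_1 > c_2 > 0$ and $A, B > 0$ such that the approximation numbers of the composition operator $C_\phi : H^2\to H^2$ satisfy, for every integer $n \geq 2$: $$A\, e^{-c_1 n/\log n} \leq a_n(C_\phi) \leq B\, e^{-c_2 n/\log n}.$$
   Context: $\mathbb{D}$ is the open unit disk. For an analytic $\phi : \mathbb{D} \to \mathbb{D}$, $C_\phi(f) = f\circ\phi$ is the composition operator on the Hardy space $H^2$ of the disk (always bounded). The approximation numbers of a bounded operator $T$ are $a_n(T) = \inf\{\|T - R\| : \mathrm{rank}\,(R) < n\}$, $n = 1,2,\ldots$ The cusp map $\phi$ is defined as follows. For $z\in\mathbb{D}$ put $$\phi_0(z) = \frac{\Big(\frac{z-i}{iz-1}\Big)^{1/2} - i}{-i\Big(\frac{z-i}{iz-1}\Big)^{1/2} + 1},$$ where $z\mapsto \frac{z-i}{iz-1}$ maps $\mathbb{D}$ onto the upper half-plane and the square root is the branch mapping the upper half-plane onto the first open quadrant; $\phi_0$ maps $\mathbb{D}$ conformally onto the half-disk $\{z\in\mathbb{D} : \mathrm{Re}\, z > 0\}$. Then set $\phi_1 = \log\phi_0$ (principal branch), $\phi_2 = -\frac{2}{\pi}\phi_1 + 1$, $\phi_3 = 1/\phi_2$, and $\phi = 1 - \phi_3$. The map $\phi$ sends $\mathbb{D}$ conformally onto a domain in $\mathbb{D}$ bounded by three circular arcs of radius $1/2$ with respective centers $1/2$, $1+i/2$, $1-i/2$. *)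

(* Defs.v *)
From Stdlib Require Import Reals.
From Coquelicot Require Import Coquelicot.
Open Scope R_scope.

Definition in_disk (z : C) : Prop := Cmod z < 1.

(** ** The Hardy space of the disk

    A function on the disk is represented by a function [C -> C] of which only
    the values on the disk matter. *)

Definition taylor (f : C -> C) (a : nat -> C) : Prop :=
  forall z : C, in_disk z -> @is_pseries C_AbsRing C_NormedModule a z (f z).

Definition square_summable (a : nat -> C) : Prop :=
  ex_series (fun n => Cmod (a n) ^ 2).

Definition in_H2 (f : C -> C) : Prop :=
  exists a : nat -> C, taylor f a /\ square_summable a.

(** Taylor coefficients are unique, so the infimum is over at most one number;
    it is [p_infty] when [f] is not in the Hardy space. *)
Definition H2_norm (f : C -> C) : Rbar :=
  Glb_Rbar (fun N => exists a : nat -> C,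
    taylor f a /\ square_summable a /\
    N = sqrt (Series (fun n => Cmod (a n) ^ 2))).

(** ** Operators on the Hardy space and their approximation numbers *)

Definition op : Type := (C -> C) -> (C -> C).

(** For a linear [T], equal to [p_infty] when [T] does not map the Hardy space
    to itself or is unbounded. *)
Definition op_norm (T : op) : Rbar :=
  Rbar_lub (fun N => exists f : C -> C,
    in_H2 f /\ Rbar_le (H2_norm f) 1 /\ N = H2_norm (T f)).

Definition linear_op (T : op) : Prop :=
  forall (f g : C -> C) (c : C), in_H2 f -> in_H2 g ->
  forall z : C, in_disk z ->
    T (fun w => c * f w + g w)%C z = (c * T f z + T g z)%C.

(** Boundedness also makes [T f], on the disk, depend only on the values of [f]
    on the disk. *)
Definition bounded_linear_op (T : op) : Prop :=
  (forall f : C -> C, in_H2 f -> in_H2 (T f)) /\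
  linear_op T /\ is_finite (op_norm T).

(** The range lies in the span of [k < n] functions [e 1], ..., [e k]
    (the sum is empty when [k = 0]). *)
Definition rank_lt (T : op) (n : nat) : Prop :=
  exists (k : nat) (e : nat -> C -> C),
    (k < n)%nat /\
    (forall i : nat, (1 <= i <= k)%nat -> in_H2 (e i)) /\
    forall f : C -> C, in_H2 f ->
    exists c : nat -> C, forall z : C, in_disk z ->
      T f z = @sum_n_m C_AbelianMonoid (fun i => c i * e i z)%C 1 k.

Definition op_sub (T S : op) : op := fun f z => (T f z - S f z)%C.

Definition approx_number (n : nat) (T : op) : Rbar :=
  Rbar_glb (fun d => exists S : op,
    bounded_linear_op S /\ rank_lt S n /\ d = op_norm (op_sub T S)).

Definition comp_op (phi : C -> C) : op := fun f z => f (phi z).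

(** ** The cusp map *)

(** Principal argument, in ]-PI, PI] for [z <> 0]. *)
Definition Carg (z : C) : R :=
  if Rle_dec 0 (Im z) then acos (Re z / Cmod z) else - acos (Re z / Cmod z).

Definition Clog (z : C) : C := (ln (Cmod z), Carg z).

(** Principal square root; it maps the open upper half-plane onto the open
    first quadrant. *)
Definition Csqrt (z : C) : C :=
  (sqrt (Cmod z) * cos (Carg z / 2), sqrt (Cmod z) * sin (Carg z / 2)).

Definition cusp0 (z : C) : C :=
  let s := Csqrt ((z - Ci) / (Ci * z - 1))%C in
  ((s - Ci) / (- Ci * s + 1))%C.

Definition cusp1 (z : C) : C := Clog (cusp0 z).

Definition cusp2 (z : C) : C := (- RtoC (2 / PI) * cusp1 z + 1)%C.

Definition cusp3 (z : C) : C := (1 / cusp2 z)%C.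

Definition cusp (z : C) : C := (1 - cusp3 z)%C.

(* Main.v *)
Require Import Defs.
From Stdlib Require Import Reals Lra Lia Psatz ClassicalEpsilon FunctionalExtensionality.
From Coquelicot Require Import Coquelicot.
Open Scope R_scope.

(** The real part [x] of [cusp2 z] is the natural coordinate at the cusp: [cusp2]
    maps the disk onto the half-strip [x > 1, |y| < 1], and the cusp map is
    [1 - 1 / cusp2]. Hence [1 - |cusp z|^2] is comparable to [1 / x], whereas
    [x >= X] holds only within a distance of order [exp (- PI / 2 * X)] of the
    boundary point [1]. In this coordinate a Blaschke factor at [1 - 1 / t] becomes
    [(q - t) / (q + t - 1)], so that points are hyperbolically far apart when their
    coordinates are in a geometric progression, and a dyadic range of [x] behaves
    like a set of fixed size.

    Upper bound ([cusp_approx_number_le]). Interpolation at [n - 1] points of the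
    segment [(0, 1)] has rank less than [n], and its error is [(B g) o cusp] with
    [B] the Blaschke product of the points and [g] of norm at most [1]
    ([interp_op_error]). Spread the points evenly, on a logarithmic scale, over the
    roughly [log2 n] dyadic ranges of [x] up to [n]; each range receives a number
    [M] of points of order [n / log n], and [|B|^2 <= (19 / 20)^M] there
    ([blaschke_prod_small]). Beyond [x = n] the crude bound
    [|g (cusp z)|^2 <= 2 x] is enough, because the set where [x] is large is
    exponentially small. Both regions are treated together by a harmonic majorant:
    the square of the error is at most a constant times [exp (- M / 20)] times
    [exp (3 / 4 * (x - 1))], and the latter is dominated by the real part of
    [cusp0 ^ (-1/2)], whose mean over circles is its value at [0]
    ([h2_comp_cusp_weighted]).

    Lower bound ([cusp_approx_number_ge]). Take [n] points [w_i = 1 - 1 / q_i] with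
    [q_i] in geometric progression of ratio [2^(1/M)], with [M] of order
    [n / log n] chosen so that [q_i] is at most of order [sqrt n]. The Blaschke
    products [f_i] over the points other than [w_i] vanish at these, while
    [|f_i (w_i)| >= exp (- 40 M)] uniformly in the number of points
    ([off_prod_lower]). An operator of rank less than [n] kills a nontrivial
    combination of the [f_i]; evaluating that combination after composition, at the
    real preimage [z_i] of the point [w_i] with the largest coefficient, bounds the
    distance to the composition operator from below ([approx_number_ge]), the price
    [1 - |z_i|^2 >= exp (- 4 sqrt n)] of point evaluation being negligible.

    The function theory behind this is kept elementary. Cauchy's theorem is proved
    for functions with a uniform quadratic error bound, by discretising the circle
    by roots of unity ([holo_taylor]); discrete Parseval sums give the harmonic
    majorant principle ([harmonic_majorant]) and with it the uniqueness of Taylor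
    coefficients. Multiplication and division by Blaschke factors act on
    Taylor coefficients as lossless linear recursions, so that norms are controlled
    without boundary values ([h2_blaschke_mult], [h2_blaschke_div]). *)

(** * Moduli and finite sums *)

Lemma Cmod_plus_le (a b : C) (x y : R) :
  Cmod a <= x -> Cmod b <= y -> Cmod (a + b) <= x + y.
Proof. intros; eapply Rle_trans; [apply Cmod_triangle | lra]. Qed.

Lemma Cmod_minus_le (a b : C) (x y : R) :
  Cmod a <= x -> Cmod b <= y -> Cmod (a - b) <= x + y.
Proof. intros; apply Cmod_plus_le; [|rewrite Cmod_opp]; assumption. Qed.

Lemma Cmod_mult_le (a b : C) (x y : R) :
  Cmod a <= x -> Cmod b <= y -> Cmod (a * b) <= x * y.
Proof.
  intros; rewrite Cmod_mult; apply Rmult_le_compat; auto; apply Cmod_ge_0.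
Qed.

Lemma Cmod_Rscal (x : R) (z : C) : 0 <= x -> Cmod (x * z) = x * Cmod z.
Proof. intros; rewrite Cmod_mult, Cmod_R, Rabs_pos_eq; auto. Qed.

Lemma quotient_01 (a b : R) : 0 <= a < b -> 0 <= a / b < 1.
Proof.
  intros H; split; [apply Rdiv_le_0_compat; lra | apply Rlt_div_l; lra].
Qed.

Lemma quotient_01_le (a b : R) : 0 <= a <= b -> 0 < b -> 0 <= a / b <= 1.
Proof.
  intros H Hb; split; [apply Rdiv_le_0_compat; lra | apply Rle_div_l; lra].
Qed.

(** A sum of [n] terms, so that splitting and telescoping identities carry no
    off-by-one shifts. *)
Fixpoint csum (u : nat -> C) (n : nat) : C :=
  match n with O => RtoC 0 | S m => (csum u m + u m)%C end.

Fixpoint rsum (u : nat -> R) (n : nat) : R :=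
  match n with O => 0 | S m => rsum u m + u m end.

Lemma csum_S (u : nat -> C) (n : nat) : csum u (S n) = (csum u n + u n)%C.
Proof. reflexivity. Qed.

Lemma rsum_S (u : nat -> R) (n : nat) : rsum u (S n) = rsum u n + u n.
Proof. reflexivity. Qed.

Lemma csum_ext (u v : nat -> C) (n : nat) :
  (forall k, (k < n)%nat -> u k = v k) -> csum u n = csum v n.
Proof.
  induction n as [|n IH]; intros H; simpl; [reflexivity|].
  rewrite IH, H; auto with arith.
Qed.

Lemma rsum_ext (u v : nat -> R) (n : nat) :
  (forall k, (k < n)%nat -> u k = v k) -> rsum u n = rsum v n.
Proof.
  induction n as [|n IH]; intros H; simpl; [reflexivity|].
  rewrite IH, H; auto with arith.
Qed.

Lemma csum_plus (u v : nat -> C) (n : nat) :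
  csum (fun k => u k + v k)%C n = (csum u n + csum v n)%C.
Proof. induction n as [|n IH]; simpl; [ring | rewrite IH; ring]. Qed.

Lemma csum_scal (c : C) (u : nat -> C) (n : nat) :
  csum (fun k => c * u k)%C n = (c * csum u n)%C.
Proof. induction n as [|n IH]; simpl; [ring | rewrite IH; ring]. Qed.

Lemma rsum_plus (u v : nat -> R) (n : nat) :
  rsum (fun k => u k + v k) n = rsum u n + rsum v n.
Proof. induction n as [|n IH]; simpl; [ring | rewrite IH; ring]. Qed.

Lemma rsum_scal (c : R) (u : nat -> R) (n : nat) :
  rsum (fun k => c * u k) n = c * rsum u n.
Proof. induction n as [|n IH]; simpl; [ring | rewrite IH; ring]. Qed.

Lemma csum_minus (u v : nat -> C) (n : nat) :
  csum (fun k => u k - v k)%C n = (csum u n - csum v n)%C.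
Proof. induction n as [|n IH]; simpl; [ring | rewrite IH; ring]. Qed.

Lemma csum_zero (n : nat) : csum (fun _ => RtoC 0) n = 0.
Proof. induction n as [|n IH]; simpl; [reflexivity | rewrite IH; ring]. Qed.

Lemma csum_const (c : C) (n : nat) : csum (fun _ => c) n = (INR n * c)%C.
Proof.
  induction n as [|n IH]; [simpl; ring|].
  rewrite S_INR, RtoC_plus; simpl csum; rewrite IH; ring.
Qed.

Lemma rsum_const (c : R) (n : nat) : rsum (fun _ => c) n = INR n * c.
Proof.
  induction n as [|n IH]; [simpl; ring|].
  rewrite S_INR; simpl rsum; rewrite IH; ring.
Qed.

Lemma csum_conj (u : nat -> C) (n : nat) :
  Cconj (csum u n) = csum (fun k => Cconj (u k)) n.
Proof.
  induction n as [|n IH]; simpl.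
  - unfold Cconj, RtoC; simpl; f_equal; ring.
  - rewrite Cplus_conj, IH; reflexivity.
Qed.

Lemma csum_RtoC (u : nat -> R) (n : nat) :
  csum (fun k => RtoC (u k)) n = RtoC (rsum u n).
Proof.
  induction n as [|n IH]; simpl; [reflexivity|].
  rewrite IH, RtoC_plus; reflexivity.
Qed.

Lemma Re_csum (u : nat -> C) (n : nat) :
  Re (csum u n) = rsum (fun k => Re (u k)) n.
Proof. induction n as [|n IH]; simpl; [reflexivity | now rewrite <- IH]. Qed.

Lemma csum_swap (u : nat -> nat -> C) (m n : nat) :
  csum (fun i => csum (fun j => u i j) n) m =
  csum (fun j => csum (fun i => u i j) m) n.
Proof.
  induction m as [|m IH]; simpl.
  - now rewrite csum_zero.
  - rewrite IH, <- csum_plus; reflexivity.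
Qed.

Lemma rsum_swap (u : nat -> nat -> R) (m n : nat) :
  rsum (fun i => rsum (fun j => u i j) n) m =
  rsum (fun j => rsum (fun i => u i j) m) n.
Proof.
  induction m as [|m IH]; simpl.
  - rewrite rsum_const; ring.
  - rewrite IH, <- rsum_plus; reflexivity.
Qed.

Lemma csum_add (u : nat -> C) (m n : nat) :
  csum u (m + n) = (csum u m + csum (fun k => u (m + k)%nat) n)%C.
Proof.
  induction n as [|n IH].
  - rewrite Nat.add_0_r; simpl; ring.
  - rewrite Nat.add_succ_r; simpl; rewrite IH; ring.
Qed.

Lemma rsum_add (u : nat -> R) (m n : nat) :
  rsum u (m + n) = rsum u m + rsum (fun k => u (m + k)%nat) n.
Proof.
  induction n as [|n IH].
  - rewrite Nat.add_0_r; simpl; ring.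
  - rewrite Nat.add_succ_r; simpl; rewrite IH; ring.
Qed.

Lemma csum_shift (u : nat -> C) (n : nat) :
  csum u (S n) = (u O + csum (fun k => u (S k)) n)%C.
Proof.
  induction n as [|n IH]; [simpl; ring|].
  change (csum u (S (S n))) with (csum u (S n) + u (S n))%C.
  rewrite IH; simpl; ring.
Qed.

Lemma csum_single (u : nat -> C) (n i : nat) :
  (i < n)%nat -> (forall k, (k < n)%nat -> k <> i -> u k = 0) ->
  csum u n = u i.
Proof.
  induction n as [|n IH]; intros Hi H; [lia|]; simpl.
  destruct (Nat.eq_dec i n) as [->|Hn].
  - rewrite (csum_ext u (fun _ => RtoC 0)), csum_zero; [ring|].
    intros k Hk; apply H; lia.
  - rewrite IH, (H n); [ring | lia | lia | lia |].
    intros k Hk1 Hk2; apply H; lia.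
Qed.

Lemma csum_telescope (u : nat -> C) (n : nat) :
  csum (fun k => u (S k) - u k)%C n = (u n - u O)%C.
Proof. induction n as [|n IH]; simpl; [ring | rewrite IH; ring]. Qed.

Lemma rsum_le (u v : nat -> R) (n : nat) :
  (forall k, (k < n)%nat -> u k <= v k) -> rsum u n <= rsum v n.
Proof.
  induction n as [|n IH]; intros H; simpl; [lra|].
  apply Rplus_le_compat; auto with arith.
Qed.

Lemma rsum_nonneg (u : nat -> R) (n : nat) :
  (forall k, (k < n)%nat -> 0 <= u k) -> 0 <= rsum u n.
Proof.
  intros H; replace 0 with (rsum (fun _ => 0) n) by (rewrite rsum_const; ring).
  now apply rsum_le.
Qed.

Lemma rsum_mono (u : nat -> R) (m n : nat) :
  (forall k, 0 <= u k) -> (m <= n)%nat -> rsum u m <= rsum u n.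
Proof.
  intros H Hmn; replace n with (m + (n - m))%nat by lia.
  rewrite rsum_add.
  assert (0 <= rsum (fun k => u (m + k)%nat) (n - m)) by now apply rsum_nonneg.
  lra.
Qed.

Lemma rsum_term_le (u : nat -> R) (n k : nat) :
  (forall k, 0 <= u k) -> (k < n)%nat -> u k <= rsum u n.
Proof.
  intros H Hk; apply Rle_trans with (rsum u (S k)).
  - simpl; assert (0 <= rsum u k) by (now apply rsum_nonneg); lra.
  - apply rsum_mono; auto.
Qed.

Lemma Cmod_csum (u : nat -> C) (n : nat) :
  Cmod (csum u n) <= rsum (fun k => Cmod (u k)) n.
Proof.
  induction n as [|n IH]; simpl; [rewrite Cmod_0; lra|].
  eapply Rle_trans; [apply Cmod_triangle | lra].
Qed.

Lemma Cmod_csum_le (u : nat -> C) (c : R) (n : nat) :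
  (forall k, (k < n)%nat -> Cmod (u k) <= c) -> Cmod (csum u n) <= INR n * c.
Proof.
  intros H; eapply Rle_trans; [apply Cmod_csum|].
  rewrite <- rsum_const; now apply rsum_le.
Qed.

Lemma rsum_cauchy_schwarz (u v : nat -> R) (n : nat) :
  rsum (fun k => u k * v k) n ^ 2 <=
  rsum (fun k => u k ^ 2) n * rsum (fun k => v k ^ 2) n.
Proof.
  induction n as [|n IH]; [simpl; nra | rewrite !rsum_S].
  set (p := rsum (fun k => u k * v k) n) in *.
  set (a := rsum (fun k => u k ^ 2) n) in *.
  set (b := rsum (fun k => v k ^ 2) n) in *.
  assert (Ha : 0 <= a) by (apply rsum_nonneg; intros; apply pow2_ge_0).
  assert (Hb : 0 <= b) by (apply rsum_nonneg; intros; apply pow2_ge_0).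
  set (x := u n); set (y := v n).
  assert (Hc : 2 * p * (x * y) <= a * y ^ 2 + b * x ^ 2).
  { assert (H1 : (2 * p * (x * y)) ^ 2 <= (a * y ^ 2 + b * x ^ 2) ^ 2).
    { assert (H2 : p ^ 2 * (x * y) ^ 2 <= a * b * (x * y) ^ 2)
        by (apply Rmult_le_compat_r; [apply pow2_ge_0 | exact IH]).
      pose proof (pow2_ge_0 (a * y ^ 2 - b * x ^ 2)); nra. }
    assert (0 <= a * y ^ 2 + b * x ^ 2).
    { apply Rplus_le_le_0_compat; apply Rmult_le_pos; auto; apply pow2_ge_0. }
    apply Rsqr_incr_0_var; [unfold Rsqr; lra | assumption]. }
  replace ((p + x * y) ^ 2) with (p ^ 2 + 2 * p * (x * y) + x ^ 2 * y ^ 2) by ring.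
  replace ((a + x ^ 2) * (b + y ^ 2))
    with (a * b + (a * y ^ 2 + b * x ^ 2) + x ^ 2 * y ^ 2) by ring.
  lra.
Qed.

Lemma Cmod_sq_csum_mult (u v : nat -> C) (n : nat) :
  Cmod (csum (fun k => u k * v k)%C n) ^ 2 <=
  rsum (fun k => Cmod (u k) ^ 2) n * rsum (fun k => Cmod (v k) ^ 2) n.
Proof.
  eapply Rle_trans; [|apply rsum_cauchy_schwarz].
  apply pow_incr; split; [apply Cmod_ge_0|].
  eapply Rle_trans; [apply Cmod_csum|].
  apply rsum_le; intros k _; rewrite Cmod_mult; lra.
Qed.

Lemma csum_geom (q : C) (n : nat) :
  ((1 - q) * csum (fun k => q ^ k) n = 1 - q ^ n)%C.
Proof.
  induction n as [|n IH]; simpl; [ring|].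
  rewrite Cmult_plus_distr_l, IH; ring.
Qed.

Lemma RtoC_m1 : RtoC (-1) = (- RtoC 1)%C.
Proof. unfold Copp, RtoC; simpl; f_equal; ring. Qed.

Lemma INR_2 : INR 2 = 2.
Proof. simpl; ring. Qed.

Lemma pow_01 (q : R) (n : nat) : 0 <= q <= 1 -> 0 <= q ^ n <= 1.
Proof.
  intros H; split; [apply pow_le; lra|].
  apply Rle_trans with (1 ^ n); [apply pow_incr; lra | rewrite pow1; lra].
Qed.

Lemma rsum_geom_le (q : R) (n : nat) :
  0 <= q < 1 -> rsum (fun k => q ^ k) n <= / (1 - q).
Proof.
  intros Hq.
  assert (H : (1 - q) * rsum (fun k => q ^ k) n = 1 - q ^ n).
  { induction n as [|n IH]; simpl; [ring | rewrite Rmult_plus_distr_l, IH; ring]. }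
  assert (0 <= q ^ n) by (apply pow_le; lra).
  apply Rmult_le_reg_l with (1 - q); [lra|].
  rewrite H, Rinv_r; lra.
Qed.

(** * Power series on the disk *)

(** All limit passages below go through this form: an error term tending to [0]
    is carried along an inequality and dropped at the end. *)
Lemma le_of_lim_0 (x y : R) (u : nat -> R) :
  is_lim_seq u 0 -> (forall n, x <= y + u n) -> x <= y.
Proof.
  intros Hu H.
  assert (Hl : is_lim_seq (fun n => y + u n) (y + 0)).
  { apply is_lim_seq_plus'; [apply is_lim_seq_const | exact Hu]. }
  rewrite Rplus_0_r in Hl.
  exact (is_lim_seq_le (fun _ => x) _ x y H (is_lim_seq_const x) Hl).
Qed.

Lemma lim_0_le (u v : nat -> R) :
  is_lim_seq v 0 -> (forall n, 0 <= u n <= v n) -> is_lim_seq u 0.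
Proof.
  intros Hv H; apply (is_lim_seq_le_le (fun _ => 0) u v); auto.
  apply is_lim_seq_const.
Qed.

Lemma lim_0_scal (c : R) (u : nat -> R) :
  is_lim_seq u 0 -> is_lim_seq (fun n => c * u n) 0.
Proof.
  intros H; replace (Finite 0) with (Rbar_mult c 0) by (simpl; f_equal; ring).
  now apply is_lim_seq_scal_l.
Qed.

Lemma lim_0_plus (u v : nat -> R) :
  is_lim_seq u 0 -> is_lim_seq v 0 -> is_lim_seq (fun n => u n + v n) 0.
Proof.
  intros Hu Hv; replace 0 with (0 + 0) by ring; now apply is_lim_seq_plus'.
Qed.

Lemma lim_0_geom (q : R) : 0 <= q < 1 -> is_lim_seq (fun n => q ^ n) 0.
Proof. intros H; apply is_lim_seq_geom; rewrite Rabs_pos_eq; lra. Qed.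

Lemma lim_Cmod_unique (u : nat -> C) (x y : C) :
  is_lim_seq (fun n => Cmod (u n - x)) 0 ->
  is_lim_seq (fun n => Cmod (u n - y)) 0 -> x = y.
Proof.
  intros Hx Hy.
  assert (H : Cmod (x - y) <= 0).
  { apply (le_of_lim_0 _ _ _ (lim_0_plus _ _ Hx Hy)); intros n; rewrite Rplus_0_l.
    replace (x - y)%C with (- (u n - x) + (u n - y))%C by ring.
    eapply Rle_trans; [apply Cmod_triangle | rewrite Cmod_opp; lra]. }
  assert (H0 : Cmod (x - y) = 0) by (pose proof (Cmod_ge_0 (x - y)); lra).
  apply Cmod_eq_0 in H0.
  replace x with ((x - y) + y)%C by ring; rewrite H0; ring.
Qed.

Lemma lim_Cmod_le (u : nat -> C) (x : C) (b : R) :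
  is_lim_seq (fun n => Cmod (u n - x)) 0 ->
  (forall n, Cmod (u n) <= b) -> Cmod x <= b.
Proof.
  intros Hx Hb; apply (le_of_lim_0 _ _ _ Hx); intros n.
  replace x with (u n + - (u n - x))%C at 1 by ring.
  eapply Rle_trans; [apply Cmod_triangle|].
  rewrite Cmod_opp; specialize (Hb n); lra.
Qed.

Lemma lim_of_geometric_steps (u : nat -> C) (c q : R) :
  0 <= q < 1 -> (forall p, Cmod (u (S p) - u p) <= c * q ^ p) ->
  exists l, is_lim_seq (fun p => Cmod (u p - l)) 0.
Proof.
  intros Hq H.
  destruct (ex_series_le (K := C_AbsRing) (V := C_CompleteNormedModule)
    (fun p => u (S p) - u p)%C (fun p => c * q ^ p)) as [l Hl].
  - exact H.
  - apply (ex_series_scal (K := R_AbsRing) (V := R_NormedModule) c (fun p => q ^ p)).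
    apply ex_series_geom; rewrite Rabs_pos_eq; lra.
  - exists (l + u O)%C; apply is_lim_seq_incr_1.
    assert (Hs : forall n, sum_n (fun p => u (S p) - u p)%C n = (u (S n) - u O)%C).
    { induction n as [|n IH]; [apply sum_O|].
      rewrite sum_Sn, IH.
      change (u (S n) - u O + (u (S (S n)) - u (S n)) = u (S (S n)) - u O)%C; ring. }
    pose proof (proj1 (filterlim_locally_ball_norm _ _) Hl) as Hb.
    apply is_lim_seq_spec; intros eps.
    destruct (Hb eps) as [N HN]; exists N; intros n Hn.
    specialize (HN n Hn); rewrite Hs in HN.
    change (Cmod (u (S n) - u O - l) < eps) in HN.
    rewrite Rminus_0_r, Rabs_pos_eq by apply Cmod_ge_0.
    replace (u (S n) - (l + u O))%C with (u (S n) - u O - l)%C by ring; exact HN.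
Qed.

Lemma csum_geometric_le (u : nat -> C) (c q : R) (n : nat) :
  0 <= q < 1 -> (forall k, Cmod (u k) <= c * q ^ k) -> Cmod (csum u n) <= c / (1 - q).
Proof.
  intros Hq H; eapply Rle_trans; [apply Cmod_csum|].
  assert (Hc : 0 <= c).
  { specialize (H O); pose proof (Cmod_ge_0 (u O)); simpl in H; lra. }
  eapply Rle_trans; [apply rsum_le; intros k _; apply H|].
  rewrite rsum_scal; apply Rmult_le_compat_l; [exact Hc | now apply rsum_geom_le].
Qed.

(** Convergence and the bound on the limit come from the same geometric majorant. *)
Lemma csum_geometric_lim (u : nat -> C) (c q : R) :
  0 <= q < 1 -> (forall k, Cmod (u k) <= c * q ^ k) ->
  exists l, is_lim_seq (fun n => Cmod (csum u n - l)) 0 /\ Cmod l <= c / (1 - q).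
Proof.
  intros Hq H.
  destruct (lim_of_geometric_steps (csum u) c q Hq) as [l Hl].
  { intros p; replace (csum u (S p) - csum u p)%C with (u p) by (simpl; ring); auto. }
  exists l; split; [exact Hl|].
  apply (lim_Cmod_le _ _ _ Hl); intros n; now apply csum_geometric_le.
Qed.

Definition psum (a : nat -> C) (z : C) (n : nat) : C :=
  csum (fun k => a k * z ^ k)%C n.

Lemma is_pseries_psum (a : nat -> C) (z l : C) :
  @is_pseries C_AbsRing C_NormedModule a z l <->
  is_lim_seq (fun n => Cmod (psum a z n - l)) 0.
Proof.
  assert (Hsum : forall n,
    sum_n (fun k => @scal C_Ring C_NormedModule (pow_n z k) (a k)) n =
    psum a z (S n)).
  { intros n; unfold psum; induction n as [|n IH].
    - rewrite sum_O; simpl; change (z ^ 0)%C with (RtoC 1).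
      change (1 * a O = 0 + a O * 1)%C; ring.
    - rewrite sum_Sn, IH.
      change (csum (fun k => a k * z ^ k)%C (S (S n)))
        with (csum (fun k => a k * z ^ k)%C (S n) + a (S n) * z ^ S n)%C.
      assert (Hp : pow_n (K := C_Ring) z (S n) = (z ^ S n)%C).
      { clear; generalize (S n); intros m; induction m as [|m IHm]; [reflexivity|].
        simpl; rewrite IHm; reflexivity. }
      rewrite Hp.
      change (csum (fun k => a k * z ^ k)%C (S n) + z ^ S n * a (S n) =
              csum (fun k => a k * z ^ k)%C (S n) + a (S n) * z ^ S n)%C.
      ring. }
  split.
  - intros H; apply is_lim_seq_incr_1.
    pose proof (proj1 (filterlim_locally_ball_norm _ _) H) as Hb.
    apply is_lim_seq_spec; intros eps.
    destruct (Hb eps) as [N HN]; exists N; intros n Hn.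
    specialize (HN n Hn); rewrite Hsum in HN.
    unfold ball_norm in HN; change (Cmod (psum a z (S n) - l) < eps) in HN.
    rewrite Rminus_0_r, Rabs_pos_eq; [exact HN | apply Cmod_ge_0].
  - intros H; apply is_lim_seq_incr_1, is_lim_seq_spec in H.
    apply filterlim_locally_ball_norm; intros eps.
    destruct (H eps) as [N HN]; exists N; intros n Hn.
    specialize (HN n Hn); rewrite Rminus_0_r, Rabs_pos_eq in HN by apply Cmod_ge_0.
    rewrite Hsum; exact HN.
Qed.

Lemma taylor_lim (f : C -> C) (a : nat -> C) :
  taylor f a <->
  forall z, in_disk z -> is_lim_seq (fun n => Cmod (psum a z n - f z)) 0.
Proof.
  split; intros H z Hz; apply is_pseries_psum; auto.
Qed.

Lemma taylor_ext (f g : C -> C) (a : nat -> C) :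
  taylor f a -> (forall z, in_disk z -> f z = g z) -> taylor g a.
Proof. intros H E z Hz; rewrite <- E by exact Hz; auto. Qed.

Lemma psum_lincomb (a b : nat -> C) (c z : C) (n : nat) :
  psum (fun k => c * a k + b k)%C z n = (c * psum a z n + psum b z n)%C.
Proof.
  unfold psum; rewrite <- csum_scal, <- csum_plus; apply csum_ext; intros; ring.
Qed.

Lemma taylor_lincomb (f g : C -> C) (a b : nat -> C) (c : C) :
  taylor f a -> taylor g b ->
  taylor (fun z => c * f z + g z)%C (fun n => c * a n + b n)%C.
Proof.
  rewrite !taylor_lim; intros Hf Hg z Hz.
  apply (lim_0_le _ _
    (lim_0_plus _ _ (lim_0_scal (Cmod c) _ (Hf z Hz)) (Hg z Hz))).
  intros n; split; [apply Cmod_ge_0|].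
  rewrite psum_lincomb.
  replace (c * psum a z n + psum b z n - (c * f z + g z))%C
    with (c * (psum a z n - f z) + (psum b z n - g z))%C by ring.
  eapply Rle_trans; [apply Cmod_triangle | rewrite Cmod_mult; lra].
Qed.

Lemma taylor_const (c : C) :
  taylor (fun _ => c) (fun n => match n with O => c | S _ => RtoC 0 end).
Proof.
  apply taylor_lim; intros z _; apply is_lim_seq_incr_1.
  apply (is_lim_seq_ext (fun _ => 0)); [|apply is_lim_seq_const].
  intros n; unfold psum; rewrite csum_shift, (csum_ext _ (fun _ => RtoC 0)), csum_zero.
  - replace (c * z ^ 0 + 0 - c)%C with (RtoC 0) by (simpl; ring); now rewrite Cmod_0.
  - intros; ring.
Qed.

Lemma taylor_zero : taylor (fun _ => RtoC 0) (fun _ => RtoC 0).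
Proof.
  replace (fun _ : nat => RtoC 0)
    with (fun n : nat => match n with O => RtoC 0 | S _ => RtoC 0 end); [apply taylor_const|].
  apply functional_extensionality; now intros [|n].
Qed.

Lemma taylor_scal (f : C -> C) (a : nat -> C) (c : C) :
  taylor f a -> taylor (fun z => c * f z)%C (fun n => c * a n)%C.
Proof.
  intros Hf; apply (taylor_ext (fun z => c * f z + 0)%C); [|intros; ring].
  replace (fun n => c * a n)%C with (fun n => c * a n + 0)%C
    by (apply functional_extensionality; intros; ring).
  exact (taylor_lincomb _ _ _ _ c Hf taylor_zero).
Qed.

Lemma taylor_scale (f : C -> C) (a : nat -> C) (r : R) :
  0 <= r <= 1 -> taylor f a ->
  taylor (fun z => f (r * z)%C) (fun n => a n * RtoC r ^ n)%C.
Proof.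
  rewrite !taylor_lim; intros Hr Hf z Hz.
  assert (Hrz : in_disk (r * z)%C).
  { unfold in_disk in *; rewrite Cmod_Rscal by lra; pose proof (Cmod_ge_0 z); nra. }
  apply (is_lim_seq_ext (fun n => Cmod (psum a (r * z)%C n - f (r * z)%C)));
    [|exact (Hf _ Hrz)].
  intros n; f_equal; f_equal; apply csum_ext; intros k _.
  rewrite Cpow_mult_l; ring.
Qed.

(** The terms of a convergent series are bounded; applied at the point [r]. *)
Lemma taylor_coef_bound (f : C -> C) (a : nat -> C) (r : R) :
  taylor f a -> 0 <= r < 1 -> exists B, forall n, Cmod (a n) * r ^ n <= B.
Proof.
  rewrite taylor_lim; intros Hf Hr.
  assert (Hd : in_disk (RtoC r)).
  { unfold in_disk; rewrite Cmod_R, Rabs_pos_eq; lra. }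
  specialize (Hf _ Hd).
  assert (Hb : exists M, forall n, Cmod (psum a r n - f r) <= M).
  { destruct (filterlim_bounded (K := R_AbsRing) (V := R_NormedModule)
                (fun n => Cmod (psum a r n - f r))) as [M HM].
    - exists 0; exact Hf.
    - exists M; intros n; specialize (HM n).
      eapply Rle_trans; [apply Rle_abs | exact HM]. }
  destruct Hb as [M HM]; exists (2 * M); intros n.
  replace (Cmod (a n) * r ^ n) with (Cmod (a n * RtoC r ^ n)).
  2:{ rewrite Cmod_mult, Cmod_pow, Cmod_R, Rabs_pos_eq; lra. }
  replace (a n * RtoC r ^ n)%C
    with ((psum a r (S n) - f r) + - (psum a r n - f r))%C
    by (unfold psum; simpl; ring).
  eapply Rle_trans; [apply Cmod_triangle|].
  rewrite Cmod_opp; pose proof (HM n); pose proof (HM (S n)); lra.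
Qed.

(** The geometric rate makes the convergence uniform on smaller disks. *)
Lemma psum_tail (a : nat -> C) (B r' r : R) (z : C) (n m : nat) :
  0 <= r < r' -> (forall k, Cmod (a k) * r' ^ k <= B) -> Cmod z <= r ->
  Cmod (psum a z (n + m) - psum a z n) <= B / (1 - r / r') * (r / r') ^ n.
Proof.
  intros Hr HB Hz.
  assert (Hq : 0 <= r / r' < 1) by (apply quotient_01; lra).
  assert (Hterm : forall k, Cmod (a k * z ^ k) <= B * (r / r') ^ k).
  { intros k; rewrite Cmod_mult, Cmod_pow.
    apply Rle_trans with (Cmod (a k) * r ^ k).
    - apply Rmult_le_compat_l; [apply Cmod_ge_0|].
      apply pow_incr; split; [apply Cmod_ge_0 | exact Hz].
    - replace (r ^ k) with (r' ^ k * (r / r') ^ k)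
        by (rewrite <- Rpow_mult_distr; f_equal; field; lra).
      rewrite <- Rmult_assoc; apply Rmult_le_compat_r; [apply pow_le; lra | apply HB]. }
  unfold psum; rewrite csum_add.
  replace (csum (fun k => a k * z ^ k)%C n +
           csum (fun k => a (n + k)%nat * z ^ (n + k))%C m -
           csum (fun k => a k * z ^ k)%C n)%C
    with (csum (fun k => a (n + k)%nat * z ^ (n + k))%C m) by ring.
  replace (B / (1 - r / r') * (r / r') ^ n) with (B * (r / r') ^ n / (1 - r / r'))
    by (unfold Rdiv; ring).
  apply csum_geometric_le; [exact Hq|]; intros k.
  rewrite Rmult_assoc, <- pow_add; apply Hterm.
Qed.

Lemma taylor_unif (f : C -> C) (a : nat -> C) (r : R) :
  taylor f a -> 0 <= r < 1 ->
  exists D q, 0 <= D /\ 0 <= q < 1 /\ forall z n, Cmod z <= r ->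
    Cmod (psum a z n - f z) <= D * q ^ n.
Proof.
  (* Boundedness of the terms at [r' > r] gives geometric decay at [r]. *)
  intros Hf Hr; set (r' := (1 + r) / 2).
  assert (Hr' : 0 <= r' < 1) by (unfold r'; lra).
  assert (Hrr : r < r') by (unfold r'; lra).
  destruct (taylor_coef_bound f a r' Hf Hr') as [B HB].
  assert (Hq : 0 <= r / r' < 1) by (apply quotient_01; lra).
  exists (B / (1 - r / r')), (r / r'); split; [|split; [exact Hq|]].
  { apply Rdiv_le_0_compat; [|lra].
    eapply Rle_trans; [|apply (HB O)]; simpl.
    pose proof (Cmod_ge_0 (a O)); lra. }
  intros z n Hz; rewrite taylor_lim in Hf.
  assert (Hzd : in_disk z) by (unfold in_disk; lra).
  apply (le_of_lim_0 _ _ (fun m => Cmod (psum a z (n + m) - f z))).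
  - apply (is_lim_seq_ext (fun m => Cmod (psum a z (m + n) - f z))).
    + intros m; now rewrite Nat.add_comm.
    + apply (is_lim_seq_incr_n (fun m => Cmod (psum a z m - f z))); auto.
  - intros m.
    replace (psum a z n - f z)%C
      with (- (psum a z (n + m) - psum a z n) + (psum a z (n + m) - f z))%C by ring.
    eapply Rle_trans; [apply Cmod_triangle|]; rewrite Cmod_opp.
    apply Rplus_le_compat_r, psum_tail; auto; lra.
Qed.

Lemma taylor_exists (a : nat -> C) (B : R) :
  (forall n, Cmod (a n) <= B) -> exists f, taylor f a.
Proof.
  intros HB.
  assert (H : forall z, exists l, in_disk z ->
    is_lim_seq (fun n => Cmod (psum a z n - l)) 0).
  { intros z; destruct (Rlt_dec (Cmod z) 1) as [Hz|Hz].
    2:{ exists (RtoC 0); intros Hz'; contradiction. }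
    destruct (csum_geometric_lim (fun k => a k * z ^ k)%C B (Cmod z)) as (l & Hl & _).
    - split; [apply Cmod_ge_0 | exact Hz].
    - intros k; rewrite Cmod_mult, Cmod_pow.
      apply Rmult_le_compat_r; [apply pow_le, Cmod_ge_0 | apply HB].
    - exists l; intros _; exact Hl. }
  exists (fun z => proj1_sig (constructive_indefinite_description _ (H z))).
  apply taylor_lim; intros z.
  exact (proj2_sig (constructive_indefinite_description _ (H z))).
Qed.

(** * Roots of unity *)

Definition cis (t : R) : C := (cos t, sin t).

Lemma cis_plus (s t : R) : cis (s + t) = (cis s * cis t)%C.
Proof.
  unfold cis, Cmult; simpl; rewrite cos_plus, sin_plus; f_equal; ring.
Qed.

Lemma cis_0 : cis 0 = 1.
Proof. unfold cis; rewrite cos_0, sin_0; reflexivity. Qed.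

Lemma cis_2PI : cis (2 * PI) = 1.
Proof. unfold cis; rewrite cos_2PI, sin_2PI; reflexivity. Qed.

Lemma Cmod_cis (t : R) : Cmod (cis t) = 1.
Proof.
  unfold Cmod, cis; simpl.
  replace (cos t * (cos t * 1) + sin t * (sin t * 1))
    with (Rsqr (sin t) + Rsqr (cos t)) by (unfold Rsqr; ring).
  rewrite sin2_cos2; apply sqrt_1.
Qed.

Lemma cis_neq_1 (t : R) : 0 < t < 2 * PI -> cis t <> 1.
Proof.
  intros Ht H; injection H; intros _ Hc.
  assert (0 < sin (t / 2)) by (apply sin_gt_0; lra).
  replace t with (2 * (t / 2)) in Hc by field.
  rewrite cos_2a_sin in Hc; nra.
Qed.

Lemma Cmod_sq_minus (z w : C) :
  Cmod (z - w) ^ 2 = (Re z - Re w) ^ 2 + (Im z - Im w) ^ 2.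
Proof. rewrite Cmod2_alt; reflexivity. Qed.

Lemma sin_sq_le (x : R) : sin x ^ 2 <= x ^ 2.
Proof.
  assert (H : forall y, 0 <= y -> sin y ^ 2 <= y ^ 2).
  { intros y [Hy|<-]; [|rewrite sin_0; lra].
    assert (sin y < y) by now apply sin_lt_x.
    assert (Hb := SIN_bound y).
    destruct (Rle_dec 1 y) as [H1|H1]; [nra|].
    assert (0 < sin y) by (apply sin_gt_0; [lra | pose proof PI2_1; lra]).
    nra. }
  destruct (Rle_dec 0 x) as [Hx|Hx]; [auto|].
  specialize (H (- x)); rewrite sin_neg in H; nra.
Qed.

Lemma cis_lipschitz (s t : R) : Cmod (cis s - cis t) <= Rabs (s - t).
Proof.
  apply Rsqr_incr_0_var; [|apply Rabs_pos].
  rewrite <- Rsqr_abs; unfold Rsqr.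
  replace (Cmod (cis s - cis t) * Cmod (cis s - cis t))
    with (Cmod (cis s - cis t) ^ 2) by ring.
  rewrite Cmod_sq_minus; unfold cis, Re, Im; simpl fst; simpl snd.
  replace ((cos s - cos t) ^ 2 + (sin s - sin t) ^ 2)
    with ((Rsqr (sin s) + Rsqr (cos s)) + (Rsqr (sin t) + Rsqr (cos t))
          - 2 * (cos s * cos t + sin s * sin t)) by (unfold Rsqr; ring).
  rewrite !sin2_cos2, <- cos_minus.
  replace (s - t) with (2 * ((s - t) / 2)) by field.
  rewrite cos_2a_sin; pose proof (sin_sq_le ((s - t) / 2)); nra.
Qed.

Definition omega (N : nat) : C := cis (2 * PI / INR N).

Lemma cis_pow (t : R) (n : nat) : (cis t ^ n)%C = cis (INR n * t).
Proof.
  induction n as [|n IH].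
  - simpl INR; rewrite Rmult_0_l, cis_0; reflexivity.
  - rewrite S_INR, Cpow_S, IH, <- cis_plus; f_equal; ring.
Qed.

Lemma Cmod_omega_pow (N k : nat) : Cmod (omega N ^ k) = 1.
Proof. unfold omega; rewrite cis_pow; apply Cmod_cis. Qed.

Lemma omega_pow_N (N : nat) : (0 < N)%nat -> (omega N ^ N)%C = 1.
Proof.
  intros HN; unfold omega; rewrite cis_pow, <- cis_2PI; f_equal.
  field; apply not_0_INR; lia.
Qed.

Lemma omega_pow_neq_1 (N n : nat) : (0 < n < N)%nat -> (omega N ^ n)%C <> 1.
Proof.
  intros Hn; unfold omega; rewrite cis_pow; apply cis_neq_1.
  assert (0 < INR n) by (apply lt_0_INR; lia).
  assert (INR n < INR N) by (apply lt_INR; lia).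
  assert (HPI := PI_RGT_0).
  replace (INR n * (2 * PI / INR N)) with (2 * PI * (INR n / INR N)) by (field; lra).
  assert (0 < INR n / INR N < 1).
  { split; [apply Rdiv_lt_0_compat | apply quotient_01]; lra. }
  nra.
Qed.

Lemma Cmod1_conj (z : C) : Cmod z = 1 -> (z * Cconj z = 1)%C.
Proof. intros H; rewrite <- Cmod2_conj, H; f_equal; ring. Qed.

Lemma csum_pow_root (q : C) (N : nat) :
  (q ^ N = 1)%C -> q <> 1 -> csum (fun k => q ^ k)%C N = 0.
Proof.
  intros H1 H2; pose proof (csum_geom q N) as H; rewrite H1 in H.
  assert (Hq : (1 - q)%C <> 0).
  { intros H0; apply H2.
    replace q with (1 - (1 - q))%C by ring; rewrite H0; ring. }
  replace (csum (fun k => q ^ k)%C N)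
    with (/ (1 - q) * ((1 - q) * csum (fun k => q ^ k) N))%C by (field; exact Hq).
  rewrite H; ring.
Qed.

Lemma omega_orthogonal (N n m : nat) :
  (n < N)%nat -> (m < N)%nat -> n <> m ->
  csum (fun k => (omega N ^ k) ^ n * Cconj (omega N ^ k) ^ m)%C N = 0.
Proof.
  intros Hn Hm Hnm.
  set (q := (omega N ^ n * Cconj (omega N ^ m))%C).
  assert (Hw : forall k, (omega N ^ k * Cconj (omega N ^ k) = 1)%C)
    by (intros k; apply Cmod1_conj, Cmod_omega_pow).
  rewrite (csum_ext _ (fun k => q ^ k)%C).
  2:{ intros k _; unfold q.
      rewrite Cpow_mult_l, !Cpow_conj, <- !Cpow_mult_r.
      rewrite (Nat.mul_comm k n), (Nat.mul_comm k m); reflexivity. }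
  apply csum_pow_root.
  - unfold q; rewrite Cpow_mult_l, <- Cpow_conj, <- !Cpow_mult_r.
    rewrite (Nat.mul_comm n N), (Nat.mul_comm m N), !Cpow_mult_r.
    rewrite omega_pow_N, !Cpow_1_l by lia.
    unfold Cconj, RtoC, Cmult; simpl; f_equal; ring.
  - intros Hq; unfold q in Hq; destruct (Nat.lt_total n m) as [H|[H|H]]; [|lia|].
    + apply (omega_pow_neq_1 N (m - n)); [lia|].
      replace m with (n + (m - n))%nat in Hq by lia.
      rewrite Cpow_add_r, Cmult_conj, Cmult_assoc, Hw, Cmult_1_l in Hq.
      rewrite <- (Cconj_conj (omega N ^ (m - n))), Hq.
      unfold Cconj, RtoC; simpl; f_equal; ring.
    + apply (omega_pow_neq_1 N (n - m)); [lia|].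
      replace n with ((n - m) + m)%nat in Hq by lia.
      rewrite Cpow_add_r, <- Cmult_assoc, Hw, Cmult_1_r in Hq.
      exact Hq.
Qed.

(** Discrete Fourier inversion for a polynomial of degree [< N]. *)
Lemma dft_coef (c : nat -> C) (N m : nat) :
  (m < N)%nat ->
  csum (fun k => psum c (omega N ^ k)%C N * Cconj (omega N ^ k) ^ m)%C N =
  (INR N * c m)%C.
Proof.
  intros Hm; unfold psum.
  rewrite (csum_ext _ (fun k => csum (fun n =>
    c n * ((omega N ^ k) ^ n * Cconj (omega N ^ k) ^ m))%C N)).
  2:{ intros k _; rewrite Cmult_comm, <- csum_scal; apply csum_ext; intros; ring. }
  rewrite csum_swap.
  rewrite (csum_single _ N m Hm).
  - rewrite csum_scal, (csum_ext _ (fun _ => RtoC 1)), csum_const; [ring|].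
    intros k _; rewrite <- Cpow_mult_l, Cmod1_conj, Cpow_1_l;
      [reflexivity | apply Cmod_omega_pow].
  - intros n Hn Hnm; rewrite csum_scal, omega_orthogonal by auto; ring.
Qed.

(** Parseval for a polynomial of degree [< N], exact because [N] sample points
    separate the exponents [0, ..., N - 1]; it replaces the integral mean over
    the circle. *)
Lemma parseval_roots (c : nat -> C) (N : nat) :
  rsum (fun k => Cmod (psum c (omega N ^ k)%C N) ^ 2) N =
  INR N * rsum (fun n => Cmod (c n) ^ 2) N.
Proof.
  apply RtoC_inj; rewrite RtoC_mult, <- !csum_RtoC.
  set (P := fun k => psum c (omega N ^ k)%C N).
  rewrite (csum_ext _ (fun k => csum (fun n =>
    Cconj (c n) * (P k * Cconj (omega N ^ k) ^ n))%C N)).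
  2:{ intros k _; fold (P k); rewrite Cmod2_conj.
      unfold P at 2, psum; rewrite csum_conj, <- csum_scal.
      apply csum_ext; intros n _; rewrite Cmult_conj, <- Cpow_conj; ring. }
  rewrite csum_swap, <- csum_scal; apply csum_ext; intros n Hn.
  rewrite csum_scal; unfold P; rewrite dft_coef by exact Hn.
  rewrite Cmod2_conj; ring.
Qed.

(** * The harmonic majorant principle *)

Lemma one_minus_pow_le (r : R) (n : nat) :
  0 <= r <= 1 -> 1 - r ^ n <= INR n * (1 - r).
Proof.
  intros Hr; induction n as [|n IH]; [simpl; lra|].
  rewrite S_INR; simpl.
  assert (0 <= r ^ n <= 1) by now apply pow_01.
  nra.
Qed.

Lemma taylor_at_0 (f : C -> C) (a : nat -> C) : taylor f a -> f 0 = a O.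
Proof.
  rewrite taylor_lim; intros H.
  assert (H0 : in_disk 0) by (unfold in_disk; rewrite Cmod_0; lra).
  specialize (H _ H0); apply is_lim_seq_incr_1 in H.
  apply (lim_Cmod_unique _ _ _ H).
  apply (is_lim_seq_ext (fun _ => 0)); [|apply is_lim_seq_const].
  intros n; unfold psum; rewrite csum_shift, (csum_ext _ (fun _ => RtoC 0)).
  - rewrite csum_zero; simpl.
    replace (a O * 1 + 0 - a O)%C with (RtoC 0) by ring; now rewrite Cmod_0.
  - intros k _; simpl; ring.
Qed.

(** Taylor polynomials of degree [< K] are averaged over [K] equidistant points
    of the circle of radius [r]. For [F] the mean of the squares is an exact
    Parseval sum, for [H] the mean is the constant term, and the two truncation
    errors decay geometrically in [K]. *)
Lemma majorant_circle (F H : C -> C) (a h : nat -> C) (r : R) (N : nat) :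
  taylor F a -> taylor H h -> 0 <= r < 1 ->
  (forall z, in_disk z -> Cmod (F z) ^ 2 <= Re (H z)) ->
  rsum (fun n => Cmod (a n * RtoC r ^ n) ^ 2) N <= Re (h O).
Proof.
  intros HF HH Hr HFH.
  destruct (taylor_unif F a r HF Hr) as (D & q & HD & Hq & HFq).
  destruct (taylor_unif H h r HH Hr) as (D' & q' & HD' & Hq' & HHq).
  apply (le_of_lim_0 _ _ (fun n =>
    3 * D * D * (q ^ N * (q * q ^ n)) + D' * (q' ^ N * (q' * q' ^ n)))).
  { apply lim_0_plus; repeat apply lim_0_scal; now apply lim_0_geom. }
  intros n; set (K := (N + S n)%nat).
  replace (q ^ N * (q * q ^ n)) with (q ^ K) by (unfold K; rewrite pow_add; reflexivity).
  replace (q' ^ N * (q' * q' ^ n)) with (q' ^ K)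
    by (unfold K; rewrite pow_add; reflexivity).
  assert (HK : 0 < INR K) by (apply lt_0_INR; unfold K; lia).
  apply Rle_trans with (rsum (fun n => Cmod (a n * RtoC r ^ n) ^ 2) K).
  { apply rsum_mono; [intros; apply pow2_ge_0 | unfold K; lia]. }
  apply Rmult_le_reg_l with (INR K); [exact HK|].
  rewrite <- parseval_roots.
  set (z := fun k => (r * omega K ^ k)%C).
  assert (Hz : forall k, Cmod (z k) <= r).
  { intros k; unfold z; rewrite Cmod_Rscal, Cmod_omega_pow; lra. }
  assert (Hps : forall (b : nat -> C) k,
    psum (fun n => b n * RtoC r ^ n)%C (omega K ^ k)%C K = psum b (z k) K).
  { intros b k; unfold psum, z; apply csum_ext; intros m _.
    rewrite Cpow_mult_l; ring. }
  assert (Hmean : rsum (fun k => Re (psum h (z k) K)) K = INR K * Re (h O)).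
  { rewrite <- Re_csum.
    pose proof (dft_coef (fun n => h n * RtoC r ^ n)%C K O) as E.
    rewrite (csum_ext _ (fun k => psum h (z k) K)) in E.
    - rewrite E by (unfold K; lia).
      rewrite Cmult_1_r; unfold Re, Cmult, RtoC; simpl fst; simpl snd; ring.
    - intros k _; rewrite Hps, Cmult_1_r; reflexivity. }
  apply Rle_trans with
    (rsum (fun k => Re (psum h (z k) K) + (3 * D * D * q ^ K + D' * q' ^ K)) K).
  2:{ rewrite rsum_plus, rsum_const, Hmean; lra. }
  apply rsum_le; intros k _; rewrite Hps.
  pose proof (HFq (z k) K (Hz k)) as H1.
  pose proof (HFq (z k) O (Hz k)) as H0.
  pose proof (HHq (z k) K (Hz k)) as H2.
  assert (H3 : Cmod (F (z k)) <= D).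
  { unfold psum in H0; simpl in H0.
    replace (0 - F (z k))%C with (- F (z k))%C in H0 by ring.
    rewrite Cmod_opp in H0; lra. }
  assert (H4 : Cmod (psum a (z k) K) <= Cmod (F (z k)) + D * q ^ K).
  { replace (psum a (z k) K) with (F (z k) + (psum a (z k) K - F (z k)))%C by ring.
    eapply Rle_trans; [apply Cmod_triangle | lra]. }
  assert (H5 : Re (H (z k)) <= Re (psum h (z k) K) + D' * q' ^ K).
  { pose proof (re_le_Cmod (psum h (z k) K - H (z k))) as H5.
    apply Rabs_le_between in H5; unfold Re in *; simpl in H5; lra. }
  assert (Hzd : in_disk (z k)) by (unfold in_disk; pose proof (Hz k); lra).
  specialize (HFH _ Hzd).
  assert (Hq1 : 0 <= q ^ K <= 1).
  { apply pow_01; lra. }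
  pose proof (Cmod_ge_0 (F (z k))) as HF0.
  pose proof (Cmod_ge_0 (psum a (z k) K)) as HP0.
  assert (H6 : Cmod (psum a (z k) K) ^ 2 <= (Cmod (F (z k)) + D * q ^ K) ^ 2)
    by (apply pow_incr; split; assumption).
  assert (HDq : 0 <= D * q ^ K) by (apply Rmult_le_pos; lra).
  assert (H7 : Cmod (F (z k)) * (D * q ^ K) <= D * (D * q ^ K))
    by (apply Rmult_le_compat_r; assumption).
  assert (H8 : (D * q ^ K) * (D * q ^ K) <= D * (D * q ^ K))
    by (apply Rmult_le_compat_r; nra).
  nra.
Qed.

(** The real part of [H] is harmonic, so its mean over every circle is its value
    at [0]; letting the radius tend to [1] bounds the Hardy norm of [F]. Every
    norm estimate for a composition with the cusp map is an instance of this. *)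
Lemma harmonic_majorant (F H : C -> C) (a h : nat -> C) (N : nat) :
  taylor F a -> taylor H h ->
  (forall z, in_disk z -> Cmod (F z) ^ 2 <= Re (H z)) ->
  rsum (fun n => Cmod (a n) ^ 2) N <= Re (H 0).
Proof.
  intros HF HH HFH; rewrite (taylor_at_0 H h HH).
  set (s := rsum (fun n => Cmod (a n) ^ 2) N).
  (* The radii are [1 - 2^(-m)]; by Bernoulli each of the [N] terms loses at most a
     factor [1 - 2 N 2^(-m)]. *)
  apply (le_of_lim_0 _ _ (fun m => 2 * INR N * s * (1 / 2) ^ m)).
  { apply lim_0_scal, lim_0_geom; lra. }
  intros m; set (e := (1 / 2) ^ m).
  assert (He : 0 < e <= 1).
  { split; [apply pow_lt; lra | apply pow_01; lra]. }
  pose proof (majorant_circle F H a h (1 - e) N HF HH) as Hc.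
  apply Rle_trans with
    (rsum (fun n => Cmod (a n * RtoC (1 - e) ^ n) ^ 2) N + 2 * INR N * s * e);
    [|apply Rplus_le_compat_r, Hc; [split; lra | exact HFH]].
  unfold s; rewrite Rmult_assoc, (Rmult_comm (rsum _ N) e), <- Rmult_assoc.
  rewrite <- rsum_scal, <- rsum_plus; apply rsum_le; intros n Hn.
  rewrite Cmod_mult, Cmod_pow, Cmod_R, Rabs_pos_eq by lra.
  rewrite Rpow_mult_distr, <- pow_mult.
  pose proof (one_minus_pow_le (1 - e) (n * 2)) as Hb.
  rewrite mult_INR in Hb; simpl (INR 2) in Hb.
  assert (INR n <= INR N) by (apply le_INR; lia).
  pose proof (pow2_ge_0 (Cmod (a n))).
  assert (1 <= (1 - e) ^ (n * 2) + 2 * INR N * e) by (specialize (Hb ltac:(lra)); nra).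
  nra.
Qed.

(** The difference of the two functions vanishes, so [0] is a harmonic majorant of
    its square. *)
Lemma taylor_unique (f g : C -> C) (a b : nat -> C) :
  taylor f a -> taylor g b -> (forall z, in_disk z -> f z = g z) ->
  forall n, a n = b n.
Proof.
  intros Ha Hb E n.
  pose proof (taylor_lincomb _ _ _ _ (RtoC (-1)) Hb Ha) as Hd.
  pose proof (harmonic_majorant _ _ _ _ (S n) Hd taylor_zero) as Hm.
  assert (H : Cmod (RtoC (-1) * b n + a n) ^ 2 <= 0).
  { eapply Rle_trans; [|apply Hm].
    - apply (rsum_term_le (fun n => Cmod (RtoC (-1) * b n + a n) ^ 2));
        [intros; apply pow2_ge_0 | lia].
    - intros z Hz; rewrite E by exact Hz.
      replace (RtoC (-1) * g z + g z)%C with (RtoC 0) by (rewrite RtoC_m1; ring).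
      rewrite Cmod_0; simpl; lra. }
  assert (H0 : Cmod (RtoC (-1) * b n + a n) = 0).
  { pose proof (Cmod_ge_0 (RtoC (-1) * b n + a n)); nra. }
  apply Cmod_eq_0 in H0.
  replace (a n) with ((RtoC (-1) * b n + a n) + b n)%C
    by (rewrite RtoC_m1; ring).
  rewrite H0; ring.
Qed.

(** * Cauchy's theorem by discretisation *)

(** Complex differentiability on the closed disk of radius [r], with an error
    bound that is quadratic and uniform. This class is stable under all the
    operations from which the cusp map is built, each by an explicit estimate,
    and it makes Riemann sums converge with an explicit rate, so that Cauchy's
    theorem needs neither integrals nor compactness arguments. *)
Definition holo (r : R) (F : C -> C) : Prop :=
  exists (F' : C -> C) (M : R), forall z w,
    Cmod z <= r -> Cmod w <= r ->
    Cmod (F z) <= M /\ Cmod (F' z) <= M /\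
    Cmod (F w - F z - F' z * (w - z)) <= M * Cmod (w - z) ^ 2.

Lemma holo_lipschitz (F F' : C -> C) (M : R) (z w : C) :
  Cmod (F' z) <= M ->
  Cmod (F w - F z - F' z * (w - z)) <= M * Cmod (w - z) ^ 2 ->
  Cmod z <= 1 -> Cmod w <= 1 ->
  Cmod (F w - F z) <= 3 * M * Cmod (w - z).
Proof.
  intros H1 H2 Hz Hw.
  replace (F w - F z)%C
    with ((F w - F z - F' z * (w - z)) + F' z * (w - z))%C by ring.
  eapply Rle_trans; [apply Cmod_triangle|]; rewrite Cmod_mult.
  assert (Hd : Cmod (w - z) <= 2).
  { eapply Rle_trans; [now apply Cmod_minus_le | lra]. }
  pose proof (Cmod_ge_0 (w - z)) as Hd0; pose proof (Cmod_ge_0 (F' z)) as HF0.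
  assert (M * Cmod (w - z) ^ 2 <= 2 * M * Cmod (w - z)).
  { simpl; rewrite Rmult_1_r, <- Rmult_assoc, (Rmult_comm 2 M).
    replace (M * 2 * Cmod (w - z)) with (M * Cmod (w - z) * 2) by ring.
    apply Rmult_le_compat_l; [apply Rmult_le_pos; lra | lra]. }
  assert (Cmod (F' z) * Cmod (w - z) <= M * Cmod (w - z))
    by (apply Rmult_le_compat_r; lra).
  lra.
Qed.

(** Values of the Cauchy kernel [w / (w - z)] at the roots of unity. *)
Definition cauchy_kernel (N : nat) (z : C) (k : nat) : C :=
  (/ (1 - z * Cconj (omega N ^ k)))%C.

Lemma cauchy_kernel_denom (N : nat) (z : C) (k : nat) :
  in_disk z -> 1 - Cmod z <= Cmod (1 - z * Cconj (omega N ^ k)).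
Proof.
  intros Hz.
  pose proof (Cmod_triangle (1 - z * Cconj (omega N ^ k)) (z * Cconj (omega N ^ k))) as H.
  replace (1 - z * Cconj (omega N ^ k) + z * Cconj (omega N ^ k))%C
    with (RtoC 1) in H by ring.
  rewrite Cmod_1, Cmod_mult, Cmod_conj, Cmod_omega_pow in H; lra.
Qed.

Lemma cauchy_kernel_denom_neq (N : nat) (z : C) (k : nat) :
  in_disk z -> (1 - z * Cconj (omega N ^ k))%C <> 0.
Proof.
  intros Hz; apply Cmod_gt_0; pose proof (cauchy_kernel_denom N z k Hz).
  unfold in_disk in Hz; lra.
Qed.

Lemma cauchy_kernel_le (N : nat) (z : C) (k : nat) :
  in_disk z -> Cmod (cauchy_kernel N z k) <= / (1 - Cmod z).
Proof.
  intros Hz; unfold cauchy_kernel; rewrite Cmod_inv by now apply cauchy_kernel_denom_neq.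
  apply Rinv_le_contravar; [unfold in_disk in Hz; lra | now apply cauchy_kernel_denom].
Qed.

Lemma cauchy_kernel_mult (N : nat) (z : C) (k : nat) :
  in_disk z -> (cauchy_kernel N z k * (omega N ^ k - z) = omega N ^ k)%C.
Proof.
  intros Hz; pose proof (Cmod1_conj _ (Cmod_omega_pow N k)) as H.
  replace (omega N ^ k - z)%C
    with ((1 - z * Cconj (omega N ^ k)) * omega N ^ k)%C.
  - unfold cauchy_kernel; field; now apply cauchy_kernel_denom_neq.
  - replace ((1 - z * Cconj (omega N ^ k)) * omega N ^ k)%C
      with (omega N ^ k - z * (omega N ^ k * Cconj (omega N ^ k)))%C by ring.
    rewrite H; ring.
Qed.

Lemma cauchy_kernel_expand (N : nat) (z : C) (k m : nat) :
  in_disk z ->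
  cauchy_kernel N z k = (csum (fun n => (z * Cconj (omega N ^ k)) ^ n) m +
                (z * Cconj (omega N ^ k)) ^ m * cauchy_kernel N z k)%C.
Proof.
  intros Hz; pose proof (csum_geom (z * Cconj (omega N ^ k)) m) as H.
  pose proof (cauchy_kernel_denom_neq N z k Hz) as Hn.
  replace (csum (fun n => (z * Cconj (omega N ^ k)) ^ n)%C m)
    with (cauchy_kernel N z k * ((1 - z * Cconj (omega N ^ k)) *
            csum (fun n => (z * Cconj (omega N ^ k)) ^ n) m))%C
    by (unfold cauchy_kernel; field; exact Hn).
  rewrite H; ring.
Qed.

Lemma omega_dist (N : nat) : (0 < N)%nat -> Cmod (omega N - 1) <= 8 / INR N.
Proof.
  intros HN; unfold omega; rewrite <- cis_0.
  assert (0 < INR N) by now apply lt_0_INR.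
  eapply Rle_trans; [apply cis_lipschitz|].
  rewrite Rminus_0_r, Rabs_pos_eq.
  - apply Rmult_le_compat_r; [left; now apply Rinv_0_lt_compat|].
    pose proof PI_4; lra.
  - apply Rdiv_le_0_compat; [pose proof PI_RGT_0; lra | assumption].
Qed.

Section Discrete_Cauchy.

Variables (F F' : C -> C) (M : R) (z : C).
Hypothesis HF : forall u v, Cmod u <= 1 -> Cmod v <= 1 ->
  Cmod (F u) <= M /\ Cmod (F' u) <= M /\
  Cmod (F v - F u - F' u * (v - u)) <= M * Cmod (v - u) ^ 2.
Hypothesis Hz : in_disk z.

Let kappa := / (1 - Cmod z).

Lemma kappa_pos : 0 < kappa.
Proof. apply Rinv_0_lt_compat; unfold in_disk in Hz; lra. Qed.

Lemma M_nonneg : 0 <= M.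
Proof.
  destruct (HF 0 0) as [H _]; try (rewrite Cmod_0; lra).
  eapply Rle_trans; [apply Cmod_ge_0 | exact H].
Qed.

(** The roots of unity, contracted towards [z] in [N] steps: [j = 0] is the
    point [z] itself and [j = N] the full circle. *)
Let sample (N j k : nat) : C := (z + RtoC (INR j / INR N) * (omega N ^ k - z))%C.

Lemma sample_in_disk (N j k : nat) : (0 < N)%nat -> (j <= N)%nat -> Cmod (sample N j k) <= 1.
Proof.
  intros HN Hj; unfold sample; set (t := INR j / INR N).
  assert (HN' : 0 < INR N) by now apply lt_0_INR.
  assert (Ht : 0 <= t <= 1).
  { apply quotient_01_le; [|exact HN'].
    split; [apply pos_INR | now apply le_INR]. }
  replace (z + t * (omega N ^ k - z))%C
    with (RtoC (1 - t) * z + RtoC t * omega N ^ k)%C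
    by (rewrite RtoC_minus; ring).
  apply Rle_trans with ((1 - t) * 1 + t * 1); [unfold in_disk in Hz | lra].
  apply Cmod_plus_le; rewrite Cmod_Rscal by lra; apply Rmult_le_compat_l;
    rewrite ?Cmod_omega_pow; lra.
Qed.

(** With [t = j / N], [t * (omega N - 1)] times the sum is a Riemann sum of the
    derivative along a closed polygon, and the increments of [F] along that
    polygon telescope to [0]. *)
Lemma closed_polygon_sum (N j : nat) :
  (2 <= N)%nat -> (1 <= j <= N)%nat ->
  Cmod (csum (fun k => F' (sample N j k) * omega N ^ k)%C N) <= 8 * M.
Proof.
  intros HN Hj; set (t := INR j / INR N); set (total := csum _ N).
  assert (HN' : 0 < INR N) by (apply lt_0_INR; lia).
  assert (Ht : 0 < t <= 1).
  { split; [apply Rdiv_lt_0_compat; [apply lt_0_INR; lia | assumption]|].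
    apply quotient_01_le; [|exact HN']; split; [apply pos_INR | now apply le_INR]. }
  set (d := Cmod (omega N - 1)).
  assert (Hd : 0 < d).
  { apply Cmod_gt_0; intros H0.
    apply (omega_pow_neq_1 N 1); [lia|].
    rewrite Cpow_1_r.
    replace (omega N) with ((omega N - 1) + 1)%C by ring; rewrite H0; ring. }
  assert (Hstep : forall k, (sample N j (S k) - sample N j k =
                             t * (omega N - 1) * omega N ^ k)%C).
  { intros k; unfold sample; fold t; rewrite Cpow_S; ring. }
  assert (E : (t * (omega N - 1) * total =
    - csum (fun k => F (sample N j (S k)) - F (sample N j k) -
        F' (sample N j k) * (sample N j (S k) - sample N j k)) N)%C).
  { rewrite csum_minus.
    rewrite (csum_telescope (fun k => F (sample N j k))).
    replace (sample N j N) with (sample N j 0).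
    2:{ unfold sample; rewrite omega_pow_N by lia; reflexivity. }
    unfold total; rewrite <- csum_scal.
    rewrite (csum_ext (fun k => F' (sample N j k) *
                (sample N j (S k) - sample N j k))%C
              (fun k => t * (omega N - 1) * (F' (sample N j k) * omega N ^ k))%C)
      by (intros k _; rewrite Hstep; ring).
    ring. }
  apply (f_equal Cmod) in E.
  rewrite Cmod_opp, !Cmod_mult, Cmod_R, Rabs_pos_eq in E by lra; fold d in E.
  assert (Hb : t * d * Cmod total <= INR N * (M * (t * d) ^ 2)).
  { rewrite E; apply Cmod_csum_le; intros k Hk.
    destruct (HF (sample N j k) (sample N j (S k))) as (_ & _ & H3);
      try (apply sample_in_disk; lia).
    eapply Rle_trans; [exact H3|].
    rewrite Hstep, !Cmod_mult, Cmod_omega_pow, Cmod_R, Rabs_pos_eq by lra.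
    fold d; rewrite Rmult_1_r; lra. }
  assert (Hd8 : INR N * d <= 8).
  { pose proof (omega_dist N ltac:(lia)) as H; fold d in H.
    apply (Rmult_le_compat_l (INR N)) in H; [|lra].
    replace (INR N * (8 / INR N)) with 8 in H by (field; lra); exact H. }
  assert (Htd : 0 < t * d) by now apply Rmult_lt_0_compat.
  apply Rmult_le_reg_l with (t * d); [exact Htd|].
  eapply Rle_trans; [exact Hb|].
  replace (INR N * (M * (t * d) ^ 2)) with (t * d * (M * t * (INR N * d))) by ring.
  apply Rmult_le_compat_l; [lra|].
  pose proof M_nonneg.
  apply Rle_trans with (M * t * 8); [apply Rmult_le_compat_l; nra | nra].
Qed.

Let contracted_sum (N j : nat) : C := csum (fun k => cauchy_kernel N z k * F (sample N j k))%C N.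

(** The kernel cancels the factor [omega N ^ k - z] by which the [k]th sample point
    moves, so that the first-order change is the sum of [closed_polygon_sum]. *)
Lemma contracted_sum_step (N j : nat) : (0 < N)%nat -> (S j <= N)%nat ->
  Cmod (contracted_sum N (S j) - contracted_sum N j -
        RtoC (/ INR N) * csum (fun k => F' (sample N j k) * omega N ^ k)%C N)
  <= 4 * kappa * M / INR N.
Proof.
  intros HN Hj; unfold contracted_sum.
  assert (HN' : 0 < INR N) by (apply lt_0_INR; lia).
  rewrite <- csum_scal, <- !csum_minus.
  replace (4 * kappa * M / INR N) with (INR N * (kappa * (M * (2 / INR N) ^ 2)))
    by (field; lra).
  apply Cmod_csum_le; intros k Hk.
  assert (Hstep : (sample N (S j) k - sample N j k = RtoC (/ INR N) * (omega N ^ k - z))%C).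
  { unfold sample; rewrite S_INR.
    replace ((INR j + 1) / INR N) with (INR j / INR N + / INR N) by (field; lra).
    rewrite RtoC_plus; ring. }
  destruct (HF (sample N j k) (sample N (S j) k)) as (_ & _ & H3);
    try (apply sample_in_disk; lia).
  replace (cauchy_kernel N z k * F (sample N (S j) k) - cauchy_kernel N z k * F (sample N j k) -
           RtoC (/ INR N) * (F' (sample N j k) * omega N ^ k))%C
    with (cauchy_kernel N z k * (F (sample N (S j) k) - F (sample N j k) -
            F' (sample N j k) * (sample N (S j) k - sample N j k)))%C.
  2:{ rewrite Hstep; pose proof (cauchy_kernel_mult N z k Hz) as E.
      transitivity (cauchy_kernel N z k * F (sample N (S j) k) -
        cauchy_kernel N z k * F (sample N j k) -
        RtoC (/ INR N) * (F' (sample N j k) *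
          (cauchy_kernel N z k * (omega N ^ k - z))))%C;
        [ring | rewrite E; reflexivity]. }
  apply Cmod_mult_le; [now apply cauchy_kernel_le|].
  eapply Rle_trans; [exact H3|].
  apply Rmult_le_compat_l; [exact M_nonneg|].
  apply pow_incr; split; [apply Cmod_ge_0|].
  rewrite Hstep, Cmod_Rscal by (left; now apply Rinv_0_lt_compat).
  unfold Rdiv; rewrite Rmult_comm; apply Rmult_le_compat_r;
    [left; now apply Rinv_0_lt_compat|].
  replace 2 with (1 + 1) by ring; unfold in_disk in Hz.
  apply Cmod_minus_le; [rewrite Cmod_omega_pow|]; lra.
Qed.

(** Cauchy's formula up to [O(1)] before division by [N]: each of the [N] steps of
    the contraction costs [O(1 / N)], and only the first, where the polygon
    degenerates to the point [z], costs [O(1)]. *)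
Lemma contracted_sum_total (N : nat) : (2 <= N)%nat ->
  Cmod (contracted_sum N N - contracted_sum N 0) <= 9 * M + 4 * kappa * M.
Proof.
  intros HN.
  assert (HN' : 0 < INR N) by (apply lt_0_INR; lia).
  pose proof M_nonneg as HM; pose proof kappa_pos as Hk.
  assert (Hi : forall j, (S j <= N)%nat ->
    Cmod (contracted_sum N (S j) - contracted_sum N 0) <=
    M + INR (S j) * (8 * M / INR N + 4 * kappa * M / INR N)).
  { induction j as [|j IH]; intros Hj.
    - pose proof (contracted_sum_step N 0 ltac:(lia) Hj) as H.
      set (s := csum (fun k => F' (sample N 0 k) * omega N ^ k)%C N) in H.
      assert (Hs : Cmod s <= INR N * M).
      { apply Cmod_csum_le; intros k _; rewrite Cmod_mult, Cmod_omega_pow, Rmult_1_r.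
        apply (HF (sample N 0 k) (sample N 0 k)); apply sample_in_disk; lia. }
      replace (contracted_sum N 1 - contracted_sum N 0)%C
        with ((contracted_sum N 1 - contracted_sum N 0 - RtoC (/ INR N) * s) +
              RtoC (/ INR N) * s)%C by ring.
      eapply Rle_trans; [apply Cmod_triangle|].
      rewrite Cmod_Rscal by (left; now apply Rinv_0_lt_compat).
      assert (/ INR N * Cmod s <= M).
      { apply Rmult_le_reg_l with (INR N); [lra|].
        rewrite <- Rmult_assoc, Rinv_r by lra; lra. }
      assert (0 <= 8 * M / INR N) by (apply Rdiv_le_0_compat; lra).
      simpl INR; lra.
    - pose proof (contracted_sum_step N (S j) ltac:(lia) Hj) as H.
      pose proof (closed_polygon_sum N (S j) HN ltac:(lia)) as Hs.
      set (s := csum (fun k => F' (sample N (S j) k) * omega N ^ k)%C N) in *.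
      replace (contracted_sum N (S (S j)) - contracted_sum N 0)%C
        with ((contracted_sum N (S j) - contracted_sum N 0) +
              ((contracted_sum N (S (S j)) - contracted_sum N (S j) -
                RtoC (/ INR N) * s) + RtoC (/ INR N) * s))%C by ring.
      eapply Rle_trans; [apply Cmod_triangle|].
      eapply Rle_trans; [apply Rplus_le_compat_l, Cmod_triangle|].
      rewrite Cmod_Rscal by (left; now apply Rinv_0_lt_compat).
      assert (/ INR N * Cmod s <= 8 * M / INR N).
      { unfold Rdiv; rewrite Rmult_comm; apply Rmult_le_compat_r; [|exact Hs].
        left; now apply Rinv_0_lt_compat. }
      specialize (IH ltac:(lia)); rewrite (S_INR (S j)); lra. }
  destruct N as [|n]; [lia|].
  eapply Rle_trans; [apply Hi; lia|].
  right; field; lra.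
Qed.

Definition dft (N n : nat) : C :=
  (RtoC (/ INR N) * csum (fun k => F (omega N ^ k) * Cconj (omega N ^ k) ^ n) N)%C.

End Discrete_Cauchy.

(** The kernel is a geometric series in [z]; summed against [F] term by term, it
    gives a polynomial whose coefficients are discrete Fourier coefficients. *)
Lemma cauchy_kernel_mean_expand (F : C -> C) (M : R) (N m : nat) (z : C) :
  (0 < N)%nat -> in_disk z -> (forall w, Cmod w <= 1 -> Cmod (F w) <= M) ->
  Cmod (RtoC (/ INR N) * csum (fun k => cauchy_kernel N z k * F (omega N ^ k)) N -
        psum (dft F N) z m)%C <= M * / (1 - Cmod z) * Cmod z ^ m.
Proof.
  intros HN Hz HF.
  assert (HN' : 0 < INR N) by (apply lt_0_INR; lia).
  assert (E : (psum (dft F N) z m =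
    RtoC (/ INR N) * csum (fun k =>
      csum (fun n => (z * Cconj (omega N ^ k)) ^ n) m * F (omega N ^ k)) N)%C).
  { rewrite (csum_ext _ (fun k => csum (fun n =>
      F (omega N ^ k)%C * (z * Cconj (omega N ^ k)) ^ n)%C m))
      by (intros k _; rewrite Cmult_comm, <- csum_scal; reflexivity).
    rewrite csum_swap, <- csum_scal; unfold psum; apply csum_ext; intros n _.
    unfold dft; rewrite <- Cmult_assoc; f_equal.
    rewrite Cmult_comm, <- csum_scal; apply csum_ext; intros k _.
    rewrite Cpow_mult_l; ring. }
  rewrite E.
  replace (RtoC (/ INR N) * csum (fun k => cauchy_kernel N z k * F (omega N ^ k)) N -
    RtoC (/ INR N) * csum (fun k =>
      csum (fun n => (z * Cconj (omega N ^ k)) ^ n) m * F (omega N ^ k)) N)%C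
    with (RtoC (/ INR N) * csum (fun k =>
      (z * Cconj (omega N ^ k)) ^ m * cauchy_kernel N z k * F (omega N ^ k)) N)%C.
  2:{ rewrite <- !csum_scal, <- csum_minus; apply csum_ext; intros k _.
      rewrite (cauchy_kernel_expand N z k m Hz) at 2; ring. }
  rewrite Cmod_Rscal by (left; now apply Rinv_0_lt_compat).
  apply Rmult_le_reg_l with (INR N); [lra|].
  rewrite <- Rmult_assoc, Rinv_r, Rmult_1_l by lra.
  apply Cmod_csum_le; intros k _.
  replace (M * / (1 - Cmod z) * Cmod z ^ m)
    with (Cmod z ^ m * / (1 - Cmod z) * M) by ring.
  apply Cmod_mult_le; [apply Cmod_mult_le; [|now apply cauchy_kernel_le]|].
  - rewrite Cmod_pow, Cmod_mult, Cmod_conj, Cmod_omega_pow, Rmult_1_r; lra.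
  - apply HF; rewrite Cmod_omega_pow; lra.
Qed.

(** The discrete Cauchy formula for the constant [1], whose Fourier coefficients
    of index [1, ..., N - 1] vanish. *)
Lemma cauchy_kernel_mean (N : nat) (z : C) : (0 < N)%nat -> in_disk z ->
  Cmod (RtoC (/ INR N) * csum (cauchy_kernel N z) N - 1)%C <= / (1 - Cmod z) * Cmod z ^ N.
Proof.
  intros HN Hz.
  assert (HN' : 0 < INR N) by (apply lt_0_INR; lia).
  pose proof (cauchy_kernel_mean_expand (fun _ => RtoC 1) 1 N N z HN Hz) as H.
  rewrite Rmult_1_l in H.
  assert (E : psum (dft (fun _ => RtoC 1) N) z N = 1).
  { unfold psum; rewrite (csum_single _ N 0 HN).
    - unfold dft; rewrite (csum_ext _ (fun _ => RtoC 1)), csum_const.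
      + change (z ^ 0)%C with (RtoC 1).
        rewrite !Cmult_1_r, <- RtoC_mult; f_equal; field; lra.
      + intros k _; change (Cconj (omega N ^ k) ^ 0)%C with (RtoC 1); ring.
    - intros n Hn Hn0; unfold dft.
      rewrite (csum_ext _ (fun k => (omega N ^ k) ^ 0 * Cconj (omega N ^ k) ^ n)%C)
        by (intros k _; change ((omega N ^ k) ^ 0)%C with (RtoC 1); reflexivity).
      rewrite omega_orthogonal by lia; ring. }
  rewrite E in H.
  rewrite (csum_ext (cauchy_kernel N z) (fun k => cauchy_kernel N z k * 1)%C) by (intros; ring).
  apply H; intros; rewrite Cmod_1; lra.
Qed.

Lemma csum_pairs (u : nat -> C) (N : nat) :
  csum u (2 * N) = csum (fun k => u (2 * k)%nat + u (2 * k + 1)%nat)%C N.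
Proof.
  induction N as [|N IH]; [reflexivity|].
  replace (2 * S N)%nat with (S (S (2 * N))) by lia.
  rewrite !csum_S, IH, Nat.add_1_r; ring.
Qed.

Lemma omega_double (N : nat) : (0 < N)%nat -> (omega (2 * N) ^ 2 = omega N)%C.
Proof.
  intros HN; unfold omega; rewrite cis_pow; f_equal.
  rewrite mult_INR, INR_2; field; apply not_0_INR; lia.
Qed.

Lemma Cmod_pow_diff (u v : C) (n : nat) : Cmod u <= 1 -> Cmod v <= 1 ->
  Cmod (u ^ n - v ^ n) <= INR n * Cmod (u - v).
Proof.
  intros Hu Hv; induction n as [|n IH].
  - simpl; replace (1 - 1)%C with (RtoC 0) by ring; rewrite Cmod_0; lra.
  - rewrite S_INR, !Cpow_S.
    replace (u * u ^ n - v * v ^ n)%C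
      with (u * (u ^ n - v ^ n) + (u - v) * v ^ n)%C by ring.
    eapply Rle_trans; [apply Cmod_triangle|]; rewrite !Cmod_mult.
    assert (Cmod (v ^ n) <= 1).
    { rewrite Cmod_pow; apply pow_01; split; [apply Cmod_ge_0 | exact Hv]. }
    pose proof (Cmod_ge_0 u); pose proof (Cmod_ge_0 (u ^ n - v ^ n)).
    pose proof (Cmod_ge_0 (u - v)); pose proof (Cmod_ge_0 (v ^ n)).
    nra.
Qed.

(** The [2 N] samples form [N] pairs of neighbours at distance [O(1 / N)], and one
    member of each pair is an old sample. *)
Lemma dft_double (F : C -> C) (M L : R) (N n : nat) :
  (0 < N)%nat ->
  (forall u, Cmod u <= 1 -> Cmod (F u) <= M) ->
  (forall u v, Cmod u <= 1 -> Cmod v <= 1 -> Cmod (F u - F v) <= L * Cmod (u - v)) ->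
  Cmod (dft F (2 * N) n - dft F N n) <= 2 * (L + M * INR n) / INR N.
Proof.
  intros HN HM HL.
  assert (HN' : 0 < INR N) by (apply lt_0_INR; lia).
  assert (HM0 : 0 <= M).
  { eapply Rle_trans; [apply Cmod_ge_0 | apply (HM 0); rewrite Cmod_0; lra]. }
  assert (H2N : INR (2 * N) = 2 * INR N) by (rewrite mult_INR, INR_2; ring).
  set (g := fun w => (F w * Cconj w ^ n)%C).
  assert (Hg : forall u v, Cmod u <= 1 -> Cmod v <= 1 ->
    Cmod (g u - g v) <= (L + M * INR n) * Cmod (u - v)).
  { intros u v Hu Hv; unfold g.
    replace (F u * Cconj u ^ n - F v * Cconj v ^ n)%C
      with ((F u - F v) * Cconj u ^ n + F v * (Cconj u ^ n - Cconj v ^ n))%C by ring.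
    eapply Rle_trans; [apply Cmod_triangle|]; rewrite !Cmod_mult.
    pose proof (HL u v Hu Hv) as H1; pose proof (HM v Hv) as H2.
    assert (H3 : Cmod (Cconj u ^ n) <= 1).
    { rewrite Cmod_pow, Cmod_conj; apply pow_01; split; [apply Cmod_ge_0 | exact Hu]. }
    pose proof (Cmod_pow_diff (Cconj u) (Cconj v) n) as H4.
    rewrite !Cmod_conj in H4; specialize (H4 Hu Hv).
    rewrite <- Cminus_conj, Cmod_conj in H4.
    pose proof (Cmod_ge_0 (F u - F v)); pose proof (Cmod_ge_0 (Cconj u ^ n)).
    pose proof (Cmod_ge_0 (Cconj u ^ n - Cconj v ^ n)).
    assert (Cmod (F u - F v) * Cmod (Cconj u ^ n) <= L * Cmod (u - v)) by nra.
    assert (Cmod (F v) * Cmod (Cconj u ^ n - Cconj v ^ n) <=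
            M * (INR n * Cmod (u - v)))
      by (apply Rmult_le_compat; auto; apply Cmod_ge_0).
    lra. }
  unfold dft; change (Cmod (RtoC (/ INR (2 * N)) *
    csum (fun k => g (omega (2 * N) ^ k)%C) (2 * N) -
    RtoC (/ INR N) * csum (fun k => g (omega N ^ k)%C) N)
    <= 2 * (L + M * INR n) / INR N).
  rewrite csum_pairs.
  replace (RtoC (/ INR N)) with (RtoC (/ INR (2 * N)) * 2)%C
    by (rewrite H2N, <- RtoC_mult; f_equal; field; lra).
  rewrite <- Cmult_assoc, <- (csum_scal 2).
  replace (RtoC (/ INR (2 * N)) * csum (fun k => g (omega (2 * N) ^ (2 * k)) +
             g (omega (2 * N) ^ (2 * k + 1))) N -
           RtoC (/ INR (2 * N)) * csum (fun k => 2 * g (omega N ^ k)) N)%C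
    with (RtoC (/ INR (2 * N)) * csum (fun k => g (omega (2 * N) ^ (2 * k + 1))
             - g (omega (2 * N) ^ (2 * k))) N)%C.
  2:{ rewrite <- !csum_scal, <- csum_minus; apply csum_ext; intros k _.
      rewrite <- (omega_double N HN), <- Cpow_mult_r; ring. }
  rewrite Cmod_mult, Cmod_R, Rabs_pos_eq, H2N
    by (left; apply Rinv_0_lt_compat; rewrite H2N; lra).
  assert (Hb : Cmod (csum (fun k => g (omega (2 * N) ^ (2 * k + 1))
             - g (omega (2 * N) ^ (2 * k)))%C N) <=
          INR N * ((L + M * INR n) * (4 / INR N))).
  { apply Cmod_csum_le; intros k _.
    eapply Rle_trans; [apply Hg; rewrite Cmod_omega_pow; lra|].
    assert (HL0 : 0 <= L + M * INR n).
    { specialize (HL 1 0); rewrite Cmod_1, Cmod_0 in HL.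
      replace (1 - 0)%C with (RtoC 1) in HL by ring; rewrite Cmod_1 in HL.
      pose proof (Cmod_ge_0 (F 1 - F 0)); specialize (HL ltac:(lra) ltac:(lra)).
      assert (0 <= M * INR n) by (apply Rmult_le_pos; [lra | apply pos_INR]); lra. }
    apply Rmult_le_compat_l; [exact HL0|].
    rewrite Cpow_add_r, Cpow_1_r.
    replace (omega (2 * N) ^ (2 * k) * omega (2 * N) - omega (2 * N) ^ (2 * k))%C
      with (omega (2 * N) ^ (2 * k) * (omega (2 * N) - 1))%C by ring.
    rewrite Cmod_mult, Cmod_omega_pow, Rmult_1_l.
    eapply Rle_trans; [apply omega_dist; lia|].
    rewrite H2N; right; field; lra. }
  apply Rle_trans with (/ (2 * INR N) * (INR N * ((L + M * INR n) * (4 / INR N)))).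
  - apply Rmult_le_compat_l; [left; apply Rinv_0_lt_compat; lra | exact Hb].
  - right; field; lra.
Qed.

(** The Taylor coefficients are the limits of the discrete Fourier coefficients
    with [2^p] sample points. For fixed [p] the discrete Cauchy formula, expanded
    in powers of [z], reproduces [F z] up to [O(2^(-p))] and a remainder
    [O(|z|^m)]; letting [p] tend to infinity leaves the second alone. *)
Lemma holo_closed_taylor (F : C -> C) : holo 1 F -> exists a, taylor F a.
Proof.
  intros (F' & M & HF).
  assert (HM : forall u, Cmod u <= 1 -> Cmod (F u) <= M)
    by (intros u Hu; apply (HF u u); auto).
  assert (HL : forall u v, Cmod u <= 1 -> Cmod v <= 1 ->
    Cmod (F u - F v) <= 3 * M * Cmod (u - v)).
  { intros u v Hu Hv; destruct (HF v u Hv Hu) as (_ & H2 & H3).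
    now apply (holo_lipschitz F F'). }
  assert (Hlim : forall n, exists l,
    is_lim_seq (fun p => Cmod (dft F (2 ^ p) n - l)) 0).
  { intros n; apply (lim_of_geometric_steps _ (2 * (3 * M + M * INR n)) (1 / 2));
      [lra|]; intros p.
    pose proof (dft_double F M (3 * M) (2 ^ p) n) as H.
    eapply Rle_trans.
    - apply H; auto; apply Nat.neq_0_lt_0, Nat.pow_nonzero; lia.
    - rewrite pow_INR, INR_2; unfold Rdiv.
      rewrite Rmult_1_l, pow_inv; lra. }
  set (a := fun n => proj1_sig (constructive_indefinite_description _ (Hlim n))).
  assert (Ha : forall n, is_lim_seq (fun p => Cmod (dft F (2 ^ p) n - a n)) 0)
    by (intros n; exact (proj2_sig (constructive_indefinite_description _ (Hlim n)))).
  exists a; apply taylor_lim; intros z Hz.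
  assert (Hz' : 0 <= Cmod z < 1) by (split; [apply Cmod_ge_0 | exact Hz]).
  set (kappa := / (1 - Cmod z)).
  assert (Hk : 0 < kappa) by (apply Rinv_0_lt_compat; lra).
  assert (HM0 : 0 <= M).
  { eapply Rle_trans; [apply Cmod_ge_0 | apply (HM 0); rewrite Cmod_0; lra]. }
  apply (lim_0_le _ (fun m => M * kappa * Cmod z ^ m)).
  { apply lim_0_scal, lim_0_geom; exact Hz'. }
  intros m; split; [apply Cmod_ge_0|].
  assert (Hsum : is_lim_seq (fun p =>
    rsum (fun n => Cmod (dft F (2 ^ p) n - a n)) m) 0).
  { clear -Ha; induction m as [|m IH]; simpl; [apply is_lim_seq_const|].
    now apply lim_0_plus. }
  apply is_lim_seq_incr_1 in Hsum.
  apply (le_of_lim_0 _ _ (fun p =>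
    rsum (fun n => Cmod (dft F (2 ^ S p) n - a n)) m +
    ((9 * M + 4 * kappa * M) * (1 / 2) ^ p + M * kappa * Cmod z ^ p))).
  { apply lim_0_plus; [exact Hsum|].
    apply lim_0_plus; apply lim_0_scal, lim_0_geom; lra. }
  intros p; set (N := (2 ^ S p)%nat).
  assert (HpN : (p < N)%nat).
  { unfold N; pose proof (Nat.pow_gt_lin_r 2 (S p)); lia. }
  assert (HN2 : (2 <= N)%nat).
  { unfold N; rewrite Nat.pow_succ_r'.
    assert (2 ^ p <> 0)%nat by (apply Nat.pow_nonzero; lia); lia. }
  assert (HN' : 0 < INR N) by (apply lt_0_INR; lia).
  pose proof (contracted_sum_total F F' M z HF Hz N HN2) as H1; fold kappa in H1.
  pose proof (cauchy_kernel_mean_expand F M N m z ltac:(lia) Hz HM) as H2; fold kappa in H2.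
  pose proof (cauchy_kernel_mean N z ltac:(lia) Hz) as H3; fold kappa in H3.
  set (A := (RtoC (/ INR N) * csum (fun k => cauchy_kernel N z k * F (omega N ^ k)) N)%C) in *.
  set (K := (RtoC (/ INR N) * csum (cauchy_kernel N z) N)%C) in *.
  assert (H4 : Cmod (A - F z * K) <= (9 * M + 4 * kappa * M) * (1 / 2) ^ p).
  { assert (E : (A - F z * K = RtoC (/ INR N) *
      (csum (fun k => cauchy_kernel N z k *
          F (z + RtoC (INR N / INR N) * (omega N ^ k - z)))%C N -
       csum (fun k => cauchy_kernel N z k *
          F (z + RtoC (INR 0 / INR N) * (omega N ^ k - z)))%C N))%C).
    { rewrite (csum_ext (fun k => cauchy_kernel N z k *
          F (z + RtoC (INR N / INR N) * (omega N ^ k - z)))%C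
          (fun k => cauchy_kernel N z k * F (omega N ^ k)%C)%C).
      2:{ intros k _; replace (INR N / INR N) with 1 by (field; lra).
          do 2 f_equal; ring. }
      rewrite (csum_ext (fun k => cauchy_kernel N z k *
          F (z + RtoC (INR 0 / INR N) * (omega N ^ k - z)))%C
          (fun k => F z * cauchy_kernel N z k)%C).
      2:{ intros k _; replace (INR 0 / INR N) with 0 by (simpl; field; lra).
          rewrite Cmult_comm; do 2 f_equal; ring. }
      rewrite csum_scal; unfold A, K; ring. }
    rewrite E, Cmod_Rscal by (left; now apply Rinv_0_lt_compat).
    apply Rle_trans with (/ INR N * (9 * M + 4 * kappa * M)).
    - apply Rmult_le_compat_l; [left; now apply Rinv_0_lt_compat | exact H1].
    - rewrite Rmult_comm; apply Rmult_le_compat_l; [nra|].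
      unfold N; rewrite pow_INR, INR_2.
      replace (1 / 2) with (/ 2) by field; rewrite pow_inv.
      apply Rinv_le_contravar; [apply pow_lt; lra|].
      apply Rle_pow; [lra | lia]. }
  assert (H5 : Cmod (psum (dft F N) z m - psum a z m) <=
    rsum (fun n => Cmod (dft F N n - a n)) m).
  { unfold psum; rewrite <- csum_minus.
    eapply Rle_trans; [apply Cmod_csum|]; apply rsum_le; intros n _.
    replace (dft F N n * z ^ n - a n * z ^ n)%C
      with ((dft F N n - a n) * z ^ n)%C by ring.
    rewrite Cmod_mult, Cmod_pow.
    assert (0 <= Cmod z ^ n <= 1) by (apply pow_01; lra).
    pose proof (Cmod_ge_0 (dft F N n - a n)); nra. }
  assert (H6 : Cmod z ^ N <= Cmod z ^ p).
  { replace N with (p + (N - p))%nat by lia; rewrite pow_add.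
    assert (0 <= Cmod z ^ p <= 1) by (apply pow_01; lra).
    assert (0 <= Cmod z ^ (N - p) <= 1) by (apply pow_01; lra); nra. }
  assert (H7 : Cmod (F z * (K - 1)) <= M * kappa * Cmod z ^ p).
  { rewrite Rmult_assoc; apply Cmod_mult_le; [apply HM; lra|].
    eapply Rle_trans; [exact H3|]; apply Rmult_le_compat_l; lra. }
  replace (psum a z m - F z)%C
    with (- (psum (dft F N) z m - psum a z m) +
          (- (A - psum (dft F N) z m) + ((A - F z * K) + F z * (K - 1))))%C by ring.
  eapply Rle_trans.
  - apply Cmod_plus_le; [rewrite Cmod_opp; exact H5|].
    apply Cmod_plus_le; [rewrite Cmod_opp; exact H2|].
    apply Cmod_plus_le; [exact H4 | exact H7].
  - fold N; lra.
Qed.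

Lemma holo_scale (r : R) (F : C -> C) :
  0 <= r <= 1 -> holo r F -> holo 1 (fun z => F (r * z)%C).
Proof.
  intros Hr (F' & M & HF).
  assert (Hc : forall z, Cmod z <= 1 -> Cmod (r * z) <= r).
  { intros z Hz; rewrite Cmod_Rscal by lra; pose proof (Cmod_ge_0 z); nra. }
  exists (fun z => r * F' (r * z))%C, M; intros z w Hz Hw.
  destruct (HF (r * z)%C (r * w)%C) as (H1 & H2 & H3); auto.
  assert (HM : 0 <= M) by (eapply Rle_trans; [apply Cmod_ge_0 | exact H1]).
  split; [exact H1|split].
  - rewrite Cmod_Rscal by lra.
    pose proof (Cmod_ge_0 (F' (r * z)%C)); nra.
  - replace (r * F' (r * z) * (w - z))%C
      with (F' (r * z) * (r * w - r * z))%C by ring.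
    eapply Rle_trans; [exact H3|]; apply Rmult_le_compat_l; [exact HM|].
    apply pow_incr; split; [apply Cmod_ge_0|].
    replace (r * w - r * z)%C with (r * (w - z))%C by ring.
    rewrite Cmod_Rscal by lra.
    pose proof (Cmod_ge_0 (w - z)); nra.
Qed.

(** The expansions on the disks of radius [r < 1] agree by uniqueness, after
    rescaling each disk to the unit disk. *)
Lemma holo_taylor (F : C -> C) :
  (forall r, 0 < r < 1 -> holo r F) -> exists a, taylor F a.
Proof.
  intros HF.
  assert (Hs : forall r, 0 < r < 1 -> exists b, taylor (fun z => F (r * z)%C) b).
  { intros r Hr; apply holo_closed_taylor, holo_scale; [lra | auto]. }
  destruct (Hs (1 / 2)) as [b Hb]; [lra|].
  set (a := fun n => (b n * RtoC 2 ^ n)%C).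
  assert (Ha : forall r, 1 / 2 <= r < 1 ->
    taylor (fun z => F (r * z)%C) (fun n => a n * RtoC r ^ n)%C).
  { intros r Hr; destruct (Hs r) as [c Hc]; [lra|].
    assert (Hq : 0 <= 1 / 2 / r <= 1).
    { apply quotient_01_le; lra. }
    pose proof (taylor_scale _ _ _ Hq Hc) as Hc'.
    assert (E : forall n, (c n * RtoC (1 / 2 / r) ^ n)%C = b n).
    { apply (taylor_unique _ _ _ _ Hc' Hb); intros z _; f_equal.
      rewrite Cmult_assoc, <- RtoC_mult; do 2 f_equal; field; lra. }
    replace (fun n => a n * RtoC r ^ n)%C with c; [exact Hc|].
    apply functional_extensionality; intros n; unfold a; rewrite <- E.
    rewrite <- !Cmult_assoc, <- !Cpow_mult_l, <- !RtoC_mult.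
    replace (1 / 2 / r * (2 * r)) with 1 by (field; lra).
    rewrite Cpow_1_l; ring. }
  exists a; apply taylor_lim; intros z Hz; unfold in_disk in Hz.
  pose proof (Cmod_ge_0 z) as Hz0.
  set (r := Rmax (1 / 2) ((1 + Cmod z) / 2)).
  assert (Hr : 1 / 2 <= r < 1).
  { unfold r; split; [apply Rmax_l | apply Rmax_lub_lt; lra]. }
  assert (Hzr : Cmod z < r).
  { eapply Rlt_le_trans; [|apply Rmax_r]; lra. }
  specialize (Ha r Hr); rewrite taylor_lim in Ha.
  assert (Hr0 : RtoC r <> 0) by (intros H; apply RtoC_inj in H; lra).
  assert (Hd : in_disk (z / r)%C).
  { unfold in_disk; rewrite Cmod_div by exact Hr0.
    rewrite Cmod_R, Rabs_pos_eq by lra.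
    apply quotient_01; lra. }
  specialize (Ha _ Hd).
  replace (r * (z / r))%C with z in Ha by (field; exact Hr0).
  apply (is_lim_seq_ext (fun n =>
    Cmod (psum (fun n => a n * RtoC r ^ n)%C (z / r)%C n - F z))); [|exact Ha].
  intros n; f_equal; f_equal; unfold psum; apply csum_ext; intros k _.
  rewrite <- Cmult_assoc, <- Cpow_mult_l; do 2 f_equal; field; exact Hr0.
Qed.

(** * Closure properties of complex differentiability *)

Lemma holo_const (r : R) (c : C) : holo r (fun _ => c).
Proof.
  exists (fun _ => RtoC 0), (Cmod c); intros z w _ _.
  split; [lra|split].
  - rewrite Cmod_0; apply Cmod_ge_0.
  - replace (c - c - 0 * (w - z))%C with (RtoC 0) by ring; rewrite Cmod_0.
    apply Rmult_le_pos; [apply Cmod_ge_0 | apply pow2_ge_0].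
Qed.

Lemma holo_id (r : R) : r <= 1 -> holo r (fun z => z).
Proof.
  intros Hr; exists (fun _ => RtoC 1), 1; intros z w Hz Hw.
  split; [lra|split].
  - rewrite Cmod_1; lra.
  - replace (w - z - 1 * (w - z))%C with (RtoC 0) by ring; rewrite Cmod_0.
    pose proof (pow2_ge_0 (Cmod (w - z))); lra.
Qed.

Lemma holo_plus (r : R) (F G : C -> C) :
  holo r F -> holo r G -> holo r (fun z => F z + G z)%C.
Proof.
  intros (F' & M & HF) (G' & N & HG).
  exists (fun z => F' z + G' z)%C, (M + N); intros z w Hz Hw.
  destruct (HF z w Hz Hw) as (F1 & F2 & F3).
  destruct (HG z w Hz Hw) as (G1 & G2 & G3).
  split; [|split]; try (eapply Rle_trans; [apply Cmod_triangle | lra]).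
  replace (F w + G w - (F z + G z) - (F' z + G' z) * (w - z))%C
    with ((F w - F z - F' z * (w - z)) + (G w - G z - G' z * (w - z)))%C by ring.
  eapply Rle_trans; [apply Cmod_triangle | lra].
Qed.

Lemma holo_mult (r : R) (F G : C -> C) :
  r <= 1 -> holo r F -> holo r G -> holo r (fun z => F z * G z)%C.
Proof.
  intros Hr (F' & M & HF) (G' & N & HG).
  exists (fun z => F' z * G z + F z * G' z)%C, (5 * M * N); intros z w Hz Hw.
  destruct (HF z w Hz Hw) as (F1 & F2 & F3).
  destruct (HG z w Hz Hw) as (G1 & G2 & G3).
  destruct (HG w z Hw Hz) as (G4 & _ & _).
  pose proof (Cmod_ge_0 (F z)); pose proof (Cmod_ge_0 (F' z)).
  pose proof (Cmod_ge_0 (G z)); pose proof (Cmod_ge_0 (G' z)).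
  assert (HMN : 0 <= M * N) by (apply Rmult_le_pos; lra).
  split; [|split].
  - eapply Rle_trans; [apply Cmod_mult_le; eassumption | lra].
  - eapply Rle_trans; [apply Cmod_plus_le; apply Cmod_mult_le; eassumption | lra].
  - set (d := Cmod (w - z)) in *.
    pose proof (holo_lipschitz G G' N z w G2 G3 ltac:(lra) ltac:(lra)) as GL.
    fold d in GL.
    assert (Hd : 0 <= d) by apply Cmod_ge_0.
    replace (F w * G w - F z * G z - (F' z * G z + F z * G' z) * (w - z))%C
      with ((F w - F z - F' z * (w - z)) * G w + (F' z * (w - z) * (G w - G z) +
            F z * (G w - G z - G' z * (w - z))))%C by ring.
    replace (5 * M * N * d ^ 2)
      with (M * d ^ 2 * N + (M * d * (3 * N * d) + M * (N * d ^ 2))) by ring.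
    repeat apply Cmod_plus_le; repeat apply Cmod_mult_le; auto; apply Rle_refl.
Qed.

Lemma holo_minus (r : R) (F G : C -> C) :
  r <= 1 -> holo r F -> holo r G -> holo r (fun z => F z - G z)%C.
Proof.
  intros Hr HF HG.
  replace (fun z => F z - G z)%C with (fun z => F z + (- RtoC 1) * G z)%C
    by (apply functional_extensionality; intros; ring).
  apply holo_plus; [exact HF|]; apply holo_mult; auto; apply holo_const.
Qed.

Lemma holo_inv (r m : R) (F : C -> C) :
  r <= 1 -> 0 < m -> (forall z, Cmod z <= r -> m <= Cmod (F z)) ->
  holo r F -> holo r (fun z => / F z)%C.
Proof.
  intros Hr Hm Hlow (F' & M & HF).
  set (i := / m).
  assert (Hi : 0 < i) by now apply Rinv_0_lt_compat.
  exists (fun z => - F' z * / F z * / F z)%C, (i + M * i * i + 4 * M * M * i * i * i).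
  intros z w Hz Hw.
  destruct (HF z w Hz Hw) as (F1 & F2 & F3).
  assert (HM : 0 <= M) by (eapply Rle_trans; [apply Cmod_ge_0 | exact F1]).
  assert (Hn : forall u, Cmod u <= r -> F u <> 0).
  { intros u Hu; apply Cmod_gt_0; specialize (Hlow u Hu); lra. }
  assert (Hinv : forall u, Cmod u <= r -> Cmod (/ F u) <= i).
  { intros u Hu; rewrite Cmod_inv by auto; apply Rinv_le_contravar; auto. }
  assert (0 <= M * i * i) by (repeat apply Rmult_le_pos; lra).
  assert (0 <= 4 * M * M * i * i * i) by (repeat apply Rmult_le_pos; lra).
  pose proof (Hinv z Hz) as I1; pose proof (Hinv w Hw) as I2.
  split; [|split].
  - lra.
  - apply Rle_trans with (M * i * i); [|lra].
    repeat apply Cmod_mult_le; rewrite ?Cmod_opp; auto.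
  - set (d := Cmod (w - z)) in *.
    pose proof (holo_lipschitz F F' M z w F2 F3 ltac:(lra) ltac:(lra)) as FL.
    fold d in FL.
    assert (Hd : 0 <= d) by apply Cmod_ge_0.
    replace (/ F w - / F z - - F' z * / F z * / F z * (w - z))%C
      with ((F' z * (w - z) * (F w - F z) - F z * (F w - F z - F' z * (w - z))) *
            (/ F z * / F z * / F w))%C by (field; auto).
    apply Rle_trans with ((M * d * (3 * M * d) + M * (M * d ^ 2)) * (i * i * i)).
    + apply Cmod_mult_le; [|repeat apply Cmod_mult_le; auto].
      apply Cmod_minus_le; repeat apply Cmod_mult_le; auto; apply Rle_refl.
    + pose proof (pow2_ge_0 d); nra.
Qed.

Lemma holo_comp (r q : R) (f F : C -> C) :
  r <= 1 -> q <= 1 -> (forall z, Cmod z <= r -> Cmod (F z) <= q) ->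
  holo q f -> holo r F -> holo r (fun z => f (F z)).
Proof.
  intros Hr Hq HFq (f' & N & Hf) (F' & M & HF).
  exists (fun z => f' (F z) * F' z)%C, (N + N * M + N * (9 * M * M) + N * M).
  intros z w Hz Hw.
  destruct (HF z w Hz Hw) as (F1 & F2 & F3).
  destruct (Hf (F z) (F w) (HFq z Hz) (HFq w Hw)) as (f1 & f2 & f3).
  assert (HM : 0 <= M) by (eapply Rle_trans; [apply Cmod_ge_0 | exact F1]).
  assert (HN : 0 <= N) by (eapply Rle_trans; [apply Cmod_ge_0 | exact f1]).
  assert (0 <= N * M) by (apply Rmult_le_pos; lra).
  assert (0 <= N * (9 * M * M)) by (repeat apply Rmult_le_pos; lra).
  split; [lra|split].
  - apply Rle_trans with (N * M); [now apply Cmod_mult_le | lra].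
  - set (d := Cmod (w - z)) in *.
    pose proof (holo_lipschitz F F' M z w F2 F3 ltac:(lra) ltac:(lra)) as FL.
    fold d in FL.
    assert (Hd : 0 <= d) by apply Cmod_ge_0.
    replace (f (F w) - f (F z) - f' (F z) * F' z * (w - z))%C
      with ((f (F w) - f (F z) - f' (F z) * (F w - F z)) +
            f' (F z) * (F w - F z - F' z * (w - z)))%C by ring.
    apply Rle_trans with (N * (3 * M * d) ^ 2 + N * (M * d ^ 2)).
    + apply Cmod_plus_le; [|now apply Cmod_mult_le].
      eapply Rle_trans; [exact f3|]; apply Rmult_le_compat_l; [exact HN|].
      apply pow_incr; split; [apply Cmod_ge_0 | exact FL].
    + pose proof (pow2_ge_0 d).
      assert (0 <= N * d ^ 2) by (apply Rmult_le_pos; lra).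
      assert (0 <= N * M * d ^ 2) by (apply Rmult_le_pos; lra).
      lra.
Qed.

(** A square root stays differentiable as long as it keeps away from the
    imaginary axis: [S w + S z] is then bounded below. *)
Lemma holo_sqrt (r m : R) (F S : C -> C) :
  r <= 1 -> 0 < m ->
  (forall z, Cmod z <= r -> (S z * S z = F z)%C /\ m <= Re (S z)) ->
  holo r F -> holo r S.
Proof.
  intros Hr Hm HS (F' & M & HF).
  set (i := / m).
  assert (Hi : 0 < i) by now apply Rinv_0_lt_compat.
  exists (fun z => F' z * / (2 * S z))%C, (1 + M + M * i + (M + (3 * M * i) ^ 2) * i).
  intros z w Hz Hw.
  destruct (HF z w Hz Hw) as (F1 & F2 & F3).
  destruct (HS z Hz) as (S1 & S2); destruct (HS w Hw) as (S3 & S4).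
  assert (HM : 0 <= M) by (eapply Rle_trans; [apply Cmod_ge_0 | exact F1]).
  assert (Hlow : forall u, m <= Re u -> m <= Cmod u).
  { intros u Hu; eapply Rle_trans; [exact Hu|].
    eapply Rle_trans; [apply Rle_abs | apply re_le_Cmod]. }
  assert (L1 : m <= Cmod (2 * S z)).
  { apply Hlow.
    replace (Re (2 * S z)) with (2 * Re (S z)); [lra|].
    destruct (S z); unfold Re, Cmult, RtoC; simpl; ring. }
  assert (L2 : m <= Cmod (S w + S z)).
  { apply Hlow.
    replace (Re (S w + S z)) with (Re (S w) + Re (S z)) by reflexivity; lra. }
  assert (N1 : (2 * S z)%C <> 0) by (apply Cmod_gt_0; lra).
  assert (N0 : S z <> 0).
  { intros E; apply N1; rewrite E; ring. }
  assert (N2 : (S w + S z)%C <> 0) by (apply Cmod_gt_0; lra).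
  assert (I1 : Cmod (/ (2 * S z)) <= i)
    by (rewrite Cmod_inv by auto; apply Rinv_le_contravar; auto).
  assert (I2 : Cmod (/ (S w + S z)) <= i)
    by (rewrite Cmod_inv by auto; apply Rinv_le_contravar; auto).
  pose proof (pow2_ge_0 (3 * M * i)) as Hp.
  assert (0 <= M * i) by (apply Rmult_le_pos; lra).
  assert (0 <= (M + (3 * M * i) ^ 2) * i) by (apply Rmult_le_pos; lra).
  split; [|split].
  - assert (Cmod (S z) * Cmod (S z) <= M) by (rewrite <- Cmod_mult, S1; exact F1).
    pose proof (Cmod_ge_0 (S z)); nra.
  - apply Rle_trans with (M * i); [now apply Cmod_mult_le | lra].
  - set (d := Cmod (w - z)) in *.
    pose proof (holo_lipschitz F F' M z w F2 F3 ltac:(lra) ltac:(lra)) as FL.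
    fold d in FL.
    assert (Hd : 0 <= d) by apply Cmod_ge_0.
    assert (SL : Cmod (S w - S z) <= 3 * M * d * i).
    { replace (S w - S z)%C with ((F w - F z) * / (S w + S z))%C
        by (rewrite <- S1, <- S3; field; auto).
      now apply Cmod_mult_le. }
    replace (S w - S z - F' z * / (2 * S z) * (w - z))%C
      with ((F w - F z - F' z * (w - z) + - ((S w - S z) * (S w - S z))) *
            / (2 * S z))%C by (rewrite <- S1, <- S3; field; auto).
    apply Rle_trans with ((M * d ^ 2 + (3 * M * d * i) * (3 * M * d * i)) * i).
    + apply Cmod_mult_le; [|exact I1].
      apply Cmod_plus_le; [exact F3 | rewrite Cmod_opp; now apply Cmod_mult_le].
    + pose proof (pow2_ge_0 d).
      assert (0 <= (1 + M + M * i) * d ^ 2) by (apply Rmult_le_pos; lra).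
      replace ((M * d ^ 2 + 3 * M * d * i * (3 * M * d * i)) * i)
        with ((M + (3 * M * i) ^ 2) * i * d ^ 2) by ring.
      lra.
Qed.

(** Each of the [k] terms [t^j], [j < k], is at least [t^k]. *)
Lemma INR_mult_pow_le (t : R) (k : nat) : 0 <= t < 1 -> INR k * t ^ k <= / (1 - t).
Proof.
  intros Ht; eapply Rle_trans; [|apply (rsum_geom_le t k Ht)].
  rewrite <- rsum_const; apply rsum_le; intros j Hj.
  replace k with (j + (k - j))%nat by lia; rewrite pow_add.
  assert (0 <= t ^ j <= 1) by (apply pow_01; lra).
  assert (0 <= t ^ (k - j) <= 1) by (apply pow_01; lra); nra.
Qed.

(** The factor [k^2] is absorbed by splitting the ratio [q / p] into two equal
    geometric factors, one for each power of [k]. *)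
Lemma taylor_coef_quadratic (f : C -> C) (a : nat -> C) (q : R) :
  taylor f a -> 0 < q < 1 ->
  exists T y, 0 <= T /\ 0 <= y < 1 /\
    forall k, Cmod (a k) * (INR k ^ 2 * q ^ k) <= T * y ^ k.
Proof.
  intros Hf Hq.
  set (y := (2 + q) / 3); set (p := (1 + 2 * q) / 3).
  assert (Hy : 0 <= y < 1) by (unfold y; lra).
  assert (Hp : q < p < y) by (unfold p, y; lra).
  destruct (taylor_coef_bound f a y Hf Hy) as [B HB].
  assert (HB0 : 0 <= B).
  { specialize (HB O); pose proof (Cmod_ge_0 (a O)); simpl in HB; lra. }
  set (t := sqrt (q / p)).
  assert (Hqp : 0 <= q / p < 1).
  { apply quotient_01; lra. }
  assert (Ht : 0 <= t < 1).
  { split; [apply sqrt_pos|]; rewrite <- sqrt_1; apply sqrt_lt_1; lra. }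
  assert (Htt : t * t = q / p) by (apply sqrt_sqrt; lra).
  assert (Hpy : 0 <= p / y < 1).
  { apply quotient_01; lra. }
  assert (Hit : 0 < / (1 - t)) by (apply Rinv_0_lt_compat; lra).
  exists (B * (/ (1 - t)) ^ 2), (p / y); split; [|split; [exact Hpy|]].
  { apply Rmult_le_pos; [exact HB0 | apply pow2_ge_0]. }
  intros k.
  replace (INR k ^ 2 * q ^ k) with ((INR k * t ^ k) ^ 2 * p ^ k).
  2:{ replace q with (t * t * p) by (rewrite Htt; field; lra).
      rewrite !Rpow_mult_distr; ring. }
  replace (Cmod (a k) * ((INR k * t ^ k) ^ 2 * p ^ k))
    with ((Cmod (a k) * y ^ k) * (INR k * t ^ k) ^ 2 * (p / y) ^ k).
  2:{ replace (p ^ k) with ((p / y) ^ k * y ^ k); [ring|].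
      rewrite <- Rpow_mult_distr; f_equal; field; lra. }
  apply Rmult_le_compat_r; [apply pow_le; lra|].
  apply Rmult_le_compat; [|apply pow2_ge_0 | apply HB |].
  - apply Rmult_le_pos; [apply Cmod_ge_0 | apply pow_le; lra].
  - apply pow_incr; split; [|now apply INR_mult_pow_le].
    apply Rmult_le_pos; [apply pos_INR | apply pow_le; lra].
Qed.

(** [k z^(k-1)], by the Leibniz rule so that [k = 0] needs no separate case. *)
Fixpoint dpow (z : C) (k : nat) : C :=
  match k with O => RtoC 0 | S j => (z ^ j + z * dpow z j)%C end.

Lemma dpow_bound (q : R) (z w : C) (k : nat) :
  0 < q -> Cmod z <= q -> Cmod w <= q ->
  q * Cmod (dpow z k) <= INR k * q ^ k /\
  q * Cmod (w ^ k - z ^ k) <= INR k * q ^ k * Cmod (w - z) /\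
  q ^ 2 * Cmod (w ^ k - z ^ k - dpow z k * (w - z)) <=
    INR k ^ 2 * q ^ k * Cmod (w - z) ^ 2.
Proof.
  intros Hq Hz Hw; set (d := Cmod (w - z)).
  assert (Hd : 0 <= d) by apply Cmod_ge_0.
  induction k as [|k (IH1 & IH2 & IH3)].
  - simpl; replace (1 - 1)%C with (RtoC 0) by ring.
    replace (0 - 0 * (w - z))%C with (RtoC 0) by ring; rewrite Cmod_0; lra.
  - assert (Hzk : Cmod (z ^ k) <= q ^ k)
      by (rewrite Cmod_pow; apply pow_incr; split; [apply Cmod_ge_0 | exact Hz]).
    assert (Hwk : Cmod (w ^ k) <= q ^ k)
      by (rewrite Cmod_pow; apply pow_incr; split; [apply Cmod_ge_0 | exact Hw]).
    assert (Hqk : 0 <= q ^ k) by (apply pow_le; lra).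
    pose proof (Cmod_ge_0 z) as Hz0.
    pose proof (pos_INR k) as Hk.
    assert (Hmul : forall x y, 0 <= x -> x <= y -> Cmod z * x <= q * y)
      by (intros x y H1 H2; apply Rmult_le_compat; assumption).
    rewrite S_INR; change (q ^ S k) with (q * q ^ k).
    change (dpow z (S k)) with (z ^ k + z * dpow z k)%C; rewrite !Cpow_S.
    split; [|split].
    + assert (Cmod (z ^ k + z * dpow z k) <= q ^ k + Cmod z * Cmod (dpow z k)).
      { eapply Rle_trans; [apply Cmod_triangle|]; rewrite Cmod_mult; lra. }
      pose proof (Hmul (q * Cmod (dpow z k)) _
        ltac:(apply Rmult_le_pos; [lra | apply Cmod_ge_0]) IH1).
      nra.
    + replace (w * w ^ k - z * z ^ k)%C
        with ((w - z) * w ^ k + z * (w ^ k - z ^ k))%C by ring.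
      assert (Cmod ((w - z) * w ^ k + z * (w ^ k - z ^ k)) <=
              d * q ^ k + Cmod z * Cmod (w ^ k - z ^ k)).
      { eapply Rle_trans; [apply Cmod_triangle|]; rewrite !Cmod_mult; fold d.
        apply Rplus_le_compat_r, Rmult_le_compat_l; assumption. }
      pose proof (Hmul (q * Cmod (w ^ k - z ^ k)) _
        ltac:(apply Rmult_le_pos; [lra | apply Cmod_ge_0]) IH2).
      nra.
    + replace (w * w ^ k - z * z ^ k - (z ^ k + z * dpow z k) * (w - z))%C
        with ((w - z) * (w ^ k - z ^ k) +
              z * (w ^ k - z ^ k - dpow z k * (w - z)))%C by ring.
      set (e := (w ^ k - z ^ k - dpow z k * (w - z))%C) in *.
      assert (H1 : Cmod ((w - z) * (w ^ k - z ^ k) + z * e) <=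
              d * Cmod (w ^ k - z ^ k) + Cmod z * Cmod e).
      { eapply Rle_trans; [apply Cmod_triangle|]; rewrite !Cmod_mult; fold d; lra. }
      pose proof (Hmul (q ^ 2 * Cmod e) _
        ltac:(apply Rmult_le_pos; [apply pow2_ge_0 | apply Cmod_ge_0]) IH3) as H2.
      assert (H3 : q * d * (q * Cmod (w ^ k - z ^ k)) <= q * d * (INR k * q ^ k * d))
        by (apply Rmult_le_compat_l; [nra | exact IH2]).
      apply Rle_trans with
        (q * d * (q * Cmod (w ^ k - z ^ k)) + Cmod z * (q ^ 2 * Cmod e)).
      * replace (q * d * (q * Cmod (w ^ k - z ^ k)) + Cmod z * (q ^ 2 * Cmod e))
          with (q ^ 2 * (d * Cmod (w ^ k - z ^ k) + Cmod z * Cmod e)) by ring.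
        apply Rmult_le_compat_l; [apply pow2_ge_0 | exact H1].
      * assert (0 <= q * q ^ k * d ^ 2)
          by (apply Rmult_le_pos; [nra | apply pow2_ge_0]).
        replace ((INR k + 1) ^ 2 * (q * q ^ k) * d ^ 2)
          with (INR k ^ 2 * (q * q ^ k) * d ^ 2 + INR k * (q * q ^ k * d ^ 2)
                + (INR k + 1) * (q * q ^ k * d ^ 2)) by ring.
        assert (0 <= (INR k + 1) * (q * q ^ k * d ^ 2)) by (apply Rmult_le_pos; lra).
        lra.
Qed.

(** Termwise differentiation: the quadratic remainders of the monomials are
    summable against the coefficients. *)
Lemma taylor_holo (f : C -> C) (a : nat -> C) (q : R) :
  taylor f a -> 0 < q < 1 -> holo q f.
Proof.
  intros Hf Hq.
  destruct (taylor_coef_quadratic f a q Hf Hq) as (T & y & HT & Hy & Hquad).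
  destruct (taylor_unif f a q Hf ltac:(lra)) as (D & p & HD & Hp & Hunif).
  assert (Hk2 : forall k, INR k <= INR k ^ 2).
  { intros [|k]; [simpl; lra|]; rewrite S_INR; pose proof (pos_INR k); nra. }
  assert (Hdom : forall z, Cmod z <= q -> forall k,
    Cmod (a k * dpow z k) <= T / q * y ^ k).
  { intros z Hz k; rewrite Cmod_mult.
    destruct (dpow_bound q z z k ltac:(lra) Hz Hz) as (H1 & _ & _).
    apply Rmult_le_reg_l with q; [lra|].
    replace (q * (T / q * y ^ k)) with (T * y ^ k) by (field; lra).
    eapply Rle_trans; [|apply Hquad].
    replace (q * (Cmod (a k) * Cmod (dpow z k)))
      with (Cmod (a k) * (q * Cmod (dpow z k))) by ring.
    apply Rmult_le_compat_l; [apply Cmod_ge_0|].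
    eapply Rle_trans; [exact H1|].
    apply Rmult_le_compat_r; [apply pow_le; lra | apply Hk2]. }
  assert (Hder : forall z, exists l, Cmod z <= q ->
    is_lim_seq (fun n => Cmod (csum (fun k => a k * dpow z k)%C n - l)) 0 /\
    Cmod l <= T / q / (1 - y)).
  { intros z; destruct (Rle_dec (Cmod z) q) as [Hz|Hz].
    - destruct (csum_geometric_lim _ _ _ Hy (Hdom z Hz)) as (l & Hl); eauto.
    - exists (RtoC 0); intros; contradiction. }
  set (f' := fun z => proj1_sig (constructive_indefinite_description _ (Hder z))).
  assert (Hf' : forall z, Cmod z <= q ->
    is_lim_seq (fun n => Cmod (csum (fun k => a k * dpow z k)%C n - f' z)) 0 /\
    Cmod (f' z) <= T / q / (1 - y))
    by (intros z; exact (proj2_sig (constructive_indefinite_description _ (Hder z)))).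
  assert (Hy1 : 0 < / (1 - y)) by (apply Rinv_0_lt_compat; lra).
  assert (P1 : 0 <= T / q / (1 - y)) by (repeat apply Rdiv_le_0_compat; lra).
  assert (P2 : 0 <= T / q ^ 2 / (1 - y)).
  { apply Rdiv_le_0_compat; [|lra]; apply Rdiv_le_0_compat; [lra | nra]. }
  exists f', (D + T / q / (1 - y) + T / q ^ 2 / (1 - y)); intros z w Hz Hw.
  destruct (Hf' z Hz) as [Hl Hb].
  split; [|split].
  - pose proof (Hunif z O Hz) as H0; unfold psum in H0; simpl in H0.
    replace (0 - f z)%C with (- f z)%C in H0 by ring; rewrite Cmod_opp in H0; lra.
  - lra.
  - rewrite taylor_lim in Hf.
    pose proof (Hf z ltac:(unfold in_disk; lra)) as Lz.
    pose proof (Hf w ltac:(unfold in_disk; lra)) as Lw.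
    set (d := Cmod (w - z)).
    assert (Hlim : is_lim_seq (fun n => Cmod (
      csum (fun k => a k * (w ^ k - z ^ k - dpow z k * (w - z)))%C n -
      (f w - f z - f' z * (w - z)))) 0).
    { apply (lim_0_le _ _ (lim_0_plus _ _ Lw (lim_0_plus _ _ Lz (lim_0_scal d _ Hl)))).
      intros n; split; [apply Cmod_ge_0|].
      replace (csum (fun k => a k * (w ^ k - z ^ k - dpow z k * (w - z)))%C n)
        with (psum a w n - psum a z n - (w - z) * csum (fun k => a k * dpow z k) n)%C.
      2:{ unfold psum; rewrite <- csum_scal, <- !csum_minus; apply csum_ext.
          intros; ring. }
      set (v := csum (fun k => a k * dpow z k)%C n).
      replace (psum a w n - psum a z n - (w - z) * v - (f w - f z - f' z * (w - z)))%C
        with ((psum a w n - f w) + (- (psum a z n - f z) + - ((w - z) * (v - f' z))))%C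
        by ring.
      eapply Rle_trans; [apply Cmod_triangle|].
      eapply Rle_trans; [apply Rplus_le_compat_l, Cmod_triangle|].
      rewrite !Cmod_opp, Cmod_mult; fold d; lra. }
    apply Rle_trans with (T / q ^ 2 * d ^ 2 / (1 - y)).
    + apply (lim_Cmod_le _ _ _ Hlim); intros n.
      apply csum_geometric_le; [exact Hy|]; intros k; rewrite Cmod_mult.
      destruct (dpow_bound q z w k ltac:(lra) Hz Hw) as (_ & _ & H3); fold d in H3.
      assert (Hq2 : 0 < q ^ 2) by nra.
      apply Rmult_le_reg_l with (q ^ 2); [exact Hq2|].
      replace (q ^ 2 * (T / q ^ 2 * d ^ 2 * y ^ k)) with (T * y ^ k * d ^ 2)
        by (field; lra).
      apply Rle_trans with (Cmod (a k) * (INR k ^ 2 * q ^ k) * d ^ 2).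
      * replace (Cmod (a k) * (INR k ^ 2 * q ^ k) * d ^ 2)
          with (Cmod (a k) * (INR k ^ 2 * q ^ k * d ^ 2)) by ring.
        replace (q ^ 2 * (Cmod (a k) * Cmod (w ^ k - z ^ k - dpow z k * (w - z))))
          with (Cmod (a k) * (q ^ 2 * Cmod (w ^ k - z ^ k - dpow z k * (w - z)))) by ring.
        apply Rmult_le_compat_l; [apply Cmod_ge_0 | exact H3].
      * apply Rmult_le_compat_r; [apply pow2_ge_0 | apply Hquad].
    + replace (T / q ^ 2 * d ^ 2 / (1 - y)) with (T / q ^ 2 / (1 - y) * d ^ 2)
        by (field; lra).
      apply Rmult_le_compat_r; [apply pow2_ge_0 | lra].
Qed.

(** * The principal argument, square root and logarithm *)

Lemma Cmod_sq (z : C) : Cmod z * Cmod z = Re z ^ 2 + Im z ^ 2.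
Proof. rewrite <- Cmod2_alt; ring. Qed.

Lemma Re_le_Cmod (z : C) : Re z <= Cmod z.
Proof. eapply Rle_trans; [apply Rle_abs | apply re_le_Cmod]. Qed.

Lemma Im_le_Cmod (z : C) : Im z <= Cmod z.
Proof.
  pose proof (Cmod_sq z); pose proof (Cmod_ge_0 z); pose proof (pow2_ge_0 (Re z)); nra.
Qed.

Lemma Carg_polar (w : C) : w <> 0 ->
  - PI <= Carg w <= PI /\
  Cmod w * cos (Carg w) = Re w /\ Cmod w * sin (Carg w) = Im w.
Proof.
  intros Hw; assert (Hp : 0 < Cmod w) by now apply Cmod_gt_0.
  pose proof (Cmod_sq w) as Hsq.
  assert (Ht : -1 <= Re w / Cmod w <= 1).
  { pose proof (re_le_Cmod w) as H; apply Rabs_le_between in H.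
    split; apply Rmult_le_reg_r with (Cmod w); try exact Hp;
      unfold Rdiv; rewrite Rmult_assoc, Rinv_l; lra. }
  pose proof (acos_bound (Re w / Cmod w)) as Hb.
  assert (Hs : Cmod w * sin (acos (Re w / Cmod w)) = Rabs (Im w)).
  { rewrite sin_acos by exact Ht.
    replace (1 - Rsqr (Re w / Cmod w)) with (Rsqr (Im w / Cmod w)).
    - rewrite sqrt_Rsqr_abs; unfold Rdiv; rewrite Rabs_mult, (Rabs_pos_eq (/ Cmod w));
        [field; lra | left; now apply Rinv_0_lt_compat].
    - unfold Rsqr; apply Rmult_eq_reg_r with (Cmod w * Cmod w); [|nra].
      replace (Im w / Cmod w * (Im w / Cmod w) * (Cmod w * Cmod w))
        with (Im w ^ 2) by (field; lra).
      replace ((1 - Re w / Cmod w * (Re w / Cmod w)) * (Cmod w * Cmod w))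
        with (Cmod w * Cmod w - Re w ^ 2) by (field; lra).
      rewrite Hsq; ring. }
  assert (Hc : Cmod w * cos (acos (Re w / Cmod w)) = Re w)
    by (rewrite cos_acos by exact Ht; field; lra).
  unfold Carg; destruct (Rle_dec 0 (Im w)) as [Hi|Hi].
  - rewrite Hs, Hc, Rabs_pos_eq by exact Hi; lra.
  - rewrite cos_neg, sin_neg, Hc.
    replace (Cmod w * - sin (acos (Re w / Cmod w)))
      with (- (Cmod w * sin (acos (Re w / Cmod w)))) by ring.
    rewrite Hs, Rabs_left by lra; lra.
Qed.

Lemma Csqrt_sq (w : C) : w <> 0 -> (Csqrt w * Csqrt w = w)%C /\ 0 <= Re (Csqrt w).
Proof.
  intros Hw; destruct (Carg_polar w Hw) as (Hb & Hc & Hs).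
  assert (Hp : 0 < Cmod w) by now apply Cmod_gt_0.
  pose proof (sqrt_sqrt (Cmod w) ltac:(lra)) as Hq.
  assert (Ha : Carg w = 2 * (Carg w / 2)) by field.
  rewrite Ha, cos_2a in Hc; rewrite Ha, sin_2a in Hs.
  set (t := Carg w / 2) in *.
  split.
  - rewrite (surjective_pairing w) at 3; change (fst w) with (Re w).
    change (snd w) with (Im w); rewrite <- Hc, <- Hs.
    unfold Csqrt, Cmult; simpl; fold t; f_equal.
    + rewrite <- Hq at 5; ring.
    + rewrite <- Hq at 5; ring.
  - unfold Csqrt, Re; simpl; fold t; apply Rmult_le_pos; [apply sqrt_pos|].
    apply cos_ge_0; unfold t; lra.
Qed.

(** The other square root has negative real part. *)
Lemma Csqrt_unique (w s : C) : 0 < Re s -> (s * s = w)%C -> Csqrt w = s.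
Proof.
  intros Hs E.
  assert (Hs0 : s <> 0) by (intros H; rewrite H in Hs; simpl in Hs; lra).
  assert (Hw : w <> 0) by (rewrite <- E; now apply Cmult_neq_0).
  destruct (Csqrt_sq w Hw) as [H1 H2].
  assert (H : ((Csqrt w - s) * (Csqrt w + s) = 0)%C).
  { replace ((Csqrt w - s) * (Csqrt w + s))%C
      with (Csqrt w * Csqrt w - s * s)%C by ring.
    rewrite H1, E; ring. }
  assert (Hn : (Csqrt w + s)%C <> 0).
  { intros H0; apply (f_equal Re) in H0.
    change (Re (Csqrt w) + Re s = 0) in H0; lra. }
  replace (Csqrt w) with ((Csqrt w - s) * (Csqrt w + s) / (Csqrt w + s) + s)%C
    by (field; exact Hn).
  rewrite H; field; exact Hn.
Qed.

Lemma Carg_atan (p : C) : 0 < Re p -> Carg p = atan (Im p / Re p).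
Proof.
  intros Hp.
  assert (Hn : p <> 0) by (intros H; rewrite H in Hp; simpl in Hp; lra).
  destruct (Carg_polar p Hn) as (Hb & Hc & Hs).
  assert (Hm : 0 < Cmod p) by now apply Cmod_gt_0.
  assert (Hcos : 0 < cos (Carg p)).
  { apply Rmult_lt_reg_l with (Cmod p); [exact Hm|]; lra. }
  assert (Hr : - PI / 2 < Carg p < PI / 2).
  { pose proof PI_RGT_0.
    split; apply Rnot_le_lt; intros H0.
    - assert (cos (- Carg p) <= 0) by (apply cos_le_0; lra).
      rewrite cos_neg in *; lra.
    - assert (cos (Carg p) <= 0) by (apply cos_le_0; lra); lra. }
  rewrite <- (atan_tan (Carg p)) by lra; f_equal.
  unfold tan; rewrite <- Hc, <- Hs; field; lra.
Qed.

Lemma Carg_bound (p : C) : 0 < Re p -> - (PI / 2) < Carg p < PI / 2.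
Proof.
  intros Hp; rewrite Carg_atan by exact Hp.
  pose proof (atan_bound (Im p / Re p)); lra.
Qed.

Lemma Clog_1 : Clog 1 = 0.
Proof.
  unfold Clog; rewrite Cmod_1, ln_1, Carg_atan by (simpl; lra).
  unfold Re, Im, RtoC; simpl; replace (0 / 1) with 0 by field; now rewrite atan_0.
Qed.

Lemma mean_value_01 (f df : R -> R) :
  (forall t, 0 <= t <= 1 -> is_derive f t (df t)) ->
  exists t, 0 <= t <= 1 /\ f 1 - f 0 = df t.
Proof.
  intros H; destruct (MVT_gen f 0 1 df) as (c & Hc & E);
    rewrite ?Rmin_left, ?Rmax_right in * by lra.
  - intros t Ht; apply H; lra.
  - intros t Ht; apply continuity_pt_filterlim.
    apply (ex_derive_continuous f); eexists; now apply H.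
  - exists c; split; [exact Hc | rewrite E; ring].
Qed.

(** Both coordinates of the logarithm are differentiated along the segment
    from [p] to [q]; the derivative is [(q - p) / p_t] and varies little. *)
Lemma Clog_quadratic (p q : C) (m : R) :
  0 < m -> m <= Re p -> m <= Re q ->
  Cmod (Clog q - Clog p - (q - p) / p) <= 2 * Cmod (q - p) ^ 2 * (/ m) ^ 2.
Proof.
  intros Hm Hp Hq; set (h := (q - p)%C).
  set (pt := fun t : R => (p + t * h)%C).
  assert (Hpt : forall t, 0 <= t <= 1 -> m <= Re (pt t)).
  { intros t Ht; unfold pt, h.
    replace (Re (p + t * (q - p))) with ((1 - t) * Re p + t * Re q); [nra|].
    destruct p, q; unfold Re; simpl; ring. }
  set (x0 := Re p); set (y0 := Im p); set (hx := Re h); set (hy := Im h).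
  assert (Ept : forall t, pt t = (x0 + t * hx, y0 + t * hy)).
  { intros t; unfold pt, x0, y0, hx, hy.
    destruct p as [a b], h as [c d]; unfold Cplus, Cmult, RtoC, Re, Im; simpl.
    f_equal; ring. }
  assert (Hxt : forall t, 0 <= t <= 1 -> m <= x0 + t * hx).
  { intros t Ht; specialize (Hpt t Ht); rewrite Ept in Hpt; exact Hpt. }
  set (D := fun t => (h / pt t)%C).
  assert (ED : forall t, 0 <= t <= 1 -> D t =
    ((hx * (x0 + t * hx) + hy * (y0 + t * hy)) / ((x0 + t * hx) ^ 2 + (y0 + t * hy) ^ 2),
     (hy * (x0 + t * hx) - hx * (y0 + t * hy)) / ((x0 + t * hx) ^ 2 + (y0 + t * hy) ^ 2))).
  { intros t Ht; specialize (Hxt t Ht); unfold D; rewrite Ept.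
    rewrite (surjective_pairing h); change (fst h) with hx; change (snd h) with hy.
    assert ((x0 + t * hx) ^ 2 + (y0 + t * hy) ^ 2 <> 0)
      by (pose proof (pow2_ge_0 (y0 + t * hy)); nra).
    unfold Cdiv, Cmult, Cinv; simpl fst; simpl snd; f_equal; field; auto. }
  assert (Hn0 : forall t, 0 <= t <= 1 -> pt t <> 0).
  { intros t Ht H; specialize (Hpt t Ht); rewrite H in Hpt; simpl in Hpt; lra. }
  assert (Hmod : forall t, 0 <= t <= 1 -> Cmod (/ pt t) <= / m).
  { intros t Ht; rewrite Cmod_inv by auto.
    apply Rinv_le_contravar; [exact Hm|].
    eapply Rle_trans; [apply Hpt, Ht | apply Re_le_Cmod]. }
  assert (HD : forall t, 0 <= t <= 1 -> Cmod (D t - D 0) <= Cmod h ^ 2 * (/ m) ^ 2).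
  { intros t Ht; assert (H0 : 0 <= 0 <= 1) by lra.
    assert (E : (D t - D 0 = - (t * (h * h)) * (/ pt t * / pt 0))%C).
    { assert (Ed : (pt 0 - pt t = - (t * h))%C) by (unfold pt; ring).
      replace (- (t * (h * h)))%C with (h * (pt 0 - pt t))%C by (rewrite Ed; ring).
      unfold D; field; split; auto. }
    rewrite E.
    replace (Cmod h ^ 2 * (/ m) ^ 2) with ((1 * (Cmod h * Cmod h)) * (/ m * / m)) by ring.
    apply Cmod_mult_le; [rewrite Cmod_opp|]; repeat apply Cmod_mult_le; auto;
      rewrite ?Cmod_R, ?Rabs_pos_eq; lra. }
  assert (Ep0 : pt 0 = p) by (unfold pt; ring).
  assert (Eq1 : pt 1 = q) by (unfold pt, h; ring).
  assert (Hs : forall t, 0 <= t <= 1 -> 0 < (x0 + t * hx) ^ 2 + (y0 + t * hy) ^ 2).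
  { intros t Ht; specialize (Hxt t Ht); pose proof (pow2_ge_0 (y0 + t * hy)); nra. }
  assert (Hre : exists t, 0 <= t <= 1 /\ Re (Clog q) - Re (Clog p) = Re (D t)).
  { rewrite <- Ep0, <- Eq1.
    apply (mean_value_01 (fun t => Re (Clog (pt t))) (fun t => Re (D t))).
    intros t Ht; rewrite ED by lra; unfold Re at 2; simpl fst.
    apply (is_derive_ext (fun t => ln (sqrt ((x0 + t * hx) ^ 2 + (y0 + t * hy) ^ 2)))).
    { intros u; rewrite Ept; reflexivity. }
    specialize (Hs t Ht); auto_derive;
      replace ((x0 + t * hx) * ((x0 + t * hx) * 1) + (y0 + t * hy) * ((y0 + t * hy) * 1))
        with ((x0 + t * hx) ^ 2 + (y0 + t * hy) ^ 2) by ring;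
      set (S := (x0 + t * hx) ^ 2 + (y0 + t * hy) ^ 2) in *;
      pose proof (sqrt_lt_R0 S Hs) as Hs2; [now auto|].
    pose proof (sqrt_sqrt S ltac:(lra)) as Hss; set (r := sqrt S) in *.
    rewrite <- Hss; field; lra. }
  assert (Him : exists t, 0 <= t <= 1 /\ Im (Clog q) - Im (Clog p) = Im (D t)).
  { assert (Ea : forall t, 0 <= t <= 1 ->
      Im (Clog (pt t)) = atan ((y0 + t * hy) / (x0 + t * hx))).
    { intros t Ht; unfold Clog, Im; simpl snd.
      rewrite Carg_atan by (specialize (Hpt t Ht); lra); rewrite Ept; reflexivity. }
    rewrite <- Ep0, <- Eq1, !Ea by lra.
    apply (mean_value_01 (fun t => atan ((y0 + t * hy) / (x0 + t * hx)))
             (fun t => Im (D t))).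
    intros t Ht; rewrite ED by lra; unfold Im; simpl snd.
    specialize (Hxt t Ht); specialize (Hs t Ht).
    auto_derive; [lra|]; field; repeat split; try lra; nra. }
  destruct Hre as (t & Ht & Er); destruct Him as (u & Hu & Ei).
  replace (h / p)%C with (D 0) by (unfold D; rewrite Ep0; reflexivity).
  set (e := (Clog q - Clog p - D 0)%C).
  assert (E1 : Re e = Re (D t - D 0)).
  { change (Re (Clog q) - Re (Clog p) - Re (D 0) = Re (D t) - Re (D 0)); lra. }
  assert (E2 : Im e = Im (D u - D 0)).
  { change (Im (Clog q) - Im (Clog p) - Im (D 0) = Im (D u) - Im (D 0)); lra. }
  pose proof (HD t Ht) as H1; pose proof (HD u Hu) as H2.
  set (K := Cmod h ^ 2 * (/ m) ^ 2) in *.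
  replace (2 * Cmod h ^ 2 * (/ m) ^ 2) with (2 * K) by (unfold K; ring).
  pose proof (Cmod_sq e) as He; rewrite E1, E2 in He.
  pose proof (Cmod_sq (D t - D 0)) as H3; pose proof (Cmod_sq (D u - D 0)) as H4.
  pose proof (Cmod_ge_0 (D t - D 0)); pose proof (Cmod_ge_0 (D u - D 0)).
  pose proof (Cmod_ge_0 e).
  pose proof (pow2_ge_0 (Im (D t - D 0))); pose proof (pow2_ge_0 (Re (D u - D 0))).
  assert (Cmod (D t - D 0) * Cmod (D t - D 0) <= K * K) by (apply Rmult_le_compat; lra).
  assert (Cmod (D u - D 0) * Cmod (D u - D 0) <= K * K) by (apply Rmult_le_compat; lra).
  nra.
Qed.

Lemma holo_log (r m : R) (F : C -> C) :
  r <= 1 -> 0 < m -> (forall z, Cmod z <= r -> m <= Re (F z)) ->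
  holo r F -> holo r (fun z => Clog (F z)).
Proof.
  intros Hr Hm Hlow (F' & M & HF).
  set (m' := Rmin m 1).
  assert (Hm' : 0 < m') by (apply Rmin_glb_lt; lra).
  assert (Hm1 : m' <= 1) by apply Rmin_r.
  set (i := / m').
  assert (Hi : 0 < i) by now apply Rinv_0_lt_compat.
  assert (Hlow' : forall z, Cmod z <= r -> m' <= Re (F z)).
  { intros z Hz; eapply Rle_trans; [apply Rmin_l | auto]. }
  exists (fun z => F' z * / F z)%C,
    ((M + 1) * i + 2 * (M + 1) ^ 2 * i ^ 2 + M * i + 18 * M ^ 2 * i ^ 2).
  intros z w Hz Hw.
  destruct (HF z w Hz Hw) as (F1 & F2 & F3).
  assert (HM : 0 <= M) by (eapply Rle_trans; [apply Cmod_ge_0 | exact F1]).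
  assert (Hn : F z <> 0).
  { intros H; specialize (Hlow' z Hz); rewrite H in Hlow'; simpl in Hlow'; lra. }
  assert (I1 : Cmod (/ F z) <= i).
  { rewrite Cmod_inv by exact Hn; apply Rinv_le_contravar; [exact Hm'|].
    eapply Rle_trans; [apply Hlow', Hz | apply Re_le_Cmod]. }
  pose proof (pow2_ge_0 i); pose proof (pow2_ge_0 M).
  assert (Hi1 : 1 <= i).
  { unfold i; rewrite <- Rinv_1; apply Rinv_le_contravar; lra. }
  assert (0 <= (M + 1) * i) by (apply Rmult_le_pos; lra).
  assert (0 <= 2 * (M + 1) ^ 2 * i ^ 2)
    by (apply Rmult_le_pos; [pose proof (pow2_ge_0 (M + 1)); lra | lra]).
  assert (0 <= M * i) by (apply Rmult_le_pos; lra).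
  assert (0 <= 18 * M ^ 2 * i ^ 2) by (apply Rmult_le_pos; lra).
  split; [|split].
  - pose proof (Clog_quadratic 1 (F z) m' Hm' ltac:(simpl; lra) (Hlow' z Hz)) as HQ.
    rewrite Clog_1 in HQ.
    assert (Hd : Cmod (F z - 1) <= M + 1).
    { unfold Cminus; eapply Rle_trans; [apply Cmod_triangle|].
      rewrite Cmod_opp, Cmod_1; lra. }
    replace (Clog (F z)) with ((Clog (F z) - 0 - (F z - 1) / 1) + (F z - 1))%C
      by (field; intros E; apply RtoC_inj in E; lra).
    eapply Rle_trans; [apply Cmod_triangle|].
    assert (Cmod (F z - 1) ^ 2 <= (M + 1) ^ 2)
      by (apply pow_incr; split; [apply Cmod_ge_0 | exact Hd]).
    fold i in HQ.
    assert (2 * Cmod (F z - 1) ^ 2 * i ^ 2 <= 2 * (M + 1) ^ 2 * i ^ 2)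
      by (apply Rmult_le_compat_r; lra).
    assert (Cmod (F z - 1) <= (M + 1) * i) by nra.
    lra.
  - apply Rle_trans with (M * i); [now apply Cmod_mult_le | lra].
  - set (d := Cmod (w - z)) in *.
    pose proof (holo_lipschitz F F' M z w F2 F3 ltac:(lra) ltac:(lra)) as FL.
    fold d in FL.
    assert (Hd : 0 <= d) by apply Cmod_ge_0.
    pose proof (Clog_quadratic (F z) (F w) m' Hm' (Hlow' z Hz) (Hlow' w Hw)) as HQ.
    fold i in HQ.
    replace (Clog (F w) - Clog (F z) - F' z * / F z * (w - z))%C
      with ((Clog (F w) - Clog (F z) - (F w - F z) / F z) +
            (F w - F z - F' z * (w - z)) * / F z)%C by (field; exact Hn).
    eapply Rle_trans;
      [apply Cmod_plus_le; [exact HQ | apply Cmod_mult_le; [exact F3 | exact I1]]|].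
    assert (Cmod (F w - F z) ^ 2 <= (3 * M * d) ^ 2)
      by (apply pow_incr; split; [apply Cmod_ge_0 | exact FL]).
    assert (2 * Cmod (F w - F z) ^ 2 * i ^ 2 <= 2 * (3 * M * d) ^ 2 * i ^ 2)
      by (apply Rmult_le_compat_r; lra).
    pose proof (pow2_ge_0 d).
    assert (0 <= ((M + 1) * i + 2 * (M + 1) ^ 2 * i ^ 2) * d ^ 2)
      by (apply Rmult_le_pos; lra).
    lra.
Qed.

(** * The cusp map *)

Definition to_half_plane (z : C) : C := ((z - Ci) / (Ci * z - 1))%C.

Definition to_quadrant (z : C) : C := Csqrt (to_half_plane z).

Lemma Cmod_Ci_mult (z : C) : Cmod (Ci * z) = Cmod z.
Proof. rewrite Cmod_mult, Cmod_Ci; ring. Qed.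

Lemma to_half_plane_denom (z : C) : 1 - Cmod z <= Cmod (Ci * z - 1).
Proof.
  pose proof (Cmod_triangle (Ci * z - 1) (- (Ci * z))) as H.
  replace (Ci * z - 1 + - (Ci * z))%C with (- RtoC 1)%C in H by ring.
  rewrite !Cmod_opp, Cmod_1, Cmod_Ci_mult in H; lra.
Qed.

Lemma to_half_plane_Im (z : C) : in_disk z ->
  Im (to_half_plane z) * Cmod (Ci * z - 1) ^ 2 = 1 - Cmod z ^ 2.
Proof.
  intros Hz.
  assert (Hn : 0 < Cmod (Ci * z - 1))
    by (pose proof (to_half_plane_denom z); unfold in_disk in Hz; lra).
  assert (Hn2 : 0 < Cmod (Ci * z - 1) ^ 2) by (apply pow_lt; exact Hn).
  rewrite !Cmod2_alt in *; destruct z as [x y].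
  unfold to_half_plane, Re, Im, Ci, Cdiv, Cinv, Cmult, Cminus, Cplus, Copp, RtoC in *.
  simpl in *; field; lra.
Qed.

(** On a closed subdisk the values stay in a compact part of the quadrant. *)
Lemma to_quadrant_compact (r : R) : 0 < r < 1 -> exists m M, 0 < m /\
  forall z, Cmod z <= r ->
    (to_quadrant z * to_quadrant z = to_half_plane z)%C /\
    m <= Re (to_quadrant z) /\ m <= Im (to_quadrant z) /\ Cmod (to_quadrant z) <= M.
Proof.
  intros Hr.
  set (M := 1 + 2 / (1 - r)); set (m := (1 - r ^ 2) / (8 * M)).
  assert (H1r : 0 < / (1 - r)) by (apply Rinv_0_lt_compat; lra).
  assert (HM : 1 < M) by (unfold M, Rdiv; lra).
  assert (Hm : 0 < m) by (apply Rdiv_lt_0_compat; nra).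
  exists m, M; split; [exact Hm|]; intros z Hz.
  assert (Hzd : in_disk z) by (unfold in_disk; lra).
  pose proof (to_half_plane_denom z) as Hden.
  pose proof (to_half_plane_Im z Hzd) as HIm.
  assert (Hd2 : Cmod (Ci * z - 1) <= 2).
  { unfold Cminus; eapply Rle_trans; [apply Cmod_triangle|].
    rewrite Cmod_opp, Cmod_1, Cmod_Ci_mult; lra. }
  assert (HI : (1 - r ^ 2) / 4 <= Im (to_half_plane z)).
  { pose proof (Cmod_ge_0 z).
    assert (0 < Cmod (Ci * z - 1) ^ 2 <= 4).
    { split; [apply pow_lt; lra|].
      replace 4 with (2 ^ 2) by ring; apply pow_incr; lra. }
    assert (Hsq : Cmod z ^ 2 <= r ^ 2) by (apply pow_incr; lra).
    assert (0 < 1 - r ^ 2) by nra.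
    nra. }
  assert (HQ : Cmod (to_half_plane z) <= 2 / (1 - r)).
  { unfold to_half_plane; rewrite Cmod_div by (apply Cmod_gt_0; lra).
    apply Rmult_le_compat; [apply Cmod_ge_0 | | |].
    - left; apply Rinv_0_lt_compat; lra.
    - unfold Cminus; eapply Rle_trans; [apply Cmod_triangle|].
      rewrite Cmod_opp, Cmod_Ci; lra.
    - apply Rinv_le_contravar; lra. }
  assert (Hn : to_half_plane z <> 0).
  { intros H; rewrite H in HI; simpl in HI; nra. }
  destruct (Csqrt_sq _ Hn) as [Hs Hre]; fold (to_quadrant z) in *.
  set (s := to_quadrant z) in *.
  assert (HsM : Cmod s <= M).
  { assert (Cmod s * Cmod s <= M)
      by (rewrite <- Cmod_mult, Hs; unfold M; lra).
    pose proof (Cmod_ge_0 s); nra. }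
  assert (Him2 : 2 * (Re s * Im s) = Im (to_half_plane z)).
  { rewrite <- Hs; destruct s as [a b]; unfold Re, Im; simpl; ring. }
  pose proof (Re_le_Cmod s); pose proof (Im_le_Cmod s).
  assert (H8 : m * (8 * M) = 1 - r ^ 2) by (unfold m; field; lra).
  assert (0 < 1 - r ^ 2) by nra.
  assert (Hre0 : 0 < Re s) by nra.
  assert (Him0 : 0 < Im s) by nra.
  split; [exact Hs|]; split; [|split; [|exact HsM]].
  - apply Rmult_le_reg_r with M; [lra|].
    assert (Re s * Im s <= Re s * M) by (apply Rmult_le_compat_l; lra); lra.
  - apply Rmult_le_reg_r with M; [lra|].
    assert (Im s * Re s <= Im s * M) by (apply Rmult_le_compat_l; lra); lra.
Qed.

(** The quadrant is sent into the right half of the unit disk. *)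
Lemma half_disk_map (s : C) : 0 <= Re s -> 0 <= Im s ->
  1 <= Cmod (- Ci * s + 1) /\ Cmod (- Ci * s + 1) <= 1 + Cmod s /\
  Re ((s - Ci) / (- Ci * s + 1)) * Cmod (- Ci * s + 1) ^ 2 = 2 * Re s /\
  (1 - Cmod ((s - Ci) / (- Ci * s + 1)) ^ 2) * Cmod (- Ci * s + 1) ^ 2 = 4 * Im s.
Proof.
  intros Hr Hi.
  assert (H1 : 1 <= Cmod (- Ci * s + 1)).
  { eapply Rle_trans; [|apply Re_le_Cmod].
    destruct s as [a b]; unfold Re, Im in *; simpl in *; lra. }
  assert (H2 : Cmod (- Ci * s + 1) <= 1 + Cmod s).
  { eapply Rle_trans; [apply Cmod_triangle|].
    rewrite Cmod_mult, Cmod_opp, Cmod_Ci, Cmod_1; lra. }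
  split; [exact H1|split; [exact H2|]].
  assert (Hn2 : 0 < Cmod (- Ci * s + 1) ^ 2) by (apply pow_lt; lra).
  rewrite !Cmod2_alt in *; destruct s as [x y].
  unfold Re, Im, Ci, Cdiv, Cinv, Cmult, Cminus, Cplus, Copp, RtoC in *.
  simpl in *; split; field; lra.
Qed.

Lemma cusp0_compact (r : R) : 0 < r < 1 -> exists m, 0 < m /\
  forall z, Cmod z <= r -> m <= Re (cusp0 z).
Proof.
  intros Hr; destruct (to_quadrant_compact r Hr) as (m & M & Hm & H).
  assert (HM : 0 <= M).
  { destruct (H 0) as (_ & _ & _ & H0); [rewrite Cmod_0; lra|].
    eapply Rle_trans; [apply Cmod_ge_0 | exact H0]. }
  exists (2 * m / (1 + M) ^ 2); split; [apply Rdiv_lt_0_compat; nra|].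
  intros z Hz; destruct (H z Hz) as (_ & H1 & H2 & H3).
  destruct (half_disk_map (to_quadrant z)) as (D1 & D2 & D3 & _); [lra | lra |].
  change ((to_quadrant z - Ci) / (- Ci * to_quadrant z + 1))%C with (cusp0 z) in D3.
  set (D := Cmod (- Ci * to_quadrant z + 1)) in *.
  assert (HD : 0 < D ^ 2 <= (1 + M) ^ 2)
    by (split; [apply pow_lt; lra | apply pow_incr; lra]).
  apply Rmult_le_reg_r with ((1 + M) ^ 2); [lra|].
  replace (2 * m / (1 + M) ^ 2 * (1 + M) ^ 2) with (2 * m) by (field; lra).
  assert (0 < Re (cusp0 z)) by nra.
  nra.
Qed.

Lemma cusp0_half_disk (z : C) : in_disk z -> 0 < Re (cusp0 z) /\ Cmod (cusp0 z) < 1.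
Proof.
  intros Hz; unfold in_disk in Hz; pose proof (Cmod_ge_0 z).
  destruct (to_quadrant_compact ((1 + Cmod z) / 2)) as (m & M & Hm & H0); [lra|].
  destruct (H0 z) as (_ & H1 & H2 & _); [lra|].
  destruct (half_disk_map (to_quadrant z)) as (D1 & D2 & D3 & D4); [lra | lra |].
  change ((to_quadrant z - Ci) / (- Ci * to_quadrant z + 1))%C with (cusp0 z) in D3, D4.
  set (D := Cmod (- Ci * to_quadrant z + 1)) in *.
  assert (0 < D ^ 2) by (apply pow_lt; lra).
  split; [nra|].
  assert (Cmod (cusp0 z) ^ 2 < 1) by nra.
  pose proof (Cmod_ge_0 (cusp0 z)); nra.
Qed.

Lemma cusp2_coords (z : C) :
  cusp2 z = (1 - 2 / PI * ln (Cmod (cusp0 z)), - (2 / PI * Carg (cusp0 z))).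
Proof.
  unfold cusp2, cusp1, Clog, Copp, Cmult, Cplus, RtoC; simpl; f_equal; ring.
Qed.

Lemma cusp2_half_strip (z : C) : in_disk z ->
  1 < Re (cusp2 z) /\ - 1 < Im (cusp2 z) < 1.
Proof.
  intros Hz; destruct (cusp0_half_disk z Hz) as [Hre Hmod].
  assert (Hp : 0 < Cmod (cusp0 z)) by (pose proof (Re_le_Cmod (cusp0 z)); lra).
  assert (Hln : ln (Cmod (cusp0 z)) < 0) by (rewrite <- ln_1; apply ln_increasing; lra).
  pose proof (Carg_bound _ Hre) as Hc.
  assert (HPI := PI_RGT_0).
  assert (H2 : 0 < 2 / PI) by (apply Rdiv_lt_0_compat; lra).
  assert (E : 2 / PI * (PI / 2) = 1) by (field; lra).
  rewrite cusp2_coords; unfold Re, Im; simpl; repeat split; nra.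
Qed.

(** The half-strip of [cusp2] lies well inside the half-plane [Re > 1 / 2], which
    [w = 1 - 1 / q] maps onto the disk. *)
Lemma half_strip_to_disk (x y : R) : 1 < x -> -1 < y < 1 ->
  Cmod (1 - 1 / (x, y)) ^ 2 = 1 - (2 * x - 1) / (x ^ 2 + y ^ 2).
Proof.
  intros Hx Hy; assert (0 < x ^ 2 + y ^ 2) by nra.
  rewrite Cmod2_alt.
  unfold Re, Im, Cdiv, Cinv, Cmult, Cminus, Cplus, Copp, RtoC; simpl; field; nra.
Qed.

(** The strip has bounded width, so the image of the cusp map approaches the unit
    circle only at [1] and nontangentially, where [1 - |w|^2] is comparable to
    the inverse of the real part of [cusp2]. *)
Lemma cusp_in_disk (z : C) : in_disk z ->
  in_disk (cusp z) /\ / (1 - Cmod (cusp z) ^ 2) <= 2 * Re (cusp2 z).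
Proof.
  intros Hz; destruct (cusp2_half_strip z Hz) as [Hx Hy].
  unfold cusp, cusp3; destruct (cusp2 z) as [x y]; unfold Re, Im in *; simpl in Hx, Hy.
  simpl fst; rewrite half_strip_to_disk by assumption.
  assert (Hs : 0 < x ^ 2 + y ^ 2) by nra.
  assert (Hq : 0 < (2 * x - 1) / (x ^ 2 + y ^ 2)) by (apply Rdiv_lt_0_compat; nra).
  split.
  - unfold in_disk; pose proof (half_strip_to_disk x y Hx Hy) as E.
    pose proof (Cmod_ge_0 (1 - 1 / (x, y))); nra.
  - replace (1 - (1 - (2 * x - 1) / (x ^ 2 + y ^ 2)))
      with ((2 * x - 1) / (x ^ 2 + y ^ 2)) by ring.
    apply Rmult_le_reg_r with ((2 * x - 1) / (x ^ 2 + y ^ 2)); [exact Hq|].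
    rewrite Rinv_l by lra.
    apply Rmult_le_reg_r with (x ^ 2 + y ^ 2); [exact Hs|].
    replace (2 * x * ((2 * x - 1) / (x ^ 2 + y ^ 2)) * (x ^ 2 + y ^ 2))
      with (2 * x * (2 * x - 1)) by (field; lra).
    nra.
Qed.

Section Holomorphy.

Variable r : R.
Hypothesis Hr : 0 < r < 1.

Let Hr1 : r <= 1. Proof. lra. Qed.

Lemma holo_to_half_plane : holo r to_half_plane.
Proof.
  unfold to_half_plane, Cdiv.
  apply holo_mult; [exact Hr1 | |].
  - apply holo_minus; [exact Hr1 | now apply holo_id | apply holo_const].
  - apply (holo_inv r (1 - r)); [exact Hr1 | lra | |].
    + intros z Hz; eapply Rle_trans; [|apply to_half_plane_denom]; lra.
    + apply holo_minus; [exact Hr1 | | apply holo_const].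
      apply holo_mult; [exact Hr1 | apply holo_const | now apply holo_id].
Qed.

Lemma holo_to_quadrant : holo r to_quadrant.
Proof.
  destruct (to_quadrant_compact r Hr) as (m & M & Hm & H).
  apply (holo_sqrt r m to_half_plane); [exact Hr1 | exact Hm | | exact holo_to_half_plane].
  intros z Hz; destruct (H z Hz) as (H1 & H2 & _); auto.
Qed.

Lemma holo_cusp0 : holo r cusp0.
Proof.
  destruct (to_quadrant_compact r Hr) as (m & M & Hm & H).
  change (holo r (fun z => (to_quadrant z - Ci) * / (- Ci * to_quadrant z + 1))%C).
  apply holo_mult; [exact Hr1 | |].
  - apply holo_minus; [exact Hr1 | exact holo_to_quadrant | apply holo_const].
  - apply (holo_inv r 1); [exact Hr1 | lra | |].
    + intros z Hz; destruct (H z Hz) as (_ & H1 & H2 & _).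
      apply half_disk_map; lra.
    + apply holo_plus; [|apply holo_const].
      apply holo_mult; [exact Hr1 | apply holo_const | exact holo_to_quadrant].
Qed.

Lemma holo_cusp2 : holo r cusp2.
Proof.
  destruct (cusp0_compact r Hr) as (m & Hm & H).
  unfold cusp2; apply holo_plus; [|apply holo_const].
  apply holo_mult; [exact Hr1 | apply holo_const |].
  apply (holo_log r m); [exact Hr1 | exact Hm | exact H | exact holo_cusp0].
Qed.

Lemma holo_cusp : holo r cusp.
Proof.
  unfold cusp, cusp3, Cdiv; apply holo_minus; [exact Hr1 | apply holo_const |].
  apply holo_mult; [exact Hr1 | apply holo_const |].
  apply (holo_inv r 1); [exact Hr1 | lra | | exact holo_cusp2].
  intros z Hz; destruct (cusp2_half_strip z) as [H _]; [unfold in_disk; lra|].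
  pose proof (Re_le_Cmod (cusp2 z)); lra.
Qed.

Lemma cusp_compact : exists q, 0 < q < 1 /\ forall z, Cmod z <= r -> Cmod (cusp z) <= q.
Proof.
  destruct holo_cusp2 as (F' & M & H).
  assert (HM : 1 < M).
  { destruct (H 0 0) as (H0 & _); try (rewrite Cmod_0; lra).
    destruct (cusp2_half_strip 0) as [H1 _]; [unfold in_disk; rewrite Cmod_0; lra|].
    pose proof (Re_le_Cmod (cusp2 0)); lra. }
  assert (Hi : 0 < / M < 1).
  { split; [apply Rinv_0_lt_compat; lra|].
    rewrite <- Rinv_1; apply Rinv_lt_contravar; lra. }
  exists (sqrt (1 - (/ M) ^ 2)).
  assert (Hp : 0 < 1 - (/ M) ^ 2 < 1) by nra.
  split.
  - split; [apply sqrt_lt_R0; lra|].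
    rewrite <- sqrt_1 at 2; apply sqrt_lt_1; lra.
  - intros z Hz; destruct (cusp2_half_strip z) as [Hx Hy]; [unfold in_disk; lra|].
    destruct (H z z Hz Hz) as (HzM & _).
    unfold cusp, cusp3; pose proof (Cmod_sq (cusp2 z)) as Hsq.
    destruct (cusp2 z) as [x y]; unfold Re, Im in *; simpl in Hx, Hy.
    simpl fst in Hsq; simpl snd in Hsq.
    apply Rsqr_incr_0_var; [|apply sqrt_pos].
    rewrite Rsqr_sqrt by lra.
    replace (Rsqr (Cmod (1 - 1 / (x, y)))) with (Cmod (1 - 1 / (x, y)) ^ 2)
      by (unfold Rsqr; ring).
    rewrite half_strip_to_disk by assumption.
    assert (0 < x ^ 2 + y ^ 2 <= M ^ 2).
    { pose proof (Cmod_ge_0 (x, y)); nra. }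
    assert ((/ M) ^ 2 <= (2 * x - 1) / (x ^ 2 + y ^ 2)); [|lra].
    apply Rmult_le_reg_r with (x ^ 2 + y ^ 2); [lra|].
    replace ((2 * x - 1) / (x ^ 2 + y ^ 2) * (x ^ 2 + y ^ 2)) with (2 * x - 1)
      by (field; lra).
    apply Rle_trans with ((/ M) ^ 2 * M ^ 2).
    + apply Rmult_le_compat_l; [apply pow2_ge_0 | lra].
    + rewrite <- Rpow_mult_distr, Rinv_l by lra; lra.
Qed.

End Holomorphy.

Lemma taylor_comp_cusp (f : C -> C) (a : nat -> C) :
  taylor f a -> exists b, taylor (fun z => f (cusp z)) b.
Proof.
  intros Hf; apply holo_taylor; intros r Hr.
  destruct (cusp_compact r Hr) as (q & Hq & Hc).
  apply (holo_comp r q); [lra | lra | exact Hc | | now apply holo_cusp].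
  now apply (taylor_holo f a).
Qed.

Lemma exp_mono (x y : R) : x <= y -> exp x <= exp y.
Proof. intros [H | ->]; [left; now apply exp_increasing | lra]. Qed.

Lemma exp_ge_1 (x : R) : 0 <= x -> 1 <= exp x.
Proof. rewrite <- exp_0; apply exp_mono. Qed.

(** With [x = Re (cusp2 z)], its real part is at least [exp (3 / 4 * (x - 1)) / 2],
    while its value at [0] is a constant: as a harmonic majorant it absorbs any
    slower growth in the cusp. *)
Definition cusp_majorant (z : C) : C := (/ Csqrt (cusp0 z))%C.

Lemma sqrt_half_plane (w : C) : 0 < Re w ->
  (Csqrt w * Csqrt w = w)%C /\ 0 < Re (Csqrt w) /\
  Cmod (Csqrt w) ^ 2 = Cmod w /\ Cmod w <= 2 * Re (Csqrt w) ^ 2.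
Proof.
  intros Hw.
  assert (Hn : w <> 0) by (intros H; rewrite H in Hw; simpl in Hw; lra).
  destruct (Csqrt_sq w Hn) as [Hs Hre]; set (s := Csqrt w) in *.
  assert (Hm : Cmod s ^ 2 = Cmod w) by (rewrite <- Hs, Cmod_mult; ring).
  assert (Hd : Re s ^ 2 - Im s ^ 2 = Re w).
  { rewrite <- Hs; destruct s as [a b]; unfold Re, Im; simpl; ring. }
  pose proof (Cmod2_alt s) as Hc; rewrite Hm in Hc.
  pose proof (pow2_ge_0 (Im s)).
  split; [exact Hs|]; split; [|split; [exact Hm|]]; nra.
Qed.

Lemma taylor_cusp_majorant : exists b, taylor cusp_majorant b.
Proof.
  apply holo_taylor; intros r Hr.
  destruct (cusp0_compact r Hr) as (m & Hm & H).
  assert (Hlow : forall z, Cmod z <= r ->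
    (Csqrt (cusp0 z) * Csqrt (cusp0 z) = cusp0 z)%C /\
    sqrt (m / 2) <= Re (Csqrt (cusp0 z))).
  { intros z Hz; specialize (H z Hz).
    destruct (sqrt_half_plane (cusp0 z)) as (H1 & H2 & _ & H4); [lra|].
    split; [exact H1|].
    rewrite <- (sqrt_pow2 (Re (Csqrt (cusp0 z)))) by lra.
    apply sqrt_le_1_alt; pose proof (Re_le_Cmod (cusp0 z)); lra. }
  assert (Hs : 0 < sqrt (m / 2)) by (apply sqrt_lt_R0; lra).
  apply (holo_inv r (sqrt (m / 2))); [lra | exact Hs | |].
  - intros z Hz; destruct (Hlow z Hz) as [_ H1].
    eapply Rle_trans; [exact H1 | apply Re_le_Cmod].
  - apply (holo_sqrt r (sqrt (m / 2)) cusp0); auto; [lra | now apply holo_cusp0].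
Qed.

(** [cusp0] has modulus [exp (- PI / 2 * (x - 1))] where [x] is the real part
    of [cusp2], so its inverse square root grows exponentially in [x], and its
    argument is at most [PI / 4]. *)
Lemma cusp_majorant_lower (z : C) : in_disk z ->
  exp (3 / 4 * (Re (cusp2 z) - 1)) <= 2 * Re (cusp_majorant z).
Proof.
  intros Hz; destruct (cusp0_half_disk z Hz) as [Hre Hmod].
  destruct (sqrt_half_plane _ Hre) as (H1 & H2 & H3 & H4).
  set (s := Csqrt (cusp0 z)) in *; set (c := Cmod (cusp0 z)) in *.
  assert (Hc : 0 < c) by (pose proof (Re_le_Cmod (cusp0 z)); unfold c; lra).
  assert (Hm : Re (cusp_majorant z) = Re s / c).
  { unfold cusp_majorant; fold s; rewrite <- H3, Cmod2_alt.
    destruct s as [a b]; unfold Re, Im, Cinv; simpl; field; simpl in H2; nra. }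
  rewrite Hm.
  assert (Hx : c = exp (- (PI / 2 * (Re (cusp2 z) - 1)))).
  { rewrite cusp2_coords; unfold Re; simpl fst; fold c.
    replace (- (PI / 2 * (1 - 2 / PI * ln c - 1))) with (ln c)
      by (field; apply PI_neq0).
    now rewrite exp_ln. }
  destruct (cusp2_half_strip z Hz) as [Hx1 _].
  set (t := Re (cusp2 z) - 1) in *.
  assert (Ht : 0 < t) by (unfold t; lra).
  assert (He : exp (3 / 4 * t) ^ 2 <= / c).
  { rewrite Hx, <- exp_Ropp, <- Rsqr_pow2; unfold Rsqr; rewrite <- exp_plus.
    apply exp_mono; pose proof PI2_3_2; nra. }
  assert (Hr : / c <= (2 * (Re s / c)) ^ 2).
  { apply Rmult_le_reg_r with (c ^ 2); [apply pow_lt, Hc|].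
    replace (/ c * c ^ 2) with c by (field; lra).
    replace ((2 * (Re s / c)) ^ 2 * c ^ 2) with (4 * Re s ^ 2) by (field; lra).
    pose proof (pow2_ge_0 (Re s)); lra. }
  apply Rsqr_incr_0_var.
  - unfold Rsqr; lra.
  - apply Rmult_le_pos; [lra|]; apply Rdiv_le_0_compat; lra.
Qed.

(** * The Hardy space *)

(** Membership in the Hardy space with squared norm at most [K], phrased with
    partial sums so that no convergence question arises. *)
Definition h2_le (f : C -> C) (K : R) : Prop :=
  exists a, taylor f a /\ forall N, rsum (fun n => Cmod (a n) ^ 2) N <= K.

Lemma h2_le_ext (f g : C -> C) (K : R) :
  h2_le f K -> (forall z, in_disk z -> f z = g z) -> h2_le g K.
Proof. intros (a & Ha & HK) E; exists a; split; [now apply (taylor_ext f) | exact HK]. Qed.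

Lemma h2_le_weaken (f : C -> C) (K L : R) : h2_le f K -> K <= L -> h2_le f L.
Proof. intros (a & Ha & HK) H; exists a; split; [exact Ha|]; intros N; specialize (HK N); lra. Qed.

Lemma h2_le_nonneg (f : C -> C) (K : R) : h2_le f K -> 0 <= K.
Proof. intros (a & _ & HK); apply (HK O). Qed.

Lemma sum_n_rsum (u : nat -> R) (n : nat) : sum_n u n = rsum u (S n).
Proof.
  induction n as [|n IH]; [rewrite sum_O; simpl; ring|].
  rewrite sum_Sn, IH; reflexivity.
Qed.

Lemma series_of_bounded (u : nat -> R) (K : R) :
  (forall n, 0 <= u n) -> (forall N, rsum u N <= K) ->
  ex_series u /\ Series u <= K.
Proof.
  intros Hu HK.
  destruct (ex_finite_lim_seq_incr (sum_n u) K) as [l Hl].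
  - intros n; rewrite !sum_n_rsum, (rsum_S u (S n)); specialize (Hu (S n)); lra.
  - intros n; rewrite sum_n_rsum; apply HK.
  - split; [exists l; exact Hl|].
    rewrite (is_series_unique u l Hl).
    apply (is_lim_seq_le (sum_n u) (fun _ => K) l K); [|exact Hl | apply is_lim_seq_const].
    intros n; rewrite sum_n_rsum; apply HK.
Qed.

Lemma rsum_le_series (u : nat -> R) (N : nat) :
  (forall n, 0 <= u n) -> ex_series u -> rsum u N <= Series u.
Proof.
  intros Hu [l Hl]; rewrite (is_series_unique u l Hl).
  apply (is_lim_seq_le_loc (fun _ => rsum u N) (sum_n u) (rsum u N) l).
  - exists N; intros n Hn; rewrite sum_n_rsum; apply rsum_mono; [exact Hu | lia].
  - apply is_lim_seq_const.
  - exact Hl.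
Qed.

Lemma h2_le_in_H2 (f : C -> C) (K : R) : h2_le f K -> in_H2 f.
Proof.
  intros (a & Ha & HK); exists a; split; [exact Ha|].
  apply (series_of_bounded _ K); [intros; apply pow2_ge_0 | exact HK].
Qed.

Lemma H2_norm_le (f : C -> C) (K : R) : h2_le f K -> Rbar_le (H2_norm f) (sqrt K).
Proof.
  intros (a & Ha & HK).
  destruct (series_of_bounded (fun n => Cmod (a n) ^ 2) K) as [Hex HS];
    [intros; apply pow2_ge_0 | exact HK |].
  apply Rbar_le_trans with (sqrt (Series (fun n => Cmod (a n) ^ 2))).
  - apply (proj1 (Glb_Rbar_correct _)); exists a; auto.
  - apply sqrt_le_1_alt; exact HS.
Qed.

(** The hypothesis quantifies over all admissible [K], so it is met vacuously
    when [f] is not in the Hardy space and the norm is infinite. *)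
Lemma H2_norm_ge (f : C -> C) (x : R) :
  (forall K, h2_le f K -> x <= sqrt K) -> Rbar_le x (H2_norm f).
Proof.
  intros H; apply (proj2 (Glb_Rbar_correct _)).
  intros N (a & Ha & Hs & ->); apply H; exists a; split; [exact Ha|].
  intros N; apply (rsum_le_series (fun n => Cmod (a n) ^ 2));
    [intros; apply pow2_ge_0 | exact Hs].
Qed.

(** Taylor coefficients are unique, so the infimum defining the norm is attained. *)
Lemma h2_le_of_norm (f : C -> C) (M : R) :
  in_H2 f -> Rbar_le (H2_norm f) M -> h2_le f (M ^ 2).
Proof.
  intros (a & Ha & Hs) HM.
  exists a; split; [exact Ha|]; intros N.
  apply Rle_trans with (Series (fun n => Cmod (a n) ^ 2)).
  { apply (rsum_le_series (fun n => Cmod (a n) ^ 2)); [intros; apply pow2_ge_0 | exact Hs]. }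
  assert (HS : 0 <= Series (fun n => Cmod (a n) ^ 2)).
  { apply (rsum_le_series (fun n => Cmod (a n) ^ 2) 0); [intros; apply pow2_ge_0 | exact Hs]. }
  assert (H : Rbar_le (sqrt (Series (fun n => Cmod (a n) ^ 2))) M).
  { eapply Rbar_le_trans; [|exact HM].
    apply (proj2 (Glb_Rbar_correct _)).
    intros K (b & Hb & _ & ->); right; f_equal; apply Series_ext; intros n.
    rewrite (taylor_unique f f a b Ha Hb); auto. }
  change (sqrt (Series (fun n => Cmod (a n) ^ 2)) <= M) in H.
  pose proof (sqrt_pos (Series (fun n => Cmod (a n) ^ 2))).
  pose proof (sqrt_sqrt _ HS); nra.
Qed.

Lemma h2_le_of_in_H2 (f : C -> C) : in_H2 f -> exists K, h2_le f K.
Proof.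
  intros (a & Ha & Hs); eexists; exists a; split; [exact Ha|]; intros N.
  apply (rsum_le_series (fun n => Cmod (a n) ^ 2)); [intros; apply pow2_ge_0 | exact Hs].
Qed.

Lemma h2_le_zero : h2_le (fun _ => RtoC 0) 0.
Proof.
  exists (fun _ => RtoC 0); split; [exact taylor_zero|].
  intros N; rewrite (rsum_ext _ (fun _ => 0)), rsum_const; [lra|].
  intros; rewrite Cmod_0; ring.
Qed.

Lemma h2_le_scal (c : C) (f : C -> C) (K : R) :
  h2_le f K -> h2_le (fun z => c * f z)%C (Cmod c ^ 2 * K).
Proof.
  intros (a & Ha & HK); exists (fun n => c * a n)%C; split; [now apply taylor_scal|].
  intros N; rewrite (rsum_ext _ (fun n => Cmod c ^ 2 * Cmod (a n) ^ 2)), rsum_scal.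
  - apply Rmult_le_compat_l; [apply pow2_ge_0 | apply HK].
  - intros n _; rewrite Cmod_mult; ring.
Qed.

(** By Cauchy-Schwarz in the [n] summands, coefficient by coefficient. *)
Lemma h2_le_csum (f : nat -> C -> C) (K : R) (n : nat) :
  (forall i, (i < n)%nat -> h2_le (f i) K) ->
  h2_le (fun z => csum (fun i => f i z) n) (INR n ^ 2 * K).
Proof.
  intros H.
  assert (Hc : exists a : nat -> nat -> C, forall i, (i < n)%nat ->
    taylor (f i) (a i) /\ forall N, rsum (fun m => Cmod (a i m) ^ 2) N <= K).
  { assert (Hi : forall i, exists b, (i < n)%nat ->
      taylor (f i) b /\ forall N, rsum (fun m => Cmod (b m) ^ 2) N <= K).
    { intros i; destruct (Compare_dec.lt_dec i n) as [Hi|Hi].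
      - destruct (H i Hi) as (b & Hb); exists b; auto.
      - exists (fun _ => RtoC 0); intros; contradiction. }
    exists (fun i => proj1_sig (constructive_indefinite_description _ (Hi i))).
    intros i; exact (proj2_sig (constructive_indefinite_description _ (Hi i))). }
  destruct Hc as [a Ha].
  exists (fun m => csum (fun i => a i m) n); split.
  - clear H; induction n as [|n IH].
    + exact taylor_zero.
    + simpl; apply (taylor_ext (fun z => 1 * csum (fun i => f i z) n + f n z)%C);
        [|intros; ring].
      replace (fun m => csum (fun i => a i m) n + a n m)%C
        with (fun m => 1 * csum (fun i => a i m) n + a n m)%C
        by (apply functional_extensionality; intros; ring).
      apply taylor_lincomb; [|apply Ha; lia].
      apply IH; intros i Hi; apply Ha; lia.
  - intros N.
    apply Rle_trans with (rsum (fun m => INR n * rsum (fun i => Cmod (a i m) ^ 2) n) N).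
    { apply rsum_le; intros m _.
      eapply Rle_trans.
      - apply pow_incr; split; [apply Cmod_ge_0 | apply Cmod_csum].
      - rewrite (rsum_ext (fun i => Cmod (a i m)) (fun i => 1 * Cmod (a i m)))
          by (intros; ring).
        eapply Rle_trans;
          [apply (rsum_cauchy_schwarz (fun _ => 1) (fun i => Cmod (a i m)))|].
        rewrite rsum_const, pow1; lra. }
    rewrite rsum_scal, rsum_swap.
    replace (INR n ^ 2 * K) with (INR n * (INR n * K)) by ring.
    apply Rmult_le_compat_l; [apply pos_INR|].
    rewrite <- rsum_const; apply rsum_le; intros i Hi; now apply Ha.
Qed.

(** Boundedness of point evaluation, by Cauchy-Schwarz. *)
Lemma h2_eval (f : C -> C) (K : R) (z : C) :
  h2_le f K -> in_disk z -> Cmod (f z) ^ 2 * (1 - Cmod z ^ 2) <= K.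
Proof.
  intros (a & Ha & HK) Hz; unfold in_disk in Hz.
  assert (Hz0 := Cmod_ge_0 z).
  assert (HK0 : 0 <= K) by apply (HK O).
  assert (Hq : 0 <= Cmod z ^ 2 < 1) by nra.
  assert (Hi : 0 < / (1 - Cmod z ^ 2)) by (apply Rinv_0_lt_compat; lra).
  assert (H : Cmod (f z) <= sqrt (K * / (1 - Cmod z ^ 2))).
  { rewrite taylor_lim in Ha; specialize (Ha z Hz).
    apply (lim_Cmod_le _ _ _ Ha); intros n.
    rewrite <- (sqrt_pow2 (Cmod (psum a z n))) by apply Cmod_ge_0.
    apply sqrt_le_1_alt; unfold psum.
    eapply Rle_trans; [apply Cmod_sq_csum_mult|].
    apply Rmult_le_compat; [| | apply HK |].
    - apply rsum_nonneg; intros; apply pow2_ge_0.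
    - apply rsum_nonneg; intros; apply pow2_ge_0.
    - rewrite (rsum_ext _ (fun k => (Cmod z ^ 2) ^ k)).
      + now apply rsum_geom_le.
      + intros k _; rewrite Cmod_pow, <- !pow_mult; f_equal; lia. }
  assert (H2 : Cmod (f z) ^ 2 <= K * / (1 - Cmod z ^ 2)).
  { rewrite <- (pow2_sqrt (K * / (1 - Cmod z ^ 2))) by (apply Rmult_le_pos; lra).
    apply pow_incr; split; [apply Cmod_ge_0 | exact H]. }
  apply Rmult_le_reg_r with (/ (1 - Cmod z ^ 2)); [exact Hi|].
  rewrite Rmult_assoc, Rinv_r by lra; lra.
Qed.

(** * Blaschke factors *)

Definition blaschke (a : R) (w : C) : C := ((w - a) / (1 - a * w))%C.

Lemma blaschke_denom (a : R) (w : C) : 0 <= a < 1 -> in_disk w -> (1 - a * w)%C <> 0.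
Proof.
  intros Ha Hw H.
  assert (E : (a * w = 1)%C).
  { replace (a * w)%C with (1 - (1 - a * w))%C by ring; rewrite H; ring. }
  apply (f_equal Cmod) in E.
  rewrite Cmod_mult, Cmod_R, Cmod_1, Rabs_pos_eq in E by lra.
  unfold in_disk in Hw; pose proof (Cmod_ge_0 w); nra.
Qed.

(** The matrix with rows [-a, s] and [s, a] is orthogonal. *)
Lemma rotation_energy (a s : R) (u v : C) : s ^ 2 = 1 - a ^ 2 ->
  Cmod (- (a * u) + s * v) ^ 2 + Cmod (s * u + a * v) ^ 2 = Cmod u ^ 2 + Cmod v ^ 2.
Proof.
  intros Hs; rewrite !Cmod2_alt; destruct u as [p q], v as [x y].
  unfold Re, Im; simpl fst; simpl snd.
  replace ((- (a * p - 0 * q) + (s * x - 0 * y)) ^ 2 +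
    (- (a * q + 0 * p) + (s * y + 0 * x)) ^ 2 +
    ((s * p - 0 * q + (a * x - 0 * y)) ^ 2 +
     (s * q + 0 * p + (a * y + 0 * x)) ^ 2))
    with ((a ^ 2 + s ^ 2) * (p ^ 2 + q ^ 2 + (x ^ 2 + y ^ 2))) by ring.
  rewrite Hs; ring.
Qed.

Lemma lim_mult_pow (u : nat -> C) (B : R) (z : C) :
  (forall n, Cmod (u n) <= B) -> in_disk z ->
  is_lim_seq (fun n => Cmod (u n * z ^ n)) 0.
Proof.
  intros HB Hz.
  apply (lim_0_le _ (fun n => B * Cmod z ^ n)).
  - apply lim_0_scal, lim_0_geom; split; [apply Cmod_ge_0 | exact Hz].
  - intros n; split; [apply Cmod_ge_0|].
    rewrite Cmod_mult, Cmod_pow; apply Rmult_le_compat_r; [apply pow_le, Cmod_ge_0 | apply HB].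
Qed.

Section Blaschke.

Variable a : R.
Hypothesis Ha : 0 < a < 1.

Let s := sqrt (1 - a ^ 2).

Lemma defect_sq : s ^ 2 = 1 - a ^ 2.
Proof. unfold s; apply pow2_sqrt; nra. Qed.

(** Multiplication by a Blaschke factor is the lossless linear system with
    input [g] and the state below: each step rotates the pair (input, state). *)
Fixpoint blaschke_state (g : nat -> C) (n : nat) : C :=
  match n with O => RtoC 0 | S m => (s * g m + a * blaschke_state g m)%C end.

Lemma blaschke_state_energy (g : nat -> C) (n : nat) :
  rsum (fun m => Cmod (- (a * g m) + s * blaschke_state g m) ^ 2) n +
  Cmod (blaschke_state g n) ^ 2 =
  rsum (fun m => Cmod (g m) ^ 2) n.
Proof.
  induction n as [|n IH].
  - simpl; rewrite Cmod_0; ring.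
  - rewrite !rsum_S, <- IH.
    pose proof (rotation_energy a s (g n) (blaschke_state g n) defect_sq) as E.
    change (blaschke_state g (S n)) with (s * g n + a * blaschke_state g n)%C; lra.
Qed.

(** The energy put into the system is the energy that came out plus the energy
    stored in the state, so the output has no larger norm than the input. This
    avoids boundary values of the Blaschke factor. *)
Lemma h2_blaschke_mult (f : C -> C) (K : R) :
  h2_le f K -> h2_le (fun w => blaschke a w * f w)%C K.
Proof.
  intros (g & Hg & HK).
  assert (Hsum : forall n, rsum (fun m => Cmod (- (a * g m) + s * blaschke_state g m) ^ 2) n <= K).
  { intros n; pose proof (blaschke_state_energy g n); specialize (HK n).
    pose proof (pow2_ge_0 (Cmod (blaschke_state g n))); lra. }
  exists (fun n => - (a * g n) + s * blaschke_state g n)%C; split; [|exact Hsum].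
  apply taylor_lim; intros w Hw.
  rewrite taylor_lim in Hg; specialize (Hg w Hw).
  assert (HB : forall n, Cmod (s * blaschke_state g n) <= sqrt K * s).
  { intros n; rewrite Cmod_Rscal by apply sqrt_pos.
    rewrite Rmult_comm; apply Rmult_le_compat_r; [apply sqrt_pos|].
    rewrite <- (sqrt_pow2 (Cmod (blaschke_state g n))) by apply Cmod_ge_0.
    apply sqrt_le_1_alt; pose proof (blaschke_state_energy g n); specialize (HK n).
    assert (0 <= rsum (fun m => Cmod (- (a * g m) + s * blaschke_state g m) ^ 2) n)
      by (apply rsum_nonneg; intros; apply pow2_ge_0).
    lra. }
  pose proof (lim_mult_pow _ _ w HB Hw) as Hlim.
  pose proof (blaschke_denom a w ltac:(lra) Hw) as Hden.
  assert (Hstate : forall n, ((1 - a * w) * psum (blaschke_state g) w n =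
    s * w * psum g w n - blaschke_state g n * w ^ n)%C).
  { intros n; unfold psum; induction n as [|n IH]; [simpl; ring|].
    rewrite !csum_S, Cmult_plus_distr_l, IH.
    change (blaschke_state g (S n)) with (s * g n + a * blaschke_state g n)%C.
    rewrite Cpow_S; ring. }
  assert (E : forall n, ((1 - a * w) * (psum (fun n => - (a * g n) + s * blaschke_state g n) w n) =
    (w - a) * psum g w n - s * blaschke_state g n * w ^ n)%C).
  { intros n.
    replace (psum (fun n => - (a * g n) + s * blaschke_state g n)%C w n)
      with (s * psum (blaschke_state g) w n + - a * psum g w n)%C.
    2:{ unfold psum; rewrite <- !csum_scal, <- csum_plus; apply csum_ext.
        intros; ring. }
    replace ((1 - a * w) * (s * psum (blaschke_state g) w n + - a * psum g w n))%C
      with (s * ((1 - a * w) * psum (blaschke_state g) w n) - a * (1 - a * w) * psum g w n)%C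
      by ring.
    rewrite Hstate.
    assert (Hs2 : (RtoC s * RtoC s = 1 - RtoC a * RtoC a)%C).
    { rewrite <- !RtoC_mult, <- RtoC_minus; f_equal; pose proof defect_sq; lra. }
    replace (s * (s * w * psum g w n - blaschke_state g n * w ^ n) - a * (1 - a * w) * psum g w n)%C
      with ((s * s) * w * psum g w n - s * blaschke_state g n * w ^ n
            - a * (1 - a * w) * psum g w n)%C by ring.
    rewrite Hs2; ring. }
  apply (lim_0_le _ _ (lim_0_scal (Cmod (/ (1 - a * w)))  _
    (lim_0_plus _ _ (lim_0_scal (Cmod (w - a)) _ Hg) Hlim))).
  intros n; split; [apply Cmod_ge_0|].
  replace (psum (fun n => - (a * g n) + s * blaschke_state g n)%C w n - blaschke a w * f w)%C
    with (/ (1 - a * w) * ((1 - a * w) *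
            psum (fun n => - (a * g n) + s * blaschke_state g n) w n - (w - a) * f w))%C
    by (unfold blaschke; field; exact Hden).
  rewrite E, Cmod_mult; apply Rmult_le_compat_l; [apply Cmod_ge_0|].
  replace ((w - a) * psum g w n - s * blaschke_state g n * w ^ n - (w - a) * f w)%C
    with ((w - a) * (psum g w n - f w) + - (s * blaschke_state g n * w ^ n))%C by ring.
  eapply Rle_trans; [apply Cmod_triangle|].
  rewrite Cmod_opp, Cmod_mult; lra.
Qed.

(** The adjoint of the same system, run backwards: the state is the scaled tail
    [s * sum over m >= n of a^(m-n) f_m], so its start is [s * f a]. *)
Fixpoint blaschke_costate (y : C) (f : nat -> C) (n : nat) : C :=
  match n with O => y | S m => ((blaschke_costate y f m - s * f m) / a)%C end.

Lemma RtoC_a_neq_0 : RtoC a <> 0.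
Proof. intros H; apply RtoC_inj in H; lra. Qed.

Lemma blaschke_costate_step (y : C) (f : nat -> C) (n : nat) :
  blaschke_costate y f n = (s * f n + a * blaschke_costate y f (S n))%C.
Proof. simpl; field; exact RtoC_a_neq_0. Qed.

Lemma blaschke_costate_energy (y : C) (f : nat -> C) (n : nat) :
  rsum (fun m => Cmod (- (a * f m) + s * blaschke_costate y f (S m)) ^ 2) n + Cmod y ^ 2 =
  rsum (fun m => Cmod (f m) ^ 2) n + Cmod (blaschke_costate y f n) ^ 2.
Proof.
  induction n as [|n IH]; [simpl; ring|].
  rewrite !rsum_S.
  pose proof (rotation_energy a s (f n) (blaschke_costate y f (S n)) defect_sq) as E.
  rewrite <- blaschke_costate_step in E; lra.
Qed.

Lemma blaschke_costate_unroll (y : C) (f : nat -> C) (n m : nat) :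
  (blaschke_costate y f n = s * csum (fun k => f (n + k)%nat * RtoC a ^ k) m +
                   RtoC a ^ m * blaschke_costate y f (n + m))%C.
Proof.
  induction m as [|m IH].
  - rewrite Nat.add_0_r; simpl; ring.
  - rewrite IH, csum_S, Nat.add_succ_r, (blaschke_costate_step y f (n + m)), Cpow_S; ring.
Qed.

(** Running backwards one needs the stored energy to be paid for by the future
    input: the state at time [n] is a tail sum, which Cauchy-Schwarz bounds by
    the energy of the coefficients of index [>= n]. *)
Lemma blaschke_costate_tail (F : C -> C) (f : nat -> C) (K : R) (n : nat) :
  taylor F f -> (forall N, rsum (fun m => Cmod (f m) ^ 2) N <= K) ->
  rsum (fun m => Cmod (f m) ^ 2) n + Cmod (blaschke_costate (s * F a) f n) ^ 2 <= K.
Proof.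
  intros HF HK; set (y := (s * F a)%C).
  assert (Hd : in_disk a) by (unfold in_disk; rewrite Cmod_R, Rabs_pos_eq; lra).
  assert (Hlim : is_lim_seq (fun m => Cmod (RtoC a ^ m * blaschke_costate y f (n + m))) 0).
  { rewrite taylor_lim in HF; specialize (HF _ Hd).
    apply (is_lim_seq_incr_n _ n) in HF.
    apply (lim_0_le _ _ (lim_0_scal (s * / a ^ n) _ HF)).
    intros m; split; [apply Cmod_ge_0|].
    assert (E : (y = s * psum f a (n + m) + RtoC a ^ (n + m) * blaschke_costate y f (n + m))%C)
      by exact (blaschke_costate_unroll y f 0 (n + m)).
    assert (Ean : (RtoC a ^ m * blaschke_costate y f (n + m) =
      - (RtoC (s * / a ^ n) * (psum f a (m + n) - F a)))%C).
    { rewrite (Nat.add_comm m n).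
      assert (Hn : (RtoC a ^ n)%C <> 0) by (apply Cpow_nz, RtoC_a_neq_0).
      rewrite RtoC_mult, RtoC_inv, RtoC_pow by (apply pow_nonzero; lra).
      replace (RtoC a ^ m * blaschke_costate y f (n + m))%C
        with (/ RtoC a ^ n * (RtoC a ^ (n + m) * blaschke_costate y f (n + m)))%C
        by (rewrite Cpow_add_r; field; exact Hn).
      replace (RtoC a ^ (n + m) * blaschke_costate y f (n + m))%C
        with (y - s * psum f a (n + m))%C by (rewrite E at 1; ring).
      unfold y; ring. }
    rewrite Ean, Cmod_opp, Cmod_Rscal; [lra|].
    apply Rmult_le_pos; [apply sqrt_pos|].
    left; apply Rinv_0_lt_compat, pow_lt; lra. }
  set (A := rsum (fun m => Cmod (f m) ^ 2) n).
  assert (HA : A <= K) by apply HK.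
  assert (Hmain : Cmod (blaschke_costate y f n) <= sqrt (K - A)).
  { apply (le_of_lim_0 _ _ _ Hlim); intros m.
    rewrite (blaschke_costate_unroll y f n m) at 1.
    eapply Rle_trans; [apply Cmod_triangle|]; apply Rplus_le_compat_r.
    rewrite <- (sqrt_pow2 (Cmod (s * _))) by apply Cmod_ge_0.
    apply sqrt_le_1_alt.
    rewrite Cmod_Rscal, Rpow_mult_distr, defect_sq by apply sqrt_pos.
    pose proof (Cmod_sq_csum_mult (fun k => f (n + k)%nat) (fun k => RtoC a ^ k)%C m) as HCS.
    assert (Hgeo : rsum (fun k => Cmod (RtoC a ^ k) ^ 2) m <= / (1 - a ^ 2)).
    { rewrite (rsum_ext _ (fun k => (a ^ 2) ^ k)).
      - apply rsum_geom_le; nra.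
      - intros k _; rewrite Cmod_pow, Cmod_R, Rabs_pos_eq, <- !pow_mult by lra.
        f_equal; lia. }
    pose proof (HK (n + m)%nat) as HKm; rewrite rsum_add in HKm; fold A in HKm.
    set (T := rsum (fun k => Cmod (f (n + k)%nat) ^ 2) m) in *.
    assert (HT : 0 <= T) by (apply rsum_nonneg; intros; apply pow2_ge_0).
    assert (Ha2 : 0 < 1 - a ^ 2) by nra.
    apply Rle_trans with ((1 - a ^ 2) * (T * / (1 - a ^ 2))).
    - apply Rmult_le_compat_l; [lra|].
      eapply Rle_trans; [exact HCS|]; now apply Rmult_le_compat_l.
    - replace ((1 - a ^ 2) * (T * / (1 - a ^ 2))) with T by (field; lra); lra. }
  assert (Cmod (blaschke_costate y f n) ^ 2 <= K - A); [|lra].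
  rewrite <- (pow2_sqrt (K - A)) by lra.
  apply pow_incr; split; [apply Cmod_ge_0 | exact Hmain].
Qed.

(** The reproducing kernel at [a], normalised to the value [1] there. *)
Definition kernel_fun (w : C) : C := (RtoC (1 - a ^ 2) / (1 - a * w))%C.

(** The orthogonal decomposition along the kernel at [a]: what is left after
    interpolating [F] at [a] is divisible by the Blaschke factor, and the quotient
    is the output of the backward system. *)
Lemma h2_blaschke_div (F : C -> C) (K : R) :
  h2_le F K -> exists G, h2_le G K /\
  forall w, in_disk w -> F w = (F a * kernel_fun w + blaschke a w * G w)%C.
Proof.
  intros (f & HF & HK).
  set (y := (s * F a)%C); set (Y := blaschke_costate y f).
  set (g := fun n => (- (a * f n) + s * Y (S n))%C).
  assert (Hg : forall N, rsum (fun n => Cmod (g n) ^ 2) N <= K).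
  { intros N; pose proof (blaschke_costate_energy y f N).
    pose proof (blaschke_costate_tail F f K N HF HK) as Ht.
    fold y in Ht; pose proof (pow2_ge_0 (Cmod y)); unfold g, Y; lra. }
  assert (HK0 : 0 <= K) by apply (HK O).
  destruct (taylor_exists g (sqrt K)) as [G HG].
  { intros n; rewrite <- (sqrt_pow2 (Cmod (g n))) by apply Cmod_ge_0.
    apply sqrt_le_1_alt; eapply Rle_trans; [|apply (Hg (S n))].
    apply (rsum_term_le (fun n => Cmod (g n) ^ 2)); [intros; apply pow2_ge_0 | lia]. }
  exists G; split; [exists g; auto|]; intros w Hw.
  pose proof (blaschke_denom a w ltac:(lra) Hw) as Hden.
  assert (HB : forall n, Cmod (s * Y n) <= s * sqrt K).
  { intros n; rewrite Cmod_Rscal by apply sqrt_pos.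
    apply Rmult_le_compat_l; [apply sqrt_pos|].
    rewrite <- (sqrt_pow2 (Cmod (Y n))) by apply Cmod_ge_0.
    apply sqrt_le_1_alt; pose proof (blaschke_costate_tail F f K n HF HK).
    assert (0 <= rsum (fun m => Cmod (f m) ^ 2) n)
      by (apply rsum_nonneg; intros; apply pow2_ge_0).
    unfold Y, y; lra. }
  pose proof (lim_mult_pow _ _ w HB Hw) as Hlim.
  assert (HY : forall n, ((w - a) * csum (fun k => Y (S k) * w ^ k) n =
    s * psum f w n - y + Y n * w ^ n)%C).
  { intros n; unfold psum; induction n as [|n IH]; 
      [change (Y O) with y; simpl csum; change (w ^ 0)%C with (RtoC 1); ring|].
    rewrite !csum_S, Cmult_plus_distr_l, IH.
    replace (Y n) with (s * f n + a * Y (S n))%C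
      by (unfold Y; symmetry; apply blaschke_costate_step).
    rewrite Cpow_S; ring. }
  assert (Hs2 : (RtoC s * RtoC s = 1 - RtoC a * RtoC a)%C).
  { rewrite <- !RtoC_mult, <- RtoC_minus; f_equal; pose proof defect_sq; lra. }
  assert (E : forall n, ((w - a) * psum g w n =
    (1 - a * w) * psum f w n - RtoC (1 - a ^ 2) * F a + s * Y n * w ^ n)%C).
  { intros n.
    replace (psum g w n)
      with (s * csum (fun k => Y (S k) * w ^ k) n + - a * psum f w n)%C.
    2:{ unfold psum, g; rewrite <- !csum_scal, <- csum_plus; apply csum_ext; intros; ring. }
    replace ((w - a) * (s * csum (fun k => Y (S k) * w ^ k) n + - a * psum f w n))%C
      with (s * ((w - a) * csum (fun k => Y (S k) * w ^ k) n) - a * (w - a) * psum f w n)%C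
      by ring.
    rewrite HY; unfold y.
    replace (1 - a ^ 2) with (s * s) by (pose proof defect_sq; lra); rewrite RtoC_mult.
    replace (s * (s * psum f w n - s * F a + Y n * w ^ n) - a * (w - a) * psum f w n)%C
      with ((s * s) * psum f w n - a * (w - a) * psum f w n
            - (s * s) * F a + s * Y n * w ^ n)%C by ring.
    rewrite Hs2; ring. }
  rewrite taylor_lim in HF, HG; specialize (HF w Hw); specialize (HG w Hw).
  assert (Hid : ((w - a) * G w = (1 - a * w) * F w - RtoC (1 - a ^ 2) * F a)%C).
  { apply (lim_Cmod_unique (fun n => (w - a) * psum g w n)%C).
    - apply (lim_0_le _ _ (lim_0_scal (Cmod (w - a)) _ HG)); intros n.
      split; [apply Cmod_ge_0|].
      replace ((w - a) * psum g w n - (w - a) * G w)%C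
        with ((w - a) * (psum g w n - G w))%C by ring.
      rewrite Cmod_mult; lra.
    - apply (lim_0_le _ _ (lim_0_plus _ _ (lim_0_scal (Cmod (1 - a * w)) _ HF) Hlim)).
      intros n; split; [apply Cmod_ge_0|]; rewrite E.
      replace ((1 - a * w) * psum f w n - RtoC (1 - a ^ 2) * F a + s * Y n * w ^ n -
        ((1 - a * w) * F w - RtoC (1 - a ^ 2) * F a))%C
        with ((1 - a * w) * (psum f w n - F w) + s * Y n * w ^ n)%C by ring.
      eapply Rle_trans; [apply Cmod_triangle|]; rewrite Cmod_mult; lra. }
  unfold kernel_fun, blaschke.
  replace (F a * (RtoC (1 - a ^ 2) / (1 - a * w)) + (w - a) / (1 - a * w) * G w)%C
    with ((RtoC (1 - a ^ 2) * F a + (w - a) * G w) / (1 - a * w))%C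
    by (field; exact Hden).
  rewrite Hid; field; exact Hden.
Qed.

Lemma h2_kernel_fun : h2_le kernel_fun 1.
Proof.
  exists (fun n => RtoC (1 - a ^ 2) * RtoC a ^ n)%C; split.
  - apply taylor_lim; intros w Hw.
    pose proof (blaschke_denom a w ltac:(lra) Hw) as Hden.
    assert (Hd : in_disk (a * w)%C).
    { unfold in_disk in *; rewrite Cmod_Rscal by lra.
      pose proof (Cmod_ge_0 w); nra. }
    pose proof (lim_mult_pow (fun _ => kernel_fun w) _ (a * w)%C
      (fun _ => Rle_refl _) Hd) as Hl.
    apply (is_lim_seq_ext _ _ _ (fun n => eq_refl)) in Hl.
    revert Hl; apply is_lim_seq_ext; intros n.
    rewrite <- (Cmod_opp (kernel_fun w * _)); f_equal.
    replace (psum (fun n => RtoC (1 - a ^ 2) * RtoC a ^ n)%C w n)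
      with (RtoC (1 - a ^ 2) * csum (fun k => (a * w) ^ k) n)%C.
    2:{ unfold psum; rewrite <- csum_scal; apply csum_ext; intros k _.
        rewrite Cpow_mult_l; ring. }
    replace (csum (fun k => (a * w) ^ k)%C n)
      with (((1 - a * w) * csum (fun k => (a * w) ^ k) n) / (1 - a * w))%C
      by (field; exact Hden).
    rewrite csum_geom; unfold kernel_fun; field; exact Hden.
  - intros N.
    rewrite (rsum_ext _ (fun k => (1 - a ^ 2) ^ 2 * (a ^ 2) ^ k)).
    2:{ intros k _; rewrite Cmod_mult, Cmod_pow, !Cmod_R, !Rabs_pos_eq by nra.
        rewrite Rpow_mult_distr, <- !pow_mult; do 2 f_equal; lia. }
    rewrite rsum_scal.
    assert (Hq : 0 <= a ^ 2 < 1) by nra.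
    pose proof (rsum_geom_le (a ^ 2) N Hq) as Hg.
    apply Rle_trans with ((1 - a ^ 2) ^ 2 * / (1 - a ^ 2)).
    + apply Rmult_le_compat_l; [apply pow2_ge_0 | exact Hg].
    + replace ((1 - a ^ 2) ^ 2 * / (1 - a ^ 2)) with (1 - a ^ 2) by (field; lra); nra.
Qed.

End Blaschke.

(** * The upper bound *)

Lemma Rbar_lub_spec (E : Rbar -> Prop) : Rbar_is_lub E (Rbar_lub E).
Proof. exact (proj2_sig (Rbar_ex_lub E)). Qed.

Lemma Rbar_glb_spec (E : Rbar -> Prop) : Rbar_is_glb E (Rbar_glb E).
Proof. exact (proj2_sig (Rbar_ex_glb E)). Qed.

Lemma op_norm_le (T : op) (K : R) :
  (forall f, h2_le f 1 -> h2_le (T f) K) -> Rbar_le (op_norm T) (sqrt K).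
Proof.
  intros H; apply (proj2 (Rbar_lub_spec _)).
  intros N (f & Hf & Hn & ->); apply H2_norm_le, H.
  apply (h2_le_weaken f (1 ^ 2)); [now apply h2_le_of_norm | lra].
Qed.

Lemma op_norm_ge (T : op) (f : C -> C) :
  h2_le f 1 -> Rbar_le (H2_norm (T f)) (op_norm T).
Proof.
  intros Hf; apply (proj1 (Rbar_lub_spec _)).
  exists f; split; [now apply (h2_le_in_H2 f 1)|]; split; [|reflexivity].
  rewrite <- sqrt_1; now apply H2_norm_le.
Qed.

Lemma op_norm_finite (T : op) (K : R) :
  (forall f, h2_le f 1 -> h2_le (T f) K) -> is_finite (op_norm T).
Proof.
  intros H; pose proof (op_norm_le T K H) as Hu.
  assert (H0 : h2_le (fun _ => RtoC 0) 1) by (apply (h2_le_weaken _ 0); [apply h2_le_zero | lra]).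
  pose proof (op_norm_ge T _ H0) as Hl.
  assert (Hn : Rbar_le 0 (H2_norm (T (fun _ => RtoC 0)))).
  { apply H2_norm_ge; intros; apply sqrt_pos. }
  pose proof (Rbar_le_trans _ _ _ Hn Hl) as Hp.
  destruct (op_norm T); simpl in *; [reflexivity | contradiction | contradiction].
Qed.

(** The mean of the harmonic function [Re cusp_majorant] over every circle
    centred at [0]. *)
Definition majorant_mean : R := Re (cusp_majorant 0).

Lemma majorant_mean_pos : 0 < majorant_mean.
Proof.
  pose proof (cusp_majorant_lower 0 ltac:(unfold in_disk; rewrite Cmod_0; lra)) as H.
  pose proof (exp_pos (3 / 4 * (Re (cusp2 0) - 1))); unfold majorant_mean; lra.
Qed.

(** Point evaluation and nontangential approach bound the square of [g (cusp z)] by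
    [2 * K * x], with [x = Re (cusp2 z)]. Even after multiplication by the weight
    [exp ((x - 1) / 20)] this grows slower than [exp (3 / 4 * x)], so it has a
    multiple of [cusp_majorant] as harmonic majorant. A function [b] that is
    small only for bounded [x] satisfies the hypothesis with a small [d], because
    the weight grows along the cusp. *)
Lemma h2_comp_cusp_weighted (b g : C -> C) (K L d : R) :
  h2_le g K -> h2_le (fun w => b w * g w)%C L ->
  (forall z, in_disk z ->
    Cmod (b (cusp z)) ^ 2 <= d * exp ((Re (cusp2 z) - 1) / 20)) ->
  h2_le (fun z => b (cusp z) * g (cusp z))%C (8 * d * K * majorant_mean).
Proof.
  intros Hg (p & Hp & _) Hb.
  assert (HK : 0 <= K) by now apply (h2_le_nonneg g).
  assert (Hd : 0 <= d).
  { assert (H0 : in_disk 0) by (unfold in_disk; rewrite Cmod_0; lra).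
    specialize (Hb 0 H0); pose proof (pow2_ge_0 (Cmod (b (cusp 0)))).
    pose proof (exp_pos ((Re (cusp2 0) - 1) / 20)); nra. }
  destruct (taylor_comp_cusp _ p Hp) as [q Hq].
  destruct taylor_cusp_majorant as [h Hh].
  pose proof (taylor_scal _ _ (RtoC (8 * d * K)%R) Hh) as HH.
  exists q; split; [exact Hq|]; intros N.
  assert (E : Re (RtoC (8 * d * K) * cusp_majorant 0) = 8 * d * K * majorant_mean).
  { unfold majorant_mean, Re, Cmult, RtoC; simpl; ring. }
  rewrite <- E; apply (harmonic_majorant _ _ _ _ N Hq HH); intros z Hz; clear E.
  destruct (cusp_in_disk z Hz) as [Hc Hc2].
  pose proof (h2_eval g K _ Hg Hc) as He.
  destruct (cusp2_half_strip z Hz) as [Hx _].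
  pose proof (cusp_majorant_lower z Hz) as Hm.
  specialize (Hb z Hz).
  set (x := Re (cusp2 z)) in *; set (W := Cmod (cusp z)) in *.
  replace (Re (RtoC (8 * d * K) * cusp_majorant z)) with (8 * d * K * Re (cusp_majorant z))
    by (unfold Re, Cmult, RtoC; simpl; ring).
  assert (HW : 0 < 1 - W ^ 2).
  { unfold in_disk in Hc; fold W in Hc; pose proof (Cmod_ge_0 (cusp z)); fold W in H; nra. }
  assert (Hg2 : Cmod (g (cusp z)) ^ 2 <= K * (2 * x)).
  { apply Rle_trans with (K * / (1 - W ^ 2)); [|now apply Rmult_le_compat_l].
    apply Rmult_le_reg_r with (1 - W ^ 2); [exact HW|].
    rewrite Rmult_assoc, Rinv_l by lra; lra. }
  rewrite Cmod_mult, Rpow_mult_distr.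
  apply Rle_trans with (d * exp ((x - 1) / 20) * (K * (2 * x))).
  { apply Rmult_le_compat; auto; apply pow2_ge_0. }
  assert (Hex : exp ((x - 1) / 20) * (2 * x) <= 4 * exp (3 / 4 * (x - 1))).
  { pose proof (exp_ineq1_le ((x - 1) / 2)) as H1.
    assert (H2 : exp (11 / 20 * (x - 1)) <= exp (3 / 4 * (x - 1))) by (apply exp_mono; lra).
    replace (11 / 20 * (x - 1)) with ((x - 1) / 20 + (x - 1) / 2) in H2 by field.
    rewrite exp_plus in H2.
    pose proof (exp_pos ((x - 1) / 20)).
    assert (exp ((x - 1) / 20) * (2 * x) <=
            exp ((x - 1) / 20) * (4 * exp ((x - 1) / 2)))
      by (apply Rmult_le_compat_l; lra).
    lra. }
  assert (HdK : 0 <= d * K) by now apply Rmult_le_pos.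
  replace (d * exp ((x - 1) / 20) * (K * (2 * x)))
    with (d * K * (exp ((x - 1) / 20) * (2 * x))) by ring.
  replace (8 * d * K * Re (cusp_majorant z)) with (d * K * (8 * Re (cusp_majorant z))) by ring.
  apply Rmult_le_compat_l; [exact HdK | lra].
Qed.

Lemma h2_comp_cusp (f : C -> C) (K : R) :
  h2_le f K -> h2_le (fun z => f (cusp z)) (8 * K * majorant_mean).
Proof.
  intros Hf.
  apply (h2_le_ext (fun z => 1 * f (cusp z))%C); [|intros; ring].
  replace (8 * K * majorant_mean) with (8 * 1 * K * majorant_mean) by ring.
  apply (h2_comp_cusp_weighted (fun _ => RtoC 1) f K K); [exact Hf | |].
  - apply (h2_le_ext f); [exact Hf | intros; ring].
  - intros z Hz; rewrite Cmod_1, pow1, Rmult_1_l.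
    destruct (cusp2_half_strip z Hz) as [Hx _].
    apply exp_ge_1; lra.
Qed.

Section Interpolation.

Variable a : nat -> R.
Hypothesis Ha : forall j, 0 < a j < 1.
Hypothesis Hinj : forall i j, i <> j -> a i <> a j.

Fixpoint blaschke_prod (n : nat) (w : C) : C :=
  match n with O => RtoC 1 | S j => (blaschke_prod j w * blaschke (a j) w)%C end.

(** Newton's divided differences with Blaschke factors. At the nodes [a j] with
    [j < n] the formula divides by [0], but the recursion reads [residual f n] at
    [a n]. The point of this formula is that it is linear in [f] for arbitrary
    functions, whereas Taylor coefficients would have to be chosen. *)
Fixpoint residual (f : C -> C) (n : nat) (w : C) : C :=
  match n with
  | O => f w
  | S j => ((residual f j w - residual f j (a j) * kernel_fun (a j) w) / blaschke (a j) w)%C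
  end.

Definition basis (i : nat) (w : C) : C := (blaschke_prod i w * kernel_fun (a i) w)%C.

Definition interp_op (n : nat) : op := fun f z =>
  csum (fun i => residual f i (a i) * basis i (cusp z))%C n.

Lemma node_in_disk (j : nat) : in_disk (a j).
Proof. unfold in_disk; rewrite Cmod_R, Rabs_pos_eq; specialize (Ha j); lra. Qed.

Lemma blaschke_neq_0 (j : nat) (w : C) :
  in_disk w -> w <> a j -> blaschke (a j) w <> 0.
Proof.
  intros Hw Hn H; apply Hn.
  pose proof (blaschke_denom (a j) w ltac:(specialize (Ha j); lra) Hw) as Hd.
  replace w with (blaschke (a j) w * (1 - a j * w) + a j)%C
    by (unfold blaschke; field; exact Hd).
  rewrite H; ring.
Qed.

Lemma residual_linear (f g : C -> C) (c : C) (n : nat) (w : C) :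
  residual (fun u => c * f u + g u)%C n w = (c * residual f n w + residual g n w)%C.
Proof.
  revert w; induction n as [|n IH]; intros w; simpl; [reflexivity|].
  rewrite !IH; unfold Cdiv; ring.
Qed.

(** Iterated division by Blaschke factors. The Hardy function [g] exists on the
    whole disk, while [residual f n] agrees with it off the first [n] nodes; as
    the nodes are distinct, that covers the next evaluation point. *)
Lemma residual_spec (f : C -> C) (K : R) (n : nat) : h2_le f K ->
  exists g, h2_le g K /\
    (forall w, in_disk w -> (forall i, (i < n)%nat -> w <> a i) -> residual f n w = g w) /\
    forall w, in_disk w ->
      f w = (csum (fun i => residual f i (a i) * basis i w) n + blaschke_prod n w * g w)%C.
Proof.
  intros Hf; induction n as [|n (g & Hg & H1 & H2)].
  - exists f; split; [exact Hf|]; split; [reflexivity|].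
    intros w _; simpl; ring.
  - destruct (h2_blaschke_div (a n) (Ha n) g K Hg) as (G & HG & HD).
    exists G; split; [exact HG|].
    assert (En : residual f n (a n) = g (a n)).
    { apply H1; [apply node_in_disk|]; intros i Hi H.
      apply (Hinj n i); [lia | now apply RtoC_inj]. }
    split.
    + intros w Hw Hne; simpl.
      rewrite En, H1, (HD w Hw); [|exact Hw | intros; apply Hne; lia].
      field; apply blaschke_neq_0; [exact Hw | apply Hne; lia].
    + intros w Hw; rewrite csum_S, En, (H2 w Hw), (HD w Hw); simpl; unfold basis; ring.
Qed.

Lemma h2_blaschke_prod_mult (n : nat) (g : C -> C) (K : R) :
  h2_le g K -> h2_le (fun w => blaschke_prod n w * g w)%C K.
Proof.
  revert g; induction n as [|n IH]; intros g Hg; simpl.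
  - apply (h2_le_ext g); [exact Hg | intros; ring].
  - apply (h2_le_ext (fun w => blaschke_prod n w * (blaschke (a n) w * g w))%C);
      [|intros; ring].
    apply (IH (fun w => blaschke (a n) w * g w)%C).
    apply (h2_blaschke_mult (a n) (Ha n) g K Hg).
Qed.

Lemma interp_op_error (n : nat) (f : C -> C) (K : R) : h2_le f K ->
  exists g, h2_le g K /\ forall z, in_disk z ->
    (f (cusp z) - interp_op n f z = blaschke_prod n (cusp z) * g (cusp z))%C.
Proof.
  intros Hf; destruct (residual_spec f K n Hf) as (g & Hg & _ & H).
  exists g; split; [exact Hg|]; intros z Hz.
  destruct (cusp_in_disk z Hz) as [Hc _].
  rewrite (H _ Hc); unfold interp_op; ring.
Qed.

Lemma basis_in_H2 (i : nat) : in_H2 (fun z => basis i (cusp z)).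
Proof.
  eapply h2_le_in_H2, (h2_comp_cusp (basis i)), h2_blaschke_prod_mult.
  apply h2_kernel_fun; apply Ha.
Qed.

Lemma interp_op_rank (n : nat) : rank_lt (interp_op n) (S n).
Proof.
  exists n, (fun i z => basis (pred i) (cusp z)); split; [lia|].
  split; [intros; apply basis_in_H2|].
  intros f _; exists (fun i => residual f (pred i) (a (pred i))); intros z _.
  assert (Hsum : forall (u : nat -> C) k,
    @sum_n_m C_AbelianMonoid u 1 k = csum (fun i => u (S i)) k).
  { intros u k; induction k as [|k IH]; [now rewrite sum_n_m_zero by lia|].
    rewrite sum_n_Sm, IH by lia; reflexivity. }
  rewrite Hsum; reflexivity.
Qed.

Lemma interp_op_bounded (n : nat) (f : C -> C) (K : R) :
  h2_le f K -> h2_le (interp_op n f) (64 * K * majorant_mean).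
Proof.
  intros Hf; destruct (interp_op_error n f K Hf) as (g & Hg & E).
  pose proof (h2_blaschke_prod_mult n g K Hg) as Hbg.
  set (u := fun (i : nat) (z : C) => match i with
    | O => f (cusp z) | S _ => (RtoC (-1) * (blaschke_prod n (cusp z) * g (cusp z)))%C end).
  apply (h2_le_ext (fun z => csum (fun i => u i z) 2)).
  - apply (h2_le_weaken _ (INR 2 ^ 2 * (8 * K * majorant_mean)));
      [|rewrite INR_2; pose proof (h2_le_nonneg f K Hf); pose proof majorant_mean_pos; nra].
    apply h2_le_csum; intros [|i] _; unfold u; [now apply h2_comp_cusp|].
    replace (8 * K * majorant_mean) with (Cmod (RtoC (-1)) ^ 2 * (8 * K * majorant_mean)).
    + apply h2_le_scal, (h2_comp_cusp (fun w => blaschke_prod n w * g w)%C), Hbg.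
    + rewrite Cmod_R, Rabs_left by lra; ring.
  - intros z Hz; simpl.
    replace (interp_op n f z) with (f (cusp z) - (f (cusp z) - interp_op n f z))%C by ring.
    rewrite (E z Hz), RtoC_m1; ring.
Qed.

(** Interpolation at [n] nodes has rank at most [n], and its error is the
    composition of a Blaschke product times a function of no larger norm. *)
Lemma approx_number_interp (n : nat) (d : R) :
  (forall z, in_disk z ->
    Cmod (blaschke_prod n (cusp z)) ^ 2 <= d * exp ((Re (cusp2 z) - 1) / 20)) ->
  Rbar_le (approx_number (S n) (comp_op cusp)) (sqrt (8 * d * majorant_mean)).
Proof.
  intros Hd.
  apply Rbar_le_trans with (op_norm (op_sub (comp_op cusp) (interp_op n))).
  - apply (proj1 (Rbar_glb_spec _)).
    exists (interp_op n); split; [|split; [apply interp_op_rank | reflexivity]].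
    split; [|split].
    + intros f Hf; destruct (h2_le_of_in_H2 f Hf) as [K HK].
      eapply h2_le_in_H2, interp_op_bounded, HK.
    + intros f g c _ _ z _; unfold interp_op.
      rewrite <- csum_scal, <- csum_plus; apply csum_ext; intros i _.
      rewrite residual_linear; ring.
    + apply (op_norm_finite _ (64 * 1 * majorant_mean)); intros f Hf; now apply interp_op_bounded.
  - apply op_norm_le; intros f Hf.
    destruct (interp_op_error n f 1 Hf) as (g & Hg & E).
    apply (h2_le_ext (fun z => blaschke_prod n (cusp z) * g (cusp z))%C).
    + replace (8 * d * majorant_mean) with (8 * d * 1 * majorant_mean) by ring.
      apply (h2_comp_cusp_weighted (blaschke_prod n) g 1 1);
        [exact Hg | now apply h2_blaschke_prod_mult | exact Hd].
    + intros z Hz; unfold op_sub, comp_op; symmetry; now apply E.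
Qed.

End Interpolation.

(** The coordinate [w = 1 - 1 / q] turns a Blaschke factor into a quotient of
    the distances from [q] to [t] and to the reflection of [t] in [Re q = 1/2]. *)
Lemma blaschke_reflected (t : R) (q : C) : t <> 0 -> q <> 0 -> (q + t - 1)%C <> 0 ->
  blaschke (1 - / t) (1 - 1 / q) = ((q - t) / (q + t - 1))%C.
Proof.
  intros Ht Hq Hd.
  assert (Ht0 : RtoC t <> 0) by (intros H; apply RtoC_inj in H; lra).
  unfold blaschke; rewrite RtoC_minus, RtoC_inv by lra.
  assert (E1 : (1 - 1 / q - (1 - / t) = (q - t) / (t * q))%C) by (field; auto).
  assert (E2 : (1 - (1 - / t) * (1 - 1 / q) = (q + t - 1) / (t * q))%C)
    by (field; auto).
  rewrite E1, E2; field; auto.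
Qed.

Lemma blaschke_cusp (t : R) (z : C) : 1 <= t -> in_disk z ->
  let x := Re (cusp2 z) in let y := Im (cusp2 z) in
  Cmod (blaschke (1 - / t) (cusp z)) ^ 2 * ((x + t - 1) ^ 2 + y ^ 2) =
  (x - t) ^ 2 + y ^ 2.
Proof.
  intros Ht Hz x y; destruct (cusp2_half_strip z Hz) as [Hx Hy]; fold x in Hx; fold y in Hy.
  assert (Ez : cusp2 z = (x, y)) by (unfold x, y, Re, Im; now rewrite <- surjective_pairing).
  set (q := cusp2 z) in *.
  assert (Hq : q <> 0) by (rewrite Ez; intros H; injection H; lra).
  assert (Hd : (q + t - 1)%C <> 0).
  { rewrite Ez; intros H; apply (f_equal Re) in H; unfold Re in H; simpl in H; lra. }
  unfold cusp, cusp3; fold q.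
  rewrite blaschke_reflected, Cmod_div; [|exact Hd | lra | exact Hq | exact Hd].
  assert (E1 : Cmod (q - t) ^ 2 = (x - t) ^ 2 + y ^ 2).
  { rewrite Cmod2_alt, Ez; unfold Re, Im; simpl; ring. }
  assert (E2 : Cmod (q + t - 1) ^ 2 = (x + t - 1) ^ 2 + y ^ 2).
  { rewrite Cmod2_alt, Ez; unfold Re, Im; simpl; ring. }
  assert (Hp : 0 < Cmod (q + t - 1)) by now apply Cmod_gt_0.
  rewrite <- E1, <- E2; field; lra.
Qed.

Lemma blaschke_cusp_le_1 (t : R) (z : C) : 1 <= t -> in_disk z ->
  Cmod (blaschke (1 - / t) (cusp z)) ^ 2 <= 1.
Proof.
  intros Ht Hz; pose proof (blaschke_cusp t z Ht Hz) as E; cbv zeta in E.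
  destruct (cusp2_half_strip z Hz) as [Hx _].
  set (x := Re (cusp2 z)) in *; set (y := Im (cusp2 z)) in *.
  set (B := Cmod (blaschke (1 - / t) (cusp z))) in *.
  apply Rnot_lt_le; intros H.
  assert (0 < (x + t - 1) ^ 2) by (apply pow_lt; lra).
  pose proof (pow2_ge_0 y).
  assert ((x + t - 1) ^ 2 - (x - t) ^ 2 = (2 * x - 1) * (2 * t - 1)) by ring.
  assert (0 < (2 * x - 1) * (2 * t - 1)) by (apply Rmult_lt_0_compat; lra).
  nra.
Qed.

(** If [t] and [x] agree up to a factor [2], the distances from [x + i y] to [t] and
    to its reflection have a ratio bounded away from [1]: the squares differ by
    [(2 x - 1) (2 t - 1) >= x^2 / 2], while the larger is at most
    [9 x^2 + 1]. *)
Lemma blaschke_cusp_small (t : R) (z : C) : 1 <= t -> in_disk z ->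
  Re (cusp2 z) / 2 <= t <= 2 * Re (cusp2 z) ->
  Cmod (blaschke (1 - / t) (cusp z)) ^ 2 <= 19 / 20.
Proof.
  intros Ht Hz Hr; pose proof (blaschke_cusp t z Ht Hz) as E; cbv zeta in E.
  destruct (cusp2_half_strip z Hz) as [Hx Hy].
  set (x := Re (cusp2 z)) in *; set (y := Im (cusp2 z)) in *.
  set (B := Cmod (blaschke (1 - / t) (cusp z))) in *.
  apply Rnot_lt_le; intros H.
  assert (Hp : 0 < (x + t - 1) ^ 2) by (apply pow_lt; lra).
  pose proof (pow2_ge_0 y) as Hy0.
  assert (Hy1 : y ^ 2 <= 1) by nra.
  assert (H1 : 19 / 20 * ((x + t - 1) ^ 2 + y ^ 2) < (x - t) ^ 2 + y ^ 2) by nra.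
  assert (H2 : (x + t - 1) ^ 2 - (x - t) ^ 2 = (2 * x - 1) * (2 * t - 1)) by ring.
  assert (H3 : x * (x / 2) <= (2 * x - 1) * (2 * t - 1)) by (apply Rmult_le_compat; lra).
  assert (H4 : (x + t - 1) ^ 2 <= (3 * x) ^ 2) by (apply pow_incr; lra).
  nra.
Qed.

Section Dyadic_Nodes.

Variable M : nat.
Hypothesis HM : (1 <= M)%nat.

(** [2^((j+1)/M)]: [M] nodes in every dyadic interval. *)
Definition tau (j : nat) : R := exp (INR (S j) / INR M * ln 2).

Lemma INR_M_pos : 0 < INR M.
Proof. apply lt_0_INR; lia. Qed.

Lemma ln2_pos : 0 < ln 2.
Proof. rewrite <- ln_1; apply ln_increasing; lra. Qed.

Lemma tau_increasing (i j : nat) : (i < j)%nat -> tau i < tau j.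
Proof.
  intros H; apply exp_increasing, Rmult_lt_compat_r; [apply ln2_pos|].
  apply Rmult_lt_compat_r; [apply Rinv_0_lt_compat, INR_M_pos | apply lt_INR; lia].
Qed.

Lemma tau_gt_1 (j : nat) : 1 < tau j.
Proof.
  rewrite <- exp_0; apply exp_increasing, Rmult_lt_0_compat; [|apply ln2_pos].
  apply Rdiv_lt_0_compat; [apply lt_0_INR; lia | apply INR_M_pos].
Qed.

Lemma pow2_exp (l : nat) : 2 ^ l = exp (INR l * ln 2).
Proof. rewrite <- Rpower_pow by lra; reflexivity. Qed.

Lemma tau_block (l j : nat) : (l * M <= j < S l * M)%nat -> 2 ^ l <= tau j <= 2 * 2 ^ l.
Proof.
  intros H; change (2 * 2 ^ l) with (2 ^ S l); rewrite !pow2_exp; unfold tau.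
  pose proof INR_M_pos; pose proof ln2_pos.
  split; apply exp_mono, Rmult_le_compat_r; try lra;
    apply Rmult_le_reg_r with (INR M); try assumption;
    unfold Rdiv; rewrite ?Rmult_assoc, ?Rinv_l, ?Rmult_1_r by lra;
    rewrite <- mult_INR; apply le_INR; lia.
Qed.

Definition node (j : nat) : R := 1 - / tau j.

Lemma node_range (j : nat) : 0 < node j < 1.
Proof.
  unfold node; pose proof (tau_gt_1 j).
  assert (0 < / tau j < 1).
  { split; [apply Rinv_0_lt_compat; lra|].
    rewrite <- Rinv_1; apply Rinv_lt_contravar; lra. }
  lra.
Qed.

Lemma node_inj (i j : nat) : i <> j -> node i <> node j.
Proof.
  intros Hij H; unfold node in H.
  assert (E : tau i = tau j) by (apply Rinv_eq_reg; lra).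
  destruct (Nat.lt_total i j) as [H1|[H1|H1]]; [|contradiction|];
    apply tau_increasing in H1; lra.
Qed.

Lemma dyadic_scale (x : R) (L : nat) : 1 <= x < 2 ^ L ->
  exists l, (l < L)%nat /\ 2 ^ l <= x < 2 * 2 ^ l.
Proof.
  induction L as [|L IH]; intros Hx; [simpl in Hx; lra|].
  destruct (Rlt_dec x (2 ^ L)) as [H|H].
  - destruct IH as (l & Hl & Hlx); [lra|]; exists l; split; [lia | exact Hlx].
  - exists L; split; [lia|]; simpl in Hx; lra.
Qed.

Lemma blaschke_prod_le_1 (k : nat) (z : C) : in_disk z ->
  Cmod (blaschke_prod node k (cusp z)) ^ 2 <= 1.
Proof.
  intros Hz; induction k as [|k IHk]; simpl blaschke_prod; [rewrite Cmod_1; lra|].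
  rewrite Cmod_mult, Rpow_mult_distr.
  pose proof (blaschke_cusp_le_1 (tau k) z ltac:(pose proof (tau_gt_1 k); lra) Hz) as H1.
  fold (node k) in H1.
  pose proof (pow2_ge_0 (Cmod (blaschke_prod node k (cusp z)))).
  pose proof (pow2_ge_0 (Cmod (blaschke (node k) (cusp z)))); nra.
Qed.

(** At a point of the [l]th dyadic range, each node of the [l]th block contributes
    a factor [19 / 20] to the square and the others at most [1]. *)
Lemma blaschke_prod_block (z : C) (l n p : nat) : in_disk z ->
  2 ^ l <= Re (cusp2 z) < 2 * 2 ^ l -> (l * M + p <= n)%nat -> (p <= M)%nat ->
  Cmod (blaschke_prod node n (cusp z)) ^ 2 <= (19 / 20) ^ p.
Proof.
  intros Hz Hl; revert p; induction n as [|n IH]; intros p Hn Hp.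
  - replace p with O by lia; simpl; rewrite Cmod_1; lra.
  - simpl blaschke_prod; rewrite Cmod_mult, Rpow_mult_distr.
    pose proof (pow2_ge_0 (Cmod (blaschke_prod node n (cusp z)))).
    pose proof (pow2_ge_0 (Cmod (blaschke (node n) (cusp z)))).
    pose proof (blaschke_cusp_le_1 (tau n) z ltac:(pose proof (tau_gt_1 n); lra) Hz) as H1.
    fold (node n) in H1.
    destruct p as [|p].
    + pose proof (blaschke_prod_le_1 n z Hz); simpl in *; nra.
    + destruct (Nat.le_gt_cases (l * M + S p) n) as [Hc|Hc].
      * specialize (IH (S p) ltac:(lia) ltac:(lia)).
        assert (0 <= (19 / 20) ^ S p) by (apply pow_le; lra); nra.
      * specialize (IH p ltac:(lia) ltac:(lia)).
        assert (Hs : Cmod (blaschke (node n) (cusp z)) ^ 2 <= 19 / 20).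
        { apply blaschke_cusp_small; [pose proof (tau_gt_1 n); lra | exact Hz|].
          pose proof (tau_block l n ltac:(simpl; lia)); lra. }
        change ((19 / 20) ^ S p) with (19 / 20 * (19 / 20) ^ p).
        rewrite (Rmult_comm (19 / 20)); now apply Rmult_le_compat.
Qed.

(** Either [x < 2^L] lies in one of the [L] dyadic ranges, and its block of [M] nodes
    gives [(19 / 20)^M <= exp (- M / 20)]; or [x >= 2^L >= M] is so far out in
    the cusp that the right-hand side is at least [1]. *)
Lemma blaschke_prod_small (L n : nat) (z : C) : in_disk z ->
  (M * L <= n)%nat -> INR M <= 2 ^ L ->
  Cmod (blaschke_prod node n (cusp z)) ^ 2 <=
  exp ((1 - INR M) / 20) * exp ((Re (cusp2 z) - 1) / 20).
Proof.
  intros Hz Hn HL; destruct (cusp2_half_strip z Hz) as [Hx _].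
  rewrite <- exp_plus.
  destruct (Rlt_dec (Re (cusp2 z)) (2 ^ L)) as [Hs|Hs].
  - destruct (dyadic_scale (Re (cusp2 z)) L) as (l & Hl & Hlx); [lra|].
    eapply Rle_trans; [apply (blaschke_prod_block z l n M Hz Hlx); nia|].
    apply Rle_trans with (exp (- (INR M / 20))); [|apply exp_mono; lra].
    replace (- (INR M / 20)) with (INR M * (- (1 / 20))) by field.
    assert (Hpow : forall k, exp (INR k * - (1 / 20)) = exp (- (1 / 20)) ^ k).
    { induction k as [|k IH]; [simpl; rewrite Rmult_0_l; apply exp_0|].
      rewrite S_INR, Rmult_plus_distr_r, exp_plus, IH, Rmult_1_l; simpl; ring. }
    rewrite Hpow; apply pow_incr; split; [lra|].
    pose proof (exp_ineq1_le (- (1 / 20))); lra.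
  - eapply Rle_trans; [now apply blaschke_prod_le_1|].
    apply exp_ge_1; lra.
Qed.

End Dyadic_Nodes.

Lemma log2_up_le (n : nat) : (2 <= n)%nat ->
  INR (Nat.log2_up n) * ln (INR 2) <= 2 * ln (INR n).
Proof.
  intros Hn; rewrite INR_2.
  destruct (Nat.log2_up_spec n) as [H _]; [lia|].
  set (l := Nat.log2_up n) in *.
  assert (Hl : INR (pred l) * ln 2 <= ln (INR n)).
  { rewrite <- (ln_exp (INR (pred l) * ln 2)), <- pow2_exp, <- INR_2, <- pow_INR.
    left; apply ln_increasing; [apply lt_0_INR, Nat.neq_0_lt_0, Nat.pow_nonzero; lia|].
    now apply lt_INR. }
  assert (H2 : ln 2 <= ln (INR n)).
  { apply ln_le; [lra|]; rewrite <- INR_2; now apply le_INR. }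
  pose proof ln2_pos.
  assert (INR l <= INR (pred l) + 1).
  { rewrite <- S_INR; apply le_INR; lia. }
  nra.
Qed.

(** About [log2 n] dyadic ranges have to be covered, which leaves about [n / log2 n]
    nodes for each; the error decays exponentially in that number. *)
Lemma cusp_approx_number_le : exists B, 0 < B /\ forall n : nat, (2 <= n)%nat ->
  Rbar_le (approx_number n (comp_op cusp))
          (B * exp (- (1 / 320) * INR n / ln (INR n))).
Proof.
  pose proof majorant_mean_pos as HG.
  exists (sqrt (8 * majorant_mean) * exp (1 / 20)); split.
  { apply Rmult_lt_0_compat; [apply sqrt_lt_R0; lra | apply exp_pos]. }
  intros n Hn.
  assert (HnN : exists N, n = S N) by (exists (pred n); lia).
  destruct HnN as [N HnN]; set (L := Nat.log2_up n); set (M := (N / L)%nat).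
  destruct (Nat.log2_up_spec n) as [_ HL]; [lia|]; fold L in HL.
  assert (HL1 : (1 <= L)%nat) by (apply Nat.log2_up_pos; lia).
  assert (HLN : (L <= N)%nat).
  { assert (L < n)%nat by (apply Nat.log2_up_lt_lin; lia); lia. }
  assert (HM : (1 <= M)%nat) by (apply Nat.div_le_lower_bound; lia).
  assert (HML : (M * L <= N)%nat) by (rewrite Nat.mul_comm; apply Nat.Div0.mul_div_le).
  assert (HMN : (M <= N)%nat) by nia.
  apply Rbar_le_trans with (sqrt (8 * exp ((1 - INR M) / 20) * majorant_mean)).
  - rewrite HnN; apply (approx_number_interp (node M) (node_range M HM) (node_inj M HM) N
             (exp ((1 - INR M) / 20))).
    intros z Hz; apply (blaschke_prod_small M HM L N z Hz HML).
    apply Rle_trans with (INR (2 ^ L)); [apply le_INR; lia|].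
    rewrite pow_INR, INR_2; lra.
  - simpl.
    replace (8 * exp ((1 - INR M) / 20) * majorant_mean)
      with (8 * majorant_mean * (exp ((1 - INR M) / 40) * exp ((1 - INR M) / 40)))
      by (rewrite <- exp_plus; replace ((1 - INR M) / 40 + (1 - INR M) / 40)
            with ((1 - INR M) / 20) by field; ring).
    rewrite sqrt_mult, sqrt_square; [|left; apply exp_pos | lra |].
    2:{ apply Rmult_le_pos; left; apply exp_pos. }
    rewrite Rmult_assoc, <- exp_plus.
    apply Rmult_le_compat_l; [apply sqrt_pos|]; apply exp_mono.
    assert (Hln : 0 < ln (INR n)).
    { rewrite <- ln_1; apply ln_increasing; [lra|].
      change 1 with (INR 1); apply lt_INR; lia. }
    pose proof (log2_up_le n Hn) as Hlog; fold L in Hlog; rewrite INR_2 in Hlog.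
    pose proof ln_lt_2 as Hl2.
    assert (HLr : INR L <= 4 * ln (INR n)) by (pose proof (pos_INR L); nra).
    assert (HMr : INR N <= (INR M + 1) * INR L).
    { rewrite <- S_INR, <- mult_INR; apply le_INR.
      pose proof (Nat.mul_succ_div_gt N L); unfold M; nia. }
    assert (Hnr : INR n <= 2 * INR N).
    { rewrite <- INR_2, <- mult_INR; apply le_INR; lia. }
    assert (H8 : INR n <= 8 * (INR M + 1) * ln (INR n)).
    { pose proof (pos_INR M).
      assert ((INR M + 1) * INR L <= (INR M + 1) * (4 * ln (INR n)))
        by (apply Rmult_le_compat_l; lra).
      lra. }
    assert (Hq : INR n / ln (INR n) <= 8 * (INR M + 1)).
    { apply Rmult_le_reg_r with (ln (INR n)); [exact Hln|].
      unfold Rdiv; rewrite Rmult_assoc, Rinv_l; lra. }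
    replace (- (1 / 320) * INR n / ln (INR n)) with (- (1 / 320) * (INR n / ln (INR n)))
      by (unfold Rdiv; ring).
    lra.
Qed.

(** * The lower bound *)

(** The order-preserving enumeration of the indices other than [p]. *)
Definition skip (p j : nat) : nat := if (j <? p)%nat then j else S j.

Lemma skip_lt (p j n : nat) : (j < n)%nat -> (skip p j < S n)%nat.
Proof. unfold skip; destruct (Nat.ltb_spec j p); lia. Qed.

Lemma csum_skip (u : nat -> C) (p n : nat) : (p <= n)%nat ->
  csum u (S n) = (u p + csum (fun j => u (skip p j)) n)%C.
Proof.
  intros Hp; replace n with (p + (n - p))%nat at 2 by lia.
  rewrite csum_add; replace (S n) with (p + S (n - p))%nat by lia.
  rewrite csum_add, csum_shift, Nat.add_0_r.
  rewrite (csum_ext (fun j => u (skip p j)) u p).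
  2:{ intros k Hk; unfold skip; destruct (Nat.ltb_spec k p); [reflexivity | lia]. }
  rewrite (csum_ext (fun k => u (skip p (p + k))) (fun k => u (p + S k)%nat)).
  2:{ intros k _; unfold skip; destruct (Nat.ltb_spec (p + k) p); [lia|].
      f_equal; lia. }
  ring.
Qed.

(** Gaussian elimination of the last equation. *)
Lemma underdetermined_system (k : nat) : forall (n : nat) (m : nat -> nat -> C),
  (k < n)%nat -> exists c : nat -> C,
    (exists j, (j < n)%nat /\ c j <> 0) /\
    forall i, (i < k)%nat -> csum (fun j => c j * m j i)%C n = 0.
Proof.
  induction k as [|k IH]; intros n m Hk.
  - exists (fun _ => RtoC 1); split; [|intros; lia].
    exists O; split; [lia | intros E; apply RtoC_inj in E; lra].
  - destruct (classic (exists p, (p < n)%nat /\ m p k <> 0)) as [(p & Hp & Hm)|Hno].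
    + destruct n as [|n]; [lia|].
      destruct (IH n (fun j i => m (skip p j) i - m (skip p j) k / m p k * m p i)%C)
        as (c & (j0 & Hj0 & Hc0) & Hc); [lia|].
      (* The pivot coefficient is forced by the last equation. *)
      set (t := csum (fun j => c j * m (skip p j) k)%C n).
      set (d := fun j => if (j =? p)%nat then (- (t / m p k))%C
                         else c (if (j <? p)%nat then j else pred j)).
      assert (Hds : forall j, d (skip p j) = c j).
      { intros j; unfold d, skip; destruct (Nat.ltb_spec j p).
        - destruct (Nat.eqb_spec j p); [lia|].
          destruct (Nat.ltb_spec j p); [reflexivity | lia].
        - destruct (Nat.eqb_spec (S j) p); [lia|].
          destruct (Nat.ltb_spec (S j) p); [lia | reflexivity]. }
      assert (Hdp : d p = (- (t / m p k))%C)
        by (unfold d; rewrite Nat.eqb_refl; reflexivity).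
      exists d; split.
      * exists (skip p j0); split; [now apply skip_lt | now rewrite Hds].
      * intros i Hi; rewrite (csum_skip _ p) by lia; rewrite Hdp.
        rewrite (csum_ext _ (fun j => c j * m (skip p j) i)%C)
          by (intros j _; rewrite Hds; reflexivity).
        destruct (Nat.eq_dec i k) as [->|Hik].
        -- fold t; field; exact Hm.
        -- specialize (Hc i ltac:(lia)).
           rewrite (csum_ext _ (fun j => c j * m (skip p j) i -
             (m p i / m p k) * (c j * m (skip p j) k))%C) in Hc
             by (intros j _; field; exact Hm).
           rewrite csum_minus, csum_scal in Hc; fold t in Hc.
           set (u := csum (fun j => c j * m (skip p j) i)%C n) in *.
           transitivity (u - m p i / m p k * t)%C; [field; exact Hm | exact Hc].
    + destruct (IH n m) as (c & Hc0 & Hc); [lia|].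
      exists c; split; [exact Hc0|]; intros i Hi.
      destruct (Nat.eq_dec i k) as [->|Hik]; [|apply Hc; lia].
      rewrite (csum_ext _ (fun _ => RtoC 0)), csum_zero; [reflexivity|].
      intros j Hj; destruct (classic (m j k = 0)) as [E|E]; [rewrite E; ring|].
      exfalso; apply Hno; exists j; auto.
Qed.

Lemma max_modulus_index (c : nat -> C) (n : nat) : (0 < n)%nat ->
  exists i, (i < n)%nat /\ forall j, (j < n)%nat -> Cmod (c j) <= Cmod (c i).
Proof.
  intros Hn; induction n as [|n IH]; [lia|].
  destruct n as [|n].
  - exists O; split; [lia|]; intros j Hj; replace j with O by lia; lra.
  - destruct IH as (i & Hi & H); [lia|].
    destruct (Rle_dec (Cmod (c i)) (Cmod (c (S n)))) as [Hc|Hc].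
    + exists (S n); split; [lia|]; intros j Hj.
      destruct (Nat.eq_dec j (S n)) as [->|]; [lra|].
      specialize (H j ltac:(lia)); lra.
    + exists i; split; [lia|]; intros j Hj.
      destruct (Nat.eq_dec j (S n)) as [->|]; [lra | apply H; lia].
Qed.

Lemma linear_op_csum (T : op) (f : nat -> C -> C) (c : nat -> C) (n : nat) (z : C) :
  linear_op T -> (forall j, (j < n)%nat -> in_H2 (f j)) -> in_disk z ->
  T (fun w => csum (fun j => c j * f j w)%C n) z = csum (fun j => c j * T (f j) z)%C n.
Proof.
  intros HS Hf Hz.
  assert (H0 : T (fun _ => RtoC 0) z = 0).
  { pose proof (HS (fun _ => RtoC 0) (fun _ => RtoC 0) (RtoC 1)
      (h2_le_in_H2 _ _ h2_le_zero) (h2_le_in_H2 _ _ h2_le_zero) z Hz) as E.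
    cbv beta in E.
    replace (fun _ : C => (1 * 0 + 0)%C) with (fun _ : C => RtoC 0) in E
      by (apply functional_extensionality; intros; ring).
    set (v := T (fun _ => RtoC 0) z) in *.
    transitivity ((1 * v + v) - v)%C; [ring | rewrite <- E; ring]. }
  assert (Hsum : forall m, (m <= n)%nat ->
    in_H2 (fun w => csum (fun j => c j * f j w)%C m)).
  { intros m Hm.
    assert (Hb : exists K, forall j, (j < m)%nat -> h2_le (fun w => c j * f j w)%C K).
    { induction m as [|m IH]; [exists 0; intros; lia|].
      destruct IH as [K HK]; [lia|].
      destruct (h2_le_of_in_H2 (f m)) as [L HL]; [apply Hf; lia|].
      exists (Rmax K (Cmod (c m) ^ 2 * L)); intros j Hj.
      destruct (Nat.eq_dec j m) as [->|].
      - eapply h2_le_weaken; [apply h2_le_scal; exact HL | apply Rmax_r].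
      - eapply h2_le_weaken; [apply HK; lia | apply Rmax_l]. }
    destruct Hb as [K HK].
    eapply h2_le_in_H2, (h2_le_csum (fun j w => c j * f j w)%C K m HK). }
  assert (Hind : forall m, (m <= n)%nat ->
    T (fun w => csum (fun j => c j * f j w)%C m) z = csum (fun j => c j * T (f j) z)%C m).
  { induction m as [|m IH]; intros Hm; [exact H0|].
    replace (fun w => csum (fun j => c j * f j w)%C (S m))
      with (fun w => c m * f m w + (fun w => csum (fun j => c j * f j w) m) w)%C
      by (apply functional_extensionality; intros; simpl; ring).
    rewrite HS, IH; [simpl; ring | lia | apply Hf; lia | apply Hsum; lia | exact Hz]. }
  apply Hind; lia.
Qed.

(** If [n] functions of norm at most [1] take, after composition, diagonal values
    at [n] points of the disk, then every operator of rank [< n] annihilates a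
    combination of them on which the composition operator stays large. *)
Lemma approx_number_ge (phi : C -> C) (n : nat) (f : nat -> C -> C) (z : nat -> C)
    (b g : R) :
  (0 < n)%nat -> 0 <= b -> 0 <= g ->
  (forall j, (j < n)%nat -> h2_le (f j) 1) ->
  (forall i, (i < n)%nat -> in_disk (z i) /\ g <= 1 - Cmod (z i) ^ 2) ->
  (forall i j, (i < n)%nat -> (j < n)%nat -> i <> j -> f j (phi (z i)) = 0) ->
  (forall i, (i < n)%nat -> b <= Cmod (f i (phi (z i)))) ->
  Rbar_le (b * sqrt g / INR n) (approx_number n (comp_op phi)).
Proof.
  intros Hn Hb Hg Hf Hz Hoff Hdiag.
  apply (proj2 (Rbar_glb_spec _)).
  intros D (T & (HS1 & HS2 & HS3) & (k & e & Hk & He & HS) & ->).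
  assert (Hf2 : forall j, (j < n)%nat -> in_H2 (f j))
    by (intros j Hj; eapply h2_le_in_H2, Hf, Hj).
  assert (Hm : exists m : nat -> nat -> C, forall j, (j < n)%nat ->
    forall w, in_disk w ->
      T (f j) w = csum (fun i => m j i * e (S i) w)%C k).
  { assert (Hi : forall j, exists mj : nat -> C, (j < n)%nat ->
      forall w, in_disk w -> T (f j) w = csum (fun i => mj i * e (S i) w)%C k).
    { intros j; destruct (Compare_dec.lt_dec j n) as [Hj|Hj].
      - destruct (HS (f j) (Hf2 j Hj)) as [c Hc].
        exists (fun i => c (S i)); intros _ w Hw; rewrite (Hc w Hw).
        clear; induction k as [|k IH]; [now rewrite sum_n_m_zero by lia|].
        rewrite sum_n_Sm, IH by lia; reflexivity.
      - exists (fun _ => RtoC 0); intros; contradiction. }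
    exists (fun j => proj1_sig (constructive_indefinite_description _ (Hi j))).
    intros j; exact (proj2_sig (constructive_indefinite_description _ (Hi j))). }
  destruct Hm as [m Hm].
  (* Fewer than [n] linear conditions on [n] coefficients; normalise the largest
     coefficient to modulus [1 / n], so that the combination has norm at most [1]. *)
  destruct (underdetermined_system k n m Hk) as (c & (j0 & Hj0 & Hc0) & Hc).
  destruct (max_modulus_index c n Hn) as (i0 & Hi0 & Hmax).
  assert (Hn' : 0 < INR n) by now apply lt_0_INR.
  assert (Hci : 0 < Cmod (c i0)).
  { apply Cmod_gt_0 in Hc0; specialize (Hmax j0 Hj0); lra. }
  assert (Hci0 : c i0 <> 0) by now apply Cmod_gt_0.
  assert (HnC : RtoC (INR n) <> 0) by (intros H; apply RtoC_inj in H; lra).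
  set (d := fun j => (c j / (INR n * c i0))%C).
  assert (Hd : forall j, (j < n)%nat -> Cmod (d j) <= / INR n).
  { intros j Hj; unfold d; rewrite Cmod_div by now apply Cmult_neq_0.
    rewrite Cmod_Rscal by lra.
    apply Rmult_le_reg_r with (INR n * Cmod (c i0)); [now apply Rmult_lt_0_compat|].
    unfold Rdiv; rewrite Rmult_assoc, Rinv_l, <- Rmult_assoc, Rinv_l by nra.
    specialize (Hmax j Hj); lra. }
  assert (Hdi : Cmod (d i0) = / INR n).
  { unfold d; rewrite Cmod_div by now apply Cmult_neq_0.
    rewrite Cmod_Rscal by lra; field; lra. }
  set (G := fun w => csum (fun j => d j * f j w)%C n).
  assert (HG : h2_le G 1).
  { replace 1 with (INR n ^ 2 * (/ INR n) ^ 2) by (field; lra).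
    apply (h2_le_csum (fun j w => d j * f j w)%C); intros j Hj.
    apply (h2_le_weaken _ (Cmod (d j) ^ 2 * 1)); [now apply h2_le_scal, Hf|].
    rewrite Rmult_1_r; apply pow_incr; split; [apply Cmod_ge_0 | now apply Hd]. }
  assert (HSG : forall w, in_disk w -> T G w = 0).
  { intros w Hw; unfold G; rewrite linear_op_csum by assumption.
    rewrite (csum_ext _ (fun j => csum (fun i => d j * (m j i * e (S i) w))%C k))
      by (intros j Hj; rewrite (Hm j Hj w Hw), <- csum_scal; reflexivity).
    rewrite csum_swap, (csum_ext _ (fun _ => RtoC 0)), csum_zero; [reflexivity|].
    intros i Hi.
    rewrite (csum_ext _ (fun j => e (S i) w / (INR n * c i0) * (c j * m j i))%C)
      by (intros j _; unfold d; field; auto).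
    rewrite csum_scal, (Hc i Hi); ring. }
  eapply Rbar_le_trans; [|apply op_norm_ge, HG].
  apply H2_norm_ge; intros K HK.
  destruct (Hz i0 Hi0) as [Hzd Hzg].
  pose proof (h2_eval _ K _ HK Hzd) as Hev.
  assert (E : op_sub (comp_op phi) T G (z i0) = (d i0 * f i0 (phi (z i0)))%C).
  { unfold op_sub, comp_op; rewrite HSG by exact Hzd; unfold G.
    rewrite (csum_single _ n i0 Hi0); [ring|].
    intros j Hj Hji; rewrite Hoff by auto; ring. }
  rewrite E, Cmod_mult, Hdi in Hev.
  assert (Hbound : b * / INR n <= / INR n * Cmod (f i0 (phi (z i0)))).
  { rewrite Rmult_comm; apply Rmult_le_compat_l;
      [left; now apply Rinv_0_lt_compat | now apply Hdiag]. }
  assert (Hbn : 0 <= b * / INR n)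
    by (apply Rmult_le_pos; [exact Hb | left; now apply Rinv_0_lt_compat]).
  set (y := / INR n * Cmod (f i0 (phi (z i0)))) in *.
  replace (b * sqrt g / INR n) with (sqrt ((b * / INR n) ^ 2 * g)).
  - apply sqrt_le_1_alt; eapply Rle_trans; [|exact Hev].
    apply Rmult_le_compat; [apply pow2_ge_0 | exact Hg | | exact Hzg].
    apply pow_incr; lra.
  - rewrite sqrt_mult, sqrt_pow2; [unfold Rdiv; ring | exact Hbn | apply pow2_ge_0 | exact Hg].
Qed.

(** The square root of [to_half_plane z] runs over the unit circle as [z] runs over the
    real diameter; the choice below makes [cusp0 z] equal to [r]. *)
Lemma cusp_real_preimage (t : R) : 2 <= t -> exists z : C,
  in_disk z /\ cusp z = (1 - 1 / RtoC t)%C /\ exp (- (2 * t)) <= 1 - Cmod z ^ 2.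
Proof.
  intros Ht; set (r := exp (- (PI / 2 * (t - 1)))).
  pose proof PI2_3_2 as HPI3; pose proof PI_4 as HPI4.
  assert (Hr0 : 0 < r) by apply exp_pos.
  assert (Hr1 : r <= / 2).
  { unfold r; rewrite exp_Ropp; apply Rinv_le_contravar; [lra|].
    pose proof (exp_ineq1_le (PI / 2 * (t - 1))); nra. }
  set (D := 1 + r ^ 2).
  assert (HD : 1 < D <= 5 / 4) by (unfold D; split; nra).
  set (x := 2 * r / D); set (y := (1 - r ^ 2) / D).
  assert (Hxy : x ^ 2 + y ^ 2 = 1) by (unfold x, y, D in *; field; lra).
  assert (Hx : 0 < x) by (apply Rdiv_lt_0_compat; lra).
  assert (Hy : 0 < y) by (apply Rdiv_lt_0_compat; nra).
  set (sg := 2 * (x * y)); set (c := x ^ 2 - y ^ 2).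
  assert (Hcs : c ^ 2 + sg ^ 2 = 1).
  { unfold c, sg; replace ((x ^ 2 - y ^ 2) ^ 2 + (2 * (x * y)) ^ 2)
      with ((x ^ 2 + y ^ 2) ^ 2) by ring.
    rewrite Hxy; ring. }
  assert (Hsg : 0 < sg) by (unfold sg; nra).
  assert (Hsg1 : sg <= 1) by nra.
  assert (Hsgr : r <= sg).
  { unfold sg, x, y; replace (2 * (2 * r / D * ((1 - r ^ 2) / D)))
      with (r * (4 * (1 - r ^ 2) / D ^ 2)) by (field; lra).
    rewrite <- (Rmult_1_r r) at 1; apply Rmult_le_compat_l; [lra|].
    apply Rmult_le_reg_r with (D ^ 2); [nra|].
    unfold Rdiv; rewrite Rmult_assoc, Rinv_l by nra; nra. }
  set (z := - c / (1 + sg)).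
  assert (Hz : 1 - z ^ 2 = 2 * sg / (1 + sg)).
  { unfold z; replace ((- c / (1 + sg)) ^ 2) with (c ^ 2 / (1 + sg) ^ 2) by (field; lra).
    replace (c ^ 2) with ((1 - sg) * (1 + sg)) by lra; field; lra. }
  assert (Hzs : sg <= 1 - z ^ 2).
  { rewrite Hz; apply Rmult_le_reg_r with (1 + sg); [lra|].
    unfold Rdiv; rewrite Rmult_assoc, Rinv_l by lra; nra. }
  assert (Hzd : in_disk (RtoC z)).
  { unfold in_disk; rewrite Cmod_R; apply Rabs_lt_between; split; nra. }
  set (s := (x, y) : C).
  assert (Hup : (s * s = to_half_plane z)%C).
  { unfold to_half_plane.
    assert (Hden : (Ci * z - 1)%C <> 0).
    { intros H; apply (f_equal Re) in H; unfold Re, Ci, RtoC in H; simpl in H; lra. }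
    assert (Hcz : c * z = sg - 1).
    { unfold z; replace (c * (- c / (1 + sg))) with (- (c ^ 2) / (1 + sg)) by (field; lra).
      replace (c ^ 2) with ((1 - sg) * (1 + sg)) by lra; field; lra. }
    assert (Hsz : sg * z = - c - z) by (unfold z; field; lra).
    assert (E : ((s * s) * (Ci * z - 1) = z - Ci)%C).
    { unfold s, Ci, RtoC, Cmult, Cminus, Cplus, Copp; simpl.
      f_equal.
      - transitivity (- c - sg * z); [unfold c, sg; ring | lra].
      - transitivity (c * z - sg); [unfold c, sg; ring | lra]. }
    rewrite <- E; field; exact Hden. }
  assert (Hq : to_quadrant z = s)
    by (apply Csqrt_unique; [unfold s, Re; simpl; exact Hx | exact Hup]).
  assert (H0 : cusp0 z = RtoC r).
  { change (cusp0 z) with ((to_quadrant z - Ci) / (- Ci * to_quadrant z + 1))%C; rewrite Hq.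
    assert (Hden : (- Ci * s + 1)%C <> 0).
    { intros H; apply (f_equal Re) in H; unfold Re, s, Ci, RtoC in H; simpl in H; lra. }
    assert (E : (RtoC r * (- Ci * s + 1) = s - Ci)%C).
    { unfold s, Ci, RtoC, Cmult, Cminus, Cplus, Copp, x, y, D; simpl.
      unfold D in HD; f_equal; field; lra. }
    rewrite <- E; field; exact Hden. }
  assert (H2 : cusp2 z = RtoC t).
  { rewrite cusp2_coords, H0, Cmod_R, Rabs_pos_eq, Carg_atan by (try (simpl; exact Hr0); lra).
    unfold Re, Im, RtoC; simpl; f_equal.
    - unfold r; rewrite ln_exp; field; lra.
    - replace (0 / r) with 0 by (field; lra); rewrite atan_0; ring. }
  exists (RtoC z); split; [exact Hzd|]; split.
  - unfold cusp, cusp3; rewrite H2; reflexivity.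
  - rewrite Cmod_R, pow2_abs; eapply Rle_trans; [|exact Hzs].
    eapply Rle_trans; [|exact Hsgr]; apply exp_mono; nra.
Qed.

(** * Separation of the interpolation points *)

Fixpoint rprod (u : nat -> R) (n : nat) : R :=
  match n with O => 1 | S m => rprod u m * u m end.

Lemma rprod_pos (u : nat -> R) (n : nat) : (forall k, 0 < u k) -> 0 < rprod u n.
Proof. intros H; induction n as [|n IH]; simpl; [lra | now apply Rmult_lt_0_compat]. Qed.

Lemma rprod_le (u v : nat -> R) (n : nat) :
  (forall k, (k < n)%nat -> 0 <= u k <= v k) -> 0 <= rprod u n <= rprod v n.
Proof.
  induction n as [|n IH]; intros H; simpl; [lra|].
  destruct IH as [H1 H2]; [intros; apply H; lia|].
  destruct (H n) as [H3 H4]; [lia|].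
  split; [now apply Rmult_le_pos | now apply Rmult_le_compat].
Qed.

Lemma rprod_add (u : nat -> R) (m n : nat) :
  rprod u (m + n) = rprod u m * rprod (fun k => u (m + k)%nat) n.
Proof.
  induction n as [|n IH].
  - rewrite Nat.add_0_r; simpl; ring.
  - rewrite Nat.add_succ_r; simpl; rewrite IH; ring.
Qed.

Lemma rprod_exp (u : nat -> R) (n : nat) :
  rprod (fun k => exp (u k)) n = exp (rsum u n).
Proof.
  induction n as [|n IH]; simpl; [now rewrite exp_0 | now rewrite IH, exp_plus].
Qed.

Section Separation.

Variable M : nat.
Hypothesis HM : (1 <= M)%nat.

(** [2^(-k/M)]. *)
Definition rho (k : nat) : R := exp (- (INR k / INR M * ln 2)).

(** A lower bound for the pseudohyperbolic distance of two points of [(0, 1)] whose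
    distances to [1] have ratio [2^(k/M)]. *)
Definition sep (k : nat) : R := (1 - rho k) / (1 + rho k).

Definition sep_prod (n : nat) : R := rprod (fun k => sep (S k)) n.

Lemma rho_pow (k : nat) : rho k = rho 1 ^ k.
Proof.
  induction k as [|k IH].
  - unfold rho; simpl INR; simpl pow; rewrite <- exp_0; f_equal; unfold Rdiv; ring.
  - simpl pow; rewrite <- IH; unfold rho; rewrite <- exp_plus; f_equal.
    rewrite S_INR; simpl (INR 1); unfold Rdiv; ring.
Qed.

Lemma ln2_le_1 : ln 2 <= 1.
Proof.
  pose proof (exp_ineq1_le (ln 2)) as H; rewrite exp_ln in H; lra.
Qed.

(** [1 - exp (- y) >= y / (1 + y)] with [y = k ln 2 / M <= 1], and [ln 2 > 1 / 2]. *)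
Lemma rho_gap (k : nat) : (k <= M)%nat -> INR k / (4 * INR M) <= 1 - rho k.
Proof.
  intros Hk; pose proof (INR_M_pos M HM) as HMp.
  pose proof ln_lt_2; pose proof ln2_le_1.
  set (y := INR k / INR M * ln 2).
  assert (Hq : 0 <= INR k / INR M <= 1).
  { apply quotient_01_le; [|exact HMp]; split; [apply pos_INR | now apply le_INR]. }
  replace (INR k / (4 * INR M)) with (INR k / INR M / 4) by (field; lra).
  set (q := INR k / INR M) in *.
  assert (Hy : q / 2 <= y <= 1) by (unfold y; fold q; nra).
  unfold rho; fold q; fold y; rewrite exp_Ropp.
  pose proof (exp_ineq1_le y) as He.
  assert (Hi : / exp y <= / (1 + y)) by (apply Rinv_le_contravar; lra).
  assert (H1 : / (1 + y) = 1 - y / (1 + y)) by (field; lra).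
  assert (H2 : q / 4 <= y / (1 + y)); [|lra].
  apply Rmult_le_reg_r with (1 + y); [lra|].
  unfold Rdiv at 2; rewrite Rmult_assoc, Rinv_l by lra; nra.
Qed.

Lemma rho_range (k : nat) : (1 <= k)%nat -> 0 < rho k < 1.
Proof.
  intros Hk; split; [apply exp_pos|].
  rewrite <- exp_0; apply exp_increasing.
  pose proof (INR_M_pos M HM); pose proof ln2_pos.
  assert (0 < INR k / INR M) by (apply Rdiv_lt_0_compat; [apply lt_0_INR; lia | assumption]).
  nra.
Qed.

Lemma rho_half (k : nat) : (M <= k)%nat -> rho k <= / 2.
Proof.
  intros Hk; replace (/ 2) with (exp (- ln 2)) by (rewrite exp_Ropp, exp_ln; lra).
  apply exp_mono; pose proof (INR_M_pos M HM); pose proof ln2_pos.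
  assert (1 <= INR k / INR M).
  { apply Rle_div_r; [|rewrite Rmult_1_l; apply le_INR]; assumption. }
  nra.
Qed.

Lemma sep_range (k : nat) : (1 <= k)%nat -> 0 < sep k <= 1.
Proof.
  intros Hk; pose proof (rho_range k Hk); unfold sep; split.
  - apply Rdiv_lt_0_compat; lra.
  - apply quotient_01_le; lra.
Qed.

Lemma sep_near (k : nat) : (1 <= k <= M)%nat -> INR k / (8 * INR M) <= sep k.
Proof.
  intros Hk; pose proof (rho_range k ltac:(lia)); pose proof (INR_M_pos M HM).
  pose proof (rho_gap k ltac:(lia)) as Hg.
  assert (0 <= INR k / (4 * INR M))
    by (apply Rdiv_le_0_compat; [apply pos_INR | lra]).
  replace (INR k / (8 * INR M)) with (INR k / (4 * INR M) / 2) by (field; lra).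
  unfold sep; apply Rmult_le_reg_r with (1 + rho k); [lra|].
  unfold Rdiv at 3; rewrite Rmult_assoc, Rinv_l by lra; nra.
Qed.

Lemma sep_far (k : nat) : (M <= k)%nat -> exp (- 4 * rho k) <= sep k.
Proof.
  intros Hk; pose proof (rho_half k Hk); pose proof (rho_range k ltac:(lia)).
  replace (- 4 * rho k) with (- (4 * rho k)) by ring; rewrite exp_Ropp.
  apply Rle_trans with (/ (1 + 4 * rho k)).
  - apply Rinv_le_contravar; [lra | apply exp_ineq1_le].
  - unfold sep; apply Rmult_le_reg_r with ((1 + 4 * rho k) * (1 + rho k)); [nra|].
    replace (/ (1 + 4 * rho k) * ((1 + 4 * rho k) * (1 + rho k))) with (1 + rho k)
      by (field; lra).
    replace ((1 - rho k) / (1 + rho k) * ((1 + 4 * rho k) * (1 + rho k)))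
      with ((1 - rho k) * (1 + 4 * rho k)) by (field; lra).
    nra.
Qed.

Lemma sep_prod_pos (n : nat) : 0 < sep_prod n.
Proof. apply rprod_pos; intros k; apply sep_range; lia. Qed.

Lemma sep_prod_antitone (m n : nat) : sep_prod (m + n) <= sep_prod m.
Proof.
  induction n as [|n IH]; [rewrite Nat.add_0_r; lra|].
  rewrite Nat.add_succ_r.
  change (sep_prod (S (m + n))) with (sep_prod (m + n) * sep (S (m + n))).
  pose proof (sep_range (S (m + n)) ltac:(lia)); pose proof (sep_prod_pos (m + n)); nra.
Qed.

Lemma fact_rprod (n : nat) : rprod (fun k => INR (S k)) n = INR (Factorial.fact n).
Proof.
  induction n as [|n IH]; [reflexivity|].
  change (Factorial.fact (S n)) with (S n * Factorial.fact n)%nat.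
  rewrite mult_INR; cbn [rprod]; rewrite IH; ring.
Qed.

(** The product of [k / (8 M)] over [k <= M] is [M! / (8 M)^M], and
    [M^M / M! <= exp M] is one term of the exponential series. *)
Lemma sep_prod_near : exp (- 4 * INR M) <= sep_prod M.
Proof.
  pose proof (INR_M_pos M HM) as HMp.
  apply Rle_trans with (rprod (fun k => INR (S k) / (8 * INR M)) M).
  2:{ apply rprod_le; intros k Hk; split.
      - apply Rdiv_le_0_compat; [apply pos_INR | lra].
      - apply sep_near; lia. }
  assert (E : forall n, rprod (fun k => INR (S k) / (8 * INR M)) n =
    INR (Factorial.fact n) * / (8 * INR M) ^ n).
  { intros n; rewrite <- fact_rprod; induction n as [|n IH].
    - simpl; field.
    - cbn [rprod]; rewrite IH; cbn [pow].
      assert (8 * INR M <> 0) by lra.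
      assert ((8 * INR M) ^ n <> 0) by now apply pow_nonzero.
      field; split; [assumption | lra]. }
  rewrite E.
  assert (Hf : 0 < INR (Factorial.fact M)) by apply INR_fact_lt_0.
  assert (Ht : INR M ^ M / INR (Factorial.fact M) <= exp (INR M)).
  { eapply Rle_trans; [|apply (exp_ge_taylor (INR M) M); lra].
    assert (Hs : forall n, INR M ^ n / INR (Factorial.fact n) <=
      sum_f_R0 (fun k => INR M ^ k / INR (Factorial.fact k)) n).
    { assert (Hp : forall k, 0 <= INR M ^ k / INR (Factorial.fact k)).
      { intros k; apply Rdiv_le_0_compat; [apply pow_le; lra | apply INR_fact_lt_0]. }
      assert (Hsp : forall n, 0 <= sum_f_R0 (fun k => INR M ^ k / INR (Factorial.fact k)) n)
        by (intros n; now apply cond_pos_sum).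
      intros [|n]; [apply Rle_refl|].
      rewrite tech5; specialize (Hsp n); lra. }
    apply Hs. }
  assert (H8 : 8 ^ M <= exp (3 * INR M)).
  { assert (H2 : 8 <= exp 3).
    { replace 3 with (1 + 1 + 1) by ring; rewrite !exp_plus.
      pose proof (exp_ineq1_le 1).
      assert (2 * 2 <= exp 1 * exp 1) by (apply Rmult_le_compat; lra); nra. }
    assert (Hp : forall n, exp (3 * INR n) = exp 3 ^ n).
    { induction n as [|n IH]; [simpl; rewrite Rmult_0_r; apply exp_0|].
      rewrite S_INR, Rmult_plus_distr_l, exp_plus, IH, Rmult_1_r; simpl; ring. }
    rewrite Hp; apply pow_incr; lra. }
  rewrite Rpow_mult_distr.
  replace (- 4 * INR M) with (- (3 * INR M + INR M)) by ring.
  rewrite exp_Ropp, exp_plus.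
  assert (HMM : 0 < INR M ^ M) by now apply pow_lt.
  assert (H8p : 0 < 8 ^ M) by (apply pow_lt; lra).
  replace (INR (Factorial.fact M) * / (8 ^ M * INR M ^ M))
    with (/ (8 ^ M * (INR M ^ M / INR (Factorial.fact M)))) by (field; lra).
  apply Rinv_le_contravar.
  - apply Rmult_lt_0_compat; [exact H8p | now apply Rdiv_lt_0_compat].
  - apply Rmult_le_compat; try assumption; [lra | left; now apply Rdiv_lt_0_compat].
Qed.

(** For indices [k > M] the defects [rho k] form a convergent geometric series with
    sum of order [M], so the tail costs a second factor [exp (- c M)]. The bound
    is uniform in the number of points. *)
Lemma sep_prod_lower (n : nat) : exp (- 20 * INR M) <= sep_prod n.
Proof.
  eapply Rle_trans; [|apply (sep_prod_antitone n M)].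
  rewrite Nat.add_comm; unfold sep_prod; rewrite rprod_add; fold (sep_prod M).
  pose proof (INR_M_pos M HM) as HMp.
  replace (- 20 * INR M) with (- 4 * INR M + (- 16 * INR M)) by ring; rewrite exp_plus.
  apply Rmult_le_compat; [left; apply exp_pos | left; apply exp_pos | apply sep_prod_near|].
  apply Rle_trans with (rprod (fun k => exp (- 4 * rho (S (M + k)))) n).
  - rewrite rprod_exp, rsum_scal; apply exp_mono.
    assert (Hr := rho_range 1 ltac:(lia)).
    assert (Hs : rsum (fun k => rho (S (M + k))) n <= 4 * INR M).
    { apply Rle_trans with (rsum (fun k => rho 1 ^ k) n).
      - apply rsum_le; intros k _; rewrite rho_pow.
        replace (S (M + k)) with (S M + k)%nat by lia; rewrite pow_add.
        pose proof (pow_01 (rho 1) (S M) ltac:(lra)).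
        pose proof (pow_01 (rho 1) k ltac:(lra)); nra.
      - eapply Rle_trans; [apply rsum_geom_le; lra|].
        pose proof (rho_gap 1 ltac:(lia)) as Hg; simpl INR in Hg.
        replace (4 * INR M) with (/ (1 / (4 * INR M))) by (field; lra).
        apply Rinv_le_contravar; [apply Rdiv_lt_0_compat; lra | exact Hg]. }
    lra.
  - apply rprod_le; intros k _; split; [left; apply exp_pos | apply sep_far; lia].
Qed.

(** Coordinates [q] of the interpolation points [1 - 1 / q]; the factor [2] keeps
    them in the range [q >= 2] of [cusp_real_preimage]. *)
Definition point (j : nat) : R := 2 * tau M j.

Fixpoint off_prod (i n : nat) (w : C) : C :=
  match n with
  | O => RtoC 1
  | S j => if (j =? i)%nat then off_prod i j w
           else (off_prod i j w * blaschke (1 - / point j) w)%C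
  end.

Lemma point_ge_2 (j : nat) : 2 <= point j.
Proof. unfold point; pose proof (tau_gt_1 M HM j); lra. Qed.

Lemma point_node_range (j : nat) : 0 < 1 - / point j < 1.
Proof.
  pose proof (point_ge_2 j).
  assert (0 < / point j <= / 2).
  { split; [apply Rinv_0_lt_compat; lra | apply Rinv_le_contravar; lra]. }
  lra.
Qed.

Lemma h2_off_prod (i n : nat) : h2_le (off_prod i n) 1.
Proof.
  induction n as [|n IH].
  - eexists; split; [exact (taylor_const 1)|].
    intros [|N]; [simpl; lra|].
    induction N as [|N IHN]; [simpl; rewrite Cmod_1; lra|].
    rewrite rsum_S, Cmod_0; lra.
  - simpl; destruct (Nat.eqb_spec n i); [exact IH|].
    apply (h2_le_ext (fun w => blaschke (1 - / point n) w * off_prod i n w)%C);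
      [|intros; ring].
    apply h2_blaschke_mult; [apply point_node_range | exact IH].
Qed.

Lemma blaschke_at_point (i j : nat) :
  blaschke (1 - / point j) (1 - 1 / RtoC (point i)) =
  RtoC ((point i - point j) / (point i + point j - 1)).
Proof.
  pose proof (point_ge_2 i); pose proof (point_ge_2 j).
  assert (Hq : RtoC (point i) <> 0) by (intros E; apply RtoC_inj in E; lra).
  assert (Hd : (RtoC (point i) + RtoC (point j) - 1)%C <> 0).
  { rewrite <- RtoC_plus, <- RtoC_minus; intros E; apply RtoC_inj in E; lra. }
  rewrite blaschke_reflected by (auto; lra).
  rewrite RtoC_div, RtoC_minus, RtoC_minus, RtoC_plus by lra; reflexivity.
Qed.

Lemma off_prod_vanish (i j n : nat) : (j < n)%nat -> i <> j ->
  off_prod i n (1 - 1 / RtoC (point j)) = 0.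
Proof.
  intros Hj Hij; induction n as [|n IH]; [lia|]; simpl.
  destruct (Nat.eq_dec j n) as [->|Hn].
  - destruct (Nat.eqb_spec n i); [lia|].
    rewrite blaschke_at_point.
    replace ((point n - point n) / (point n + point n - 1)) with 0; [ring|].
    unfold Rdiv; ring.
  - rewrite IH by lia; destruct (n =? i)%nat; ring.
Qed.

Lemma tau_ratio (i k : nat) : tau M i = tau M (i + k) * rho k.
Proof.
  unfold tau, rho; rewrite <- exp_plus; f_equal.
  rewrite !S_INR, plus_INR; unfold Rdiv; ring.
Qed.

Lemma blaschke_sep (i j : nat) : i <> j ->
  sep ((i - j) + (j - i)) <= Cmod (blaschke (1 - / point j) (1 - 1 / RtoC (point i))).
Proof.
  intros Hij; rewrite blaschke_at_point, Cmod_R.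
  pose proof (point_ge_2 i); pose proof (point_ge_2 j).
  assert (Hmain : forall a b k, (1 <= k)%nat -> 2 <= point (a + k) -> b = (a + k)%nat ->
    sep k <= (point b - point a) / (point b + point a - 1)).
  { intros a b k Hk H2 ->; unfold point in *; rewrite (tau_ratio a k).
    pose proof (rho_range k Hk) as Hr; set (t := tau M (a + k)) in *.
    unfold sep; apply Rmult_le_reg_r with ((1 + rho k) * (2 * t + 2 * (t * rho k) - 1));
      [nra|].
    replace ((1 - rho k) / (1 + rho k) * ((1 + rho k) * (2 * t + 2 * (t * rho k) - 1)))
      with ((1 - rho k) * (2 * t + 2 * (t * rho k) - 1)) by (field; lra).
    replace ((2 * t - 2 * (t * rho k)) / (2 * t + 2 * (t * rho k) - 1) *
      ((1 + rho k) * (2 * t + 2 * (t * rho k) - 1)))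
      with ((2 * t - 2 * (t * rho k)) * (1 + rho k)) by (field; nra).
    nra. }
  destruct (Nat.lt_total i j) as [H1|[H1|H1]]; [|contradiction|].
  - replace ((i - j) + (j - i))%nat with (j - i)%nat by lia.
    eapply Rle_trans; [apply (Hmain i j (j - i)%nat); [lia | | lia]|].
    + replace (i + (j - i))%nat with j by lia; assumption.
    + rewrite <- Rabs_Ropp; eapply Rle_trans; [|apply Rle_abs].
      right; field; lra.
  - replace ((i - j) + (j - i))%nat with (i - j)%nat by lia.
    eapply Rle_trans; [apply (Hmain j i (i - j)%nat); [lia | | lia]|].
    + replace (j + (i - j))%nat with i by lia; assumption.
    + apply Rle_abs.
Qed.

(** The factors at the points [j < i] come with the distances [i, i - 1, ...] in
    decreasing order; the second factor holds those still to come. *)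
Lemma off_prod_before (i m : nat) : (m <= i)%nat ->
  sep_prod i <= Cmod (off_prod i m (1 - 1 / RtoC (point i))) * sep_prod (i - m).
Proof.
  induction m as [|m IH]; intros Hm.
  - simpl off_prod; rewrite Cmod_1, Nat.sub_0_r; lra.
  - simpl off_prod; destruct (Nat.eqb_spec m i) as [E|_]; [lia|].
    rewrite Cmod_mult; specialize (IH ltac:(lia)).
    pose proof (blaschke_sep i m ltac:(lia)) as Hb.
    replace ((i - m) + (m - i))%nat with (S (i - S m)) in Hb by lia.
    replace (i - m)%nat with (S (i - S m)) in IH by lia.
    change (sep_prod (S (i - S m))) with (sep_prod (i - S m) * sep (S (i - S m))) in IH.
    pose proof (sep_prod_pos (i - S m)).
    eapply Rle_trans; [exact IH|].
    rewrite Rmult_assoc; apply Rmult_le_compat_l; [apply Cmod_ge_0|].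
    rewrite Rmult_comm; apply Rmult_le_compat_r; lra.
Qed.

Lemma off_prod_after (i p : nat) :
  sep_prod i * sep_prod p <= Cmod (off_prod i (S i + p) (1 - 1 / RtoC (point i))).
Proof.
  induction p as [|p IH].
  - rewrite Nat.add_0_r; simpl off_prod; rewrite Nat.eqb_refl.
    pose proof (off_prod_before i i (le_n i)) as H; rewrite Nat.sub_diag in H.
    change (sep_prod 0) with 1 in *; lra.
  - rewrite Nat.add_succ_r; cbn [off_prod].
    destruct (Nat.eqb_spec (S i + p) i) as [E|_]; [lia|].
    rewrite Cmod_mult.
    pose proof (blaschke_sep i (S i + p) ltac:(lia)) as Hb.
    replace ((i - (S i + p)) + (S i + p - i))%nat with (S p) in Hb by lia.
    change (sep_prod (S p)) with (sep_prod p * sep (S p)).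
    rewrite <- Rmult_assoc.
    pose proof (sep_prod_pos i); pose proof (sep_prod_pos p).
    pose proof (sep_range (S p) ltac:(lia)).
    apply Rmult_le_compat; try lra; nra.
Qed.

Lemma off_prod_lower (i n : nat) : (i < n)%nat ->
  exp (- 40 * INR M) <= Cmod (off_prod i n (1 - 1 / RtoC (point i))).
Proof.
  intros Hi; replace n with (S i + (n - S i))%nat by lia.
  eapply Rle_trans; [|apply off_prod_after].
  replace (- 40 * INR M) with (- 20 * INR M + - 20 * INR M) by ring; rewrite exp_plus.
  apply Rmult_le_compat; try (left; apply exp_pos); apply sep_prod_lower.
Qed.

End Separation.

Lemma ln_le_2_sqrt (x : R) : 0 < x -> ln x <= 2 * sqrt x.
Proof.
  intros Hx; pose proof (sqrt_lt_R0 x Hx) as Hs.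
  rewrite <- (sqrt_sqrt x) at 1 by lra; rewrite ln_mult by assumption.
  pose proof (exp_ineq1_le (ln (sqrt x))) as H; rewrite exp_ln in H by exact Hs; lra.
Qed.

(** With [M] of order [n / log n], the [n] points [1 - 1 / q] reach up to [q] of order
    [sqrt n] at most. Separation costs [exp (- 40 M)]. The preimages [z] under
    the cusp map satisfy [1 - |z|^2 >= exp (- 4 sqrt n)]; the exponents [4 sqrt n] and
    [log n], the latter from the factor [1 / n], are also [O(n / log n)]. *)
Lemma cusp_approx_number_ge (n : nat) : (2 <= n)%nat ->
  Rbar_le (exp (- 140 * INR n / ln (INR n))) (approx_number n (comp_op cusp)).
Proof.
  intros Hn.
  set (x := INR n).
  assert (Hx : 2 <= x) by (unfold x; rewrite <- INR_2; now apply le_INR).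
  assert (Hln : 0 < ln x) by (rewrite <- ln_1; apply ln_increasing; lra).
  set (X := x / ln x).
  assert (HX1 : 1 <= X).
  { unfold X; apply Rle_div_r; [exact Hln|].
    pose proof (exp_ineq1_le (ln x)) as H; rewrite exp_ln in H; lra. }
  pose proof (sqrt_lt_R0 x ltac:(lra)) as Hs; pose proof (sqrt_sqrt x ltac:(lra)) as Hss.
  set (s := sqrt x) in *.
  assert (Hls : ln x <= 2 * s) by (apply ln_le_2_sqrt; lra).
  assert (HsX : s <= 2 * X).
  { unfold X; apply Rmult_le_reg_r with (ln x); [exact Hln|].
    replace (2 * (x / ln x) * ln x) with (2 * x) by (field; lra); nra. }
  assert (HlX : ln x <= 4 * X).
  { lra. }
  (* [M >= 2 X] makes [n / M <= log n / 2], hence [tau M j <= sqrt n]. *)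
  destruct (nfloor_ex (2 * X)) as [m Hm]; [lra|].
  set (M := S m).
  assert (HM : (1 <= M)%nat) by (unfold M; lia).
  assert (HMX : 2 * X <= INR M <= 3 * X) by (unfold M; rewrite S_INR; lra).
  assert (HMp : 0 < INR M) by lra.
  assert (Htau : forall j, (j < n)%nat -> tau M j <= s).
  { intros j Hj.
    replace s with (exp (ln s)) by (now apply exp_ln).
    apply exp_mono.
    assert (E2 : ln x = 2 * ln s) by (rewrite <- Hss at 1; rewrite ln_mult by assumption; ring).
    apply Rle_trans with (x / INR M * 1).
    - assert (Hjx : INR (S j) <= x) by (apply le_INR; lia).
      pose proof ln2_pos; pose proof ln2_le_1.
      apply Rmult_le_compat; try lra.
      + apply Rdiv_le_0_compat; [apply pos_INR | exact HMp].
      + apply Rmult_le_compat_r; [left; now apply Rinv_0_lt_compat | exact Hjx].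
    - apply Rmult_le_reg_r with (INR M); [exact HMp|].
      replace (x / INR M * 1 * INR M) with x by (field; lra).
      assert (x = X * ln x) by (unfold X; field; lra).
      assert (0 < ln s) by lra; nra. }
  assert (Hpt : forall j, exists z, in_disk z /\
    cusp z = (1 - 1 / RtoC (point M j))%C /\ exp (- (2 * point M j)) <= 1 - Cmod z ^ 2)
    by (intros j; apply cusp_real_preimage, point_ge_2, HM).
  set (z := fun j => proj1_sig (constructive_indefinite_description _ (Hpt j))).
  assert (Hz : forall j, in_disk (z j) /\
    cusp (z j) = (1 - 1 / RtoC (point M j))%C /\
    exp (- (2 * point M j)) <= 1 - Cmod (z j) ^ 2)
    by (intros j; exact (proj2_sig (constructive_indefinite_description _ (Hpt j)))).
  apply Rbar_le_trans with
    (exp (- 40 * INR M) * sqrt (exp (- (4 * s))) / INR n).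
  - replace (exp (- (4 * s))) with (exp (- (2 * s)) * exp (- (2 * s)))
      by (rewrite <- exp_plus; f_equal; ring).
    rewrite sqrt_square by (left; apply exp_pos).
    fold x; unfold Rdiv.
    replace (/ x) with (exp (- ln x)) by (rewrite exp_Ropp, exp_ln; lra).
    rewrite <- !exp_plus; apply exp_mono.
    replace (- 140 * x * / ln x) with (- 140 * X) by (unfold X, Rdiv; ring); lra.
  - apply (approx_number_ge cusp n (fun i => off_prod M i n) z); [lia | | | | | |].
    + left; apply exp_pos.
    + left; apply exp_pos.
    + intros; apply h2_off_prod, HM.
    + intros i Hi; destruct (Hz i) as (H1 & _ & H3); split; [exact H1|].
      eapply Rle_trans; [|exact H3]; apply exp_mono.
      specialize (Htau i Hi); unfold point; lra.
    + intros i j Hi Hj Hij; destruct (Hz i) as (_ & -> & _).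
      apply off_prod_vanish; auto.
    + intros i Hi; destruct (Hz i) as (_ & -> & _); now apply off_prod_lower.
Qed.

Theorem theorem4p3 :
  exists c1 c2 A B : R,
    c1 > c2 /\ c2 > 0 /\ A > 0 /\ B > 0 /\
    forall n : nat, (2 <= n)%nat ->
      Rbar_le (Finite (A * exp (- c1 * INR n / ln (INR n))))
              (approx_number n (comp_op cusp)) /\
      Rbar_le (approx_number n (comp_op cusp))
              (Finite (B * exp (- c2 * INR n / ln (INR n)))).
Proof.
  destruct cusp_approx_number_le as (B & HB & Hup).
  exists 140, (1 / 320), 1, B.
  split; [lra|]; split; [lra|]; split; [lra|]; split; [lra|].
  intros n Hn; split; [|now apply Hup].
  rewrite Rmult_1_l; now apply cusp_approx_number_ge.
Qed.
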